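(* Suppose $N$ is a quaternionic manifold. Then locally $N$ admits a positive definite QKT structure; that is, every point of $N$ has a neighbourhood on which the quaternionic structure $\mathcal G$ is part of a QKT structure $(g_N,\mathcal G,\nabla^N)$ with $g_N$ positive definite.
   Context: An almost quaternionic structure on a $4n$-manifold $N$ is a subbundle $\mathcal G\subset\mathrm{End}\,TN$ locally having a basis $\{I_N,J_N,K_N\}$ with $I_N^2=J_N^2=K_N^2=-1$, $I_NJ_N=K_N=-J_NI_N$ (a quaternion basis). $(N,\mathcal G)$ is a quaternionic manifold if it admits a torsion-free connection preserving $\mathcal G$; in dimension 4 one requires in addition self-duality ($W_-=0$, where $W_-$ is the part of the Weyl curvature of the induced conformal structure acting non-trivially on $\mathcal G$). QKT structure: a triple $(g_N,\mathcal G,\nabla^N)$ with $\mathcal G\subset\mathrm{End}\,TN$ an almost quaternionic structure on $N$ (a subbundle locally having a quaternion basis $\{I_N,J_N,K_N\}$), $g_N$ a metric Hermitian with respect to the elements $I_N,J_N,K_N$ of each local quaternion basis, and $\nabla^N$ a connection with $\nabla^Ng_N=0$ preserving $\mathcal G$ (so $\nabla^NI_N$ is a linear combination of $J_N$ and $K_N$, etc.), whose torsion tensor $c^N(A,B,C)=g_N(A,T^N(B,C))$, $T^N(B,C)=\nabla^N_BC-\nabla^N_CB-[B,C]$, is totally skew and of type $(2,1)+(1,2)$ with respect to each such $I_N$. *)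

(* Defs.v *)
From HB Require Import structures.
From mathcomp Require Import all_boot all_order all_algebra.
From mathcomp Require Import all_classical all_reals all_analysis.
From mathcomp Require Import complex.

Set Implicit Arguments.
Unset Strict Implicit.
Unset Printing Implicit Defensive.

Import Order.TTheory GRing.Theory Num.Theory.
Import numFieldNormedType.Exports.

Local Open Scope classical_set_scope.
Local Open Scope ring_scope.

Section Smooth.
Variables (R : realType) (E F : normedModType R).

(* For open U this is C^k on U in the usual sense (E is finite dimensional in
   all uses): directional derivatives up to order k exist and are continuous. *)
Fixpoint Ck_on (k : nat) (U : set E) (f : E -> F) : Prop :=
  (forall x, U x -> {for x, continuous f}) /\
  match k with
  | 0%N => True
  | k'.+1 => forall v : E,
      (forall x, U x -> derivable f x v) /\ Ck_on k' U ('D_v f)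
  end.

Definition smooth_on (U : set E) (f : E -> F) := forall k, Ck_on k U f.

End Smooth.

Section Jacobian.
Variables (R : realType) (m : nat).

Definition basis_vec (k : 'I_m) : 'cV[R]_m := delta_mx k 0.

(* Vectors are columns, so this is the transpose of the library's [jacobian]. *)
Definition jac (f : 'cV[R]_m -> 'cV[R]_m) (x : 'cV[R]_m) : 'M[R]_m :=
  \matrix_(a, b) ('D_(basis_vec b) f x) a 0.

Definition bilin (B : 'M[R]_m) (u v : 'cV[R]_m) : R := (u^T *m B *m v) 0 0.

End Jacobian.

(* A smooth manifold, given by a (not necessarily maximal) smooth atlas.
   Outside chart_dom i (resp. its image) the values of chart i (resp.
   chart_inv i) are irrelevant. *)
Record smoothManifold (R : realType) (m : nat) := SmoothManifold {
  points :> topologicalType;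
  chart_idx : Type;
  chart_dom : chart_idx -> set points;
  chart : chart_idx -> points -> 'cV[R]_m;
  chart_inv : chart_idx -> 'cV[R]_m -> points;
  points_hausdorff : hausdorff_space points;
  points_second_countable : @second_countable points;
  chart_cover : forall p, exists i, chart_dom i p;
  chart_dom_open : forall i, open (chart_dom i);
  chart_img_open : forall i, open (chart i @` chart_dom i);
  chartK : forall i p, chart_dom i p -> chart_inv i (chart i p) = p;
  chart_continuous : forall i p, chart_dom i p ->
    {for p, continuous (chart i)};
  chart_inv_continuous : forall i x, (chart i @` chart_dom i) x ->
    {for x, continuous (chart_inv i)};
  transition_smooth : forall i j,
    smooth_on (chart i @` (chart_dom i `&` chart_dom j))
              (chart j \o chart_inv i)
}.

Section ChartFields.
Variables (R : realType) (m : nat) (N : smoothManifold R m).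
Local Notation E := 'cV[R]_m.

(* Tensor fields, subbundles of End TN and connections are represented by
   their expressions in all charts, at the points of the chart images, subject
   to the classical transformation laws.  A field of endomorphisms is a field
   of matrices A acting by v |-> A *m v, a bilinear form is B with value
   u^T B v on (u, v). *)

Definition coord_img (V : set N) (i : chart_idx N) : set E :=
  chart i @` (V `&` chart_dom i).

Definition coord_open (V : set N) (i : chart_idx N) (W : set E) :=
  open W /\ W `<=` coord_img V i.

Definition transition (i j : chart_idx N) : E -> E := chart j \o chart_inv i.

Definition endo_subset := chart_idx N -> E -> set 'M[R]_m.
Definition bilinear_field := chart_idx N -> E -> 'M[R]_m.
(* (Gam i k x) a b is the Christoffel symbol Gamma^a_{k b} at x in chart i. *)
Definition christoffel := chart_idx N -> 'I_m -> E -> 'M[R]_m.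

Definition endo_subset_law (V : set N) (G : endo_subset) :=
  forall i j p, V p -> chart_dom i p -> chart_dom j p ->
    let J := jac (transition i j) (chart i p) in
    forall A, G i (chart i p) A <-> G j (chart j p) (J *m A *m invmx J).

Definition quaternion_relations (I J K : 'M[R]_m) :=
  [/\ I *m I = - 1%:M, J *m J = - 1%:M, K *m K = - 1%:M,
      I *m J = K & J *m I = - K].

Definition local_quaternion_basis (G : endo_subset) (V : set N)
    (i : chart_idx N) (W : set E) (I J K : E -> 'M[R]_m) :=
  [/\ coord_open V i W,
      [/\ smooth_on W I, smooth_on W J & smooth_on W K],
      (forall x, W x -> quaternion_relations (I x) (J x) (K x)) &
      (forall x, W x -> G i x =
         [set A | exists a b c, A = a *: I x + b *: J x + c *: K x])].

Definition almost_quaternionic (V : set N) (G : endo_subset) :=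
  endo_subset_law V G /\
  (forall i p, V p -> chart_dom i p -> exists W I J K,
     W (chart i p) /\ local_quaternion_basis G V i W I J K).

Definition is_metric (V : set N) (g : bilinear_field) :=
  [/\ (forall i, smooth_on (coord_img V i) (g i)),
      (forall i x, coord_img V i x -> (g i x)^T = g i x /\ g i x \in unitmx) &
      (forall i j p, V p -> chart_dom i p -> chart_dom j p ->
         let J := jac (transition i j) (chart i p) in
         g i (chart i p) = J^T *m g j (chart j p) *m J)].

Definition positive_definite (V : set N) (g : bilinear_field) :=
  forall i x, coord_img V i x ->
  forall v : E, v != 0 -> 0 < bilin (g i x) v v.

Definition hermitian (V : set N) (g : bilinear_field) (G : endo_subset) :=
  forall i W I J K, local_quaternion_basis G V i W I J K ->
  forall x, W x -> forall u v : E,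
    [/\ bilin (g i x) (I x *m u) (I x *m v) = bilin (g i x) u v,
        bilin (g i x) (J x *m u) (J x *m v) = bilin (g i x) u v &
        bilin (g i x) (K x *m u) (K x *m v) = bilin (g i x) u v].

(* In a chart, nabla_v = D_v + conn_mx v on vector fields. *)
Definition conn_mx (Gam : 'I_m -> E -> 'M[R]_m) (x v : E) : 'M[R]_m :=
  \sum_k v k 0 *: Gam k x.

(* The transformation law says that, when Y' \o tau = jac tau Y, one has
   nabla'_{jac tau v} Y' = jac tau (nabla_v Y), with tau the transition. *)
Definition is_connection (V : set N) (Gam : christoffel) :=
  (forall i k, smooth_on (coord_img V i) (Gam i k)) /\
  (forall i j p, V p -> chart_dom i p -> chart_dom j p ->
     let x := chart i p in let J := jac (transition i j) in
     forall v : E,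
       conn_mx (Gam j) (chart j p) (J x *m v) *m J x =
       J x *m conn_mx (Gam i) x v - 'D_v J x).

Definition nabla (Gam : 'I_m -> E -> 'M[R]_m) (X Y : E -> E) (x : E) : E :=
  'D_(X x) Y x + conn_mx Gam x (X x) *m Y x.

Definition bracket (X Y : E -> E) (x : E) : E :=
  'D_(X x) Y x - 'D_(Y x) X x.

Definition torsion Gam (X Y : E -> E) (x : E) : E :=
  nabla Gam X Y x - nabla Gam Y X x - bracket X Y x.

Definition nabla_endo (Gam : 'I_m -> E -> 'M[R]_m) (v : E)
    (A : E -> 'M[R]_m) (x : E) : 'M[R]_m :=
  'D_v A x + conn_mx Gam x v *m A x - A x *m conn_mx Gam x v.

Definition nabla_bilin (Gam : 'I_m -> E -> 'M[R]_m) (v : E)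
    (g : E -> 'M[R]_m) (x : E) : 'M[R]_m :=
  'D_v g x - (conn_mx Gam x v)^T *m g x - g x *m conn_mx Gam x v.

Definition torsion_free (V : set N) (Gam : christoffel) :=
  forall i W X Y, coord_open V i W -> smooth_on W X -> smooth_on W Y ->
  forall x, W x -> torsion (Gam i) X Y x = 0.

Definition preserves (V : set N) (Gam : christoffel) (G : endo_subset) :=
  forall i W A, coord_open V i W -> smooth_on W A ->
  (forall x, W x -> G i x (A x)) ->
  forall x v, W x -> G i x (nabla_endo (Gam i) v A x).

Definition metric_connection (V : set N) (Gam : christoffel)
    (g : bilinear_field) :=
  forall i x v, coord_img V i x -> nabla_bilin (Gam i) v (g i) x = 0.

(* Tensorial expressions are evaluated at a point by extending vectors to
   constant fields in the chart. *)
Definition torsion_form (Gam : 'I_m -> E -> 'M[R]_m) (g : E -> 'M[R]_m)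
    (x : E) (a b c : 'I_m) : R :=
  bilin (g x) (basis_vec R a)
    (torsion Gam (fun=> basis_vec R b) (fun=> basis_vec R c) x).

Definition curvature (Gam : 'I_m -> E -> 'M[R]_m) (X Y Z : E -> E) (x : E) : E :=
  nabla Gam X (nabla Gam Y Z) x - nabla Gam Y (nabla Gam X Z) x
  - nabla Gam (bracket X Y) Z x.

Section Weyl.
Variables (Gam : 'I_m -> E -> 'M[R]_m) (g : E -> 'M[R]_m) (x : E).

Definition curv_at (u v w : E) : E :=
  curvature Gam (fun=> u) (fun=> v) (fun=> w) x.

Definition ricci : 'M[R]_m :=
  \matrix_(b, c)
    \sum_a (curv_at (basis_vec R a) (basis_vec R b) (basis_vec R c)) a 0.

Definition scal : R := \tr (invmx (g x) *m ricci).

Definition schouten : 'M[R]_m :=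
  (m%:R - 2)^-1 *: (ricci - (scal / (2 * (m%:R - 1))) *: g x).

Definition weyl (u v w : E) : E :=
  let P := schouten in let Psharp := invmx (g x) *m P in
  curv_at u v w
  - (bilin P v w *: u - bilin P u w *: v
     + bilin (g x) v w *: (Psharp *m u) - bilin (g x) u w *: (Psharp *m v)).

Definition weyl_endo (u v : E) : 'M[R]_m :=
  \matrix_(a, b) (weyl u v (basis_vec R b)) a 0.

End Weyl.

(* For m = 4: orthogonal projection of so(4) = <I, J, K> + centraliser onto
   <I, J, K>; the latter has orthonormal basis I, J, K for -tr(AB)/4. *)
Definition quaternionic_part (I J K A : 'M[R]_m) : 'M[R]_m :=
  - 4^-1 *: (\tr (A *m I) *: I + \tr (A *m J) *: J + \tr (A *m K) *: K).

(* For m = 4: W_- = 0 for the conformal class of the positive definite metrics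
   Hermitian for G.  As W, as an endomorphism valued 2-form, is conformally
   invariant, all (local) metrics in the class give the same condition. *)
Definition self_dual (G : endo_subset) :=
  forall (V : set N) g Gam, open V ->
  is_metric V g -> positive_definite V g -> hermitian V g G ->
  is_connection V Gam -> torsion_free V Gam -> metric_connection V Gam g ->
  forall i W I J K, local_quaternion_basis G V i W I J K ->
  forall x, W x -> forall u v : E,
    quaternionic_part (I x) (J x) (K x)
      (weyl_endo (Gam i) (g i) x u v) = 0.

End ChartFields.

Section ThreeForms.
Variable m : nat.

Definition eval3 (C : comPzRingType) (c : 'I_m -> 'I_m -> 'I_m -> C)
    (u v w : 'cV[C]_m) : C :=
  \sum_i \sum_j \sum_k c i j k * u i 0 * v j 0 * w k 0.

Definition totally_skew (C : comPzRingType) (c : 'I_m -> 'I_m -> 'I_m -> C) :=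
  forall u v w, eval3 c v u w = - eval3 c u v w /\
                eval3 c u w v = - eval3 c u v w.

Variable R : realType.

(* v is a complexified vector of type (1,0) (b = true) or (0,1) (b = false) *)
Definition pure_vec (I : 'M[R]_m) (b : bool) (v : 'cV[R[i]]_m) :=
  map_mx (real_complex R) I *m v = (if b then 'i%C else - 'i%C) *: v.

Definition form_of_type (I : 'M[R]_m) (p q : nat)
    (al : 'I_m -> 'I_m -> 'I_m -> R[i]) :=
  totally_skew al /\
  forall (b1 b2 b3 : bool) u v w,
    pure_vec I b1 u -> pure_vec I b2 v -> pure_vec I b3 w ->
    ~ ((b1 + b2 + b3 = p)%N /\ (~~ b1 + ~~ b2 + ~~ b3 = q)%N) ->
    eval3 al u v w = 0.

Definition type_21_12 (I : 'M[R]_m) (c : 'I_m -> 'I_m -> 'I_m -> R) :=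
  exists al be, [/\ form_of_type I 2 1 al, form_of_type I 1 2 be &
    forall i j k, real_complex R (c i j k) = al i j k + be i j k].

End ThreeForms.

Section Quaternionic.
Variables (R : realType) (n : nat) (N : smoothManifold R (4 * n)%N).

Definition quaternionic_manifold (G : endo_subset N) :=
  [/\ almost_quaternionic setT G,
      (exists Gam : christoffel N,
         [/\ is_connection setT Gam, torsion_free setT Gam &
             preserves setT Gam G]) &
      (n = 1%N -> self_dual G)].

Definition QKT_structure (V : set N) (g : bilinear_field N)
    (G : endo_subset N) (Gam : christoffel N) :=
  [/\ almost_quaternionic V G, is_metric V g /\ hermitian V g G,
      is_connection V Gam, metric_connection V Gam g /\ preserves V Gam G &
      (forall i x, coord_img V i x ->
         totally_skew (torsion_form (Gam i) (g i) x)) /\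
      (forall i W I J K, local_quaternion_basis G V i W I J K ->
         forall x, W x -> type_21_12 (I x) (torsion_form (Gam i) (g i) x))].

End Quaternionic.

(* Main.v *)
Require Import Defs.
From HB Require Import structures.
From mathcomp Require Import all_boot all_order all_algebra.
From mathcomp Require Import all_classical all_reals all_analysis.
From mathcomp Require Import ring lra.
From mathcomp Require Import complex.

Set Implicit Arguments.
Unset Strict Implicit.
Unset Printing Implicit Defensive.

Import Order.TTheory GRing.Theory Num.Theory.
Import numFieldNormedType.Exports.

Local Open Scope classical_set_scope.
Local Open Scope ring_scope.

(** Take a torsion-free connection D preserving the bundle and, over a small
chart domain, a quaternion basis I, J, K.  The idea is to look for a Hermitian
metric g and then correct D by a field of endomorphisms A_v commuting with
I, J, K, so that the corrected connection still preserves the bundle.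

Put h_v = D_v g, a Hermitian form for each v ([nabla_havg]), and let t_I be the
3-form
  t_I(x, y, z) = - (h(Ix, y, Iz) + h(Iy, z, Ix) + h(Iz, x, Iy))
([torsion3]).  If t_I = t_J, then
  a(x, y, z) = (h(x, y, z) + h(y, x, z) - h(z, x, y) + t_I(x, y, z)) / 2
is invariant in its last two arguments under I and under J, hence under K; the
endomorphisms with g(A_x y, z) = a(x, y, z) commute with I, J, K, make g
parallel, and change the torsion from 0 to t_I ([contorsion3_inv],
[contorsion3_metric], [contorsion3_torsion]).  As A commutes with every almost
complex structure Q of the bundle, this 3-form is of type (2,1) + (1,2)
([type_of_invariant], [type_21_12_of]).  Everything is thus reduced to finding,
near a point, a positive definite Hermitian g with t_I = t_J; [chart_qkt_of] is
this reduction.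

In dimension 4 every Hermitian g will do: by trilinearity the identity is
tested on the basis e, Ie, Je, Ke ([torsion3_dim4]), and the average of the
standard form over I, J, K is a positive Hermitian metric.

In dimension m = 4n > 4 the metric is made from the curvature.  Let a_I, a_J,
a_K be the curvature forms of the rank 3 bundle ([sp1_curv]).  The connections
D + S_xi ([conn_shift]), xi a covector field, are again torsion-free and
preserve the bundle; a first choice of xi makes the induced connection on
volume forms flat, so that the Ricci form is symmetric.  The first Bianchi
identity then gives
  Ric(y, Iz) - Ric(z, Iy) = m a_I(y, z) + 2 (a_J(Ky, z) + a_J(y, Kz))
                            - 2 (a_K(Jy, z) + a_K(y, Jz))
and its cyclic permutations ([curv_eq_adapted]).  For m > 4 this linear system
forces a_I to be I-invariant ([curv_invariant]) and yields one symmetric form P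
with a_I(y, z) = P(y, Iz) - P(z, Iy), and the same for J, K ([ric_potE]).  The
second Bianchi identity for a_I becomes a cyclic identity for D P
([potential_bianchi]), and such an identity for I, J and K says precisely enough
for the Hermitian average g of P to satisfy t_I = t_J ([torsion3_herm_avg],
[potential_qkt]), because averaging commutes with D.

It remains to make g positive.  A further change by xi = - t (x - x0)^T keeps
the volume connection flat and adds t to P at x0 ([potential_radial]); for t
large g is positive definite at x0, hence near x0 ([chart_qkt_large]).

Finally, a neighbourhood contained in one chart is still met by all the other
charts: metric and contorsion are carried there by the Jacobians of the
transition maps, and the chain rule turns the chart statements into the
required ones. *)

(** Entrywise proofs of linear identities between matrices; the matrix products must
    be generalised first, so that they are atoms. *)
Ltac mx_ring := by apply/matrixP => ? ?; rewrite !mxE; ring.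
Ltac mx_field := by apply/matrixP => ? ?; rewrite !mxE; field.

(** * Linear maps on column vectors *)

Lemma cV_sum_basis (C : comPzRingType) m (v : 'cV[C]_m) :
  v = \sum_k v k 0 *: delta_mx k 0.
Proof.
apply/matrixP => i j; rewrite (ord1 j) summxE (bigD1 i) //= big1 => [|k ki].
  by rewrite !mxE !eqxx mulr1 addr0.
by rewrite !mxE eq_sym (negPf ki) mulr0.
Qed.

Lemma linear_form_sum (C : comPzRingType) m (f : 'cV[C]_m -> C) :
  (forall a u v, f (a *: u + v) = a * f u + f v) ->
  forall v, f v = \sum_k v k 0 * f (delta_mx k 0).
Proof.
move=> fl v; rewrite [in LHS](cV_sum_basis v).
have f0 : f 0 = 0.
  have := fl 1 0 0; rewrite scale1r addr0 mul1r => /eqP.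
  by rewrite -subr_eq0 opprD addrA subrr sub0r oppr_eq0 => /eqP.
by elim: (index_enum _) => [|k r IH]; rewrite ?big_nil // !big_cons fl IH.
Qed.

Section PlainLinear.
Context {R : pzRingType} {U V : lmodType R} {f : U -> V}.
Hypothesis f_lin : linear f.

Lemma lin_fun0 : f 0 = 0.
Proof. by have := f_lin 1 0 0; rewrite scale1r addr0 scale1r -[X in X = _]addr0 => /addrI. Qed.
Lemma lin_funD u v : f (u + v) = f u + f v.
Proof. by have := f_lin 1 u v; rewrite !scale1r. Qed.
Lemma lin_funZ a u : f (a *: u) = a *: f u.
Proof. by have := f_lin a u 0; rewrite lin_fun0 !addr0. Qed.
Lemma lin_funN u : f (- u) = - f u.
Proof. by rewrite -scaleN1r lin_funZ scaleN1r. Qed.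

End PlainLinear.

(** * Calculus of C^k maps *)

Lemma is_derive_line (R : realType) (E F : normedModType R) (f : E -> F) x v s :
  derivable f (s *: v + x) v ->
  is_derive s (1 : R) (fun t : R => f (t *: v + x)) ('D_v f (s *: v + x)).
Proof.
have eqg : (fun h : R => h^-1 *: (f ((h *: 1 + s) *: v + x) - f (s *: v + x)))
   = (fun h : R => h^-1 *: (f (h *: v + (s *: v + x)) - f (s *: v + x))).
  by apply/funext => h; rewrite scalerDl scaler1 addrA.
move=> df; split; first by rewrite /derivable /= eqg.
by rewrite /derive /= eqg.
Qed.

Section MeanValue.
Context {R : realType} {E : normedModType R}.
Implicit Types (f : E -> R) (x v : E).

(** The mean value theorem along the line through x in direction v, for increments
    of either sign. *)
Lemma mean_value f x v c :
  (forall s, `|s| <= `|c| -> derivable f (s *: v + x) v) ->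
  exists2 s, `|s| <= `|c| & f (c *: v + x) - f x = c * 'D_v f (s *: v + x).
Proof.
move=> df; pose g (t : R) := f (t *: v + x).
have g0 : g 0 = f x by rewrite /g scale0r add0r.
have gdf s : `|s| <= `|c| -> is_derive s (1 : R) g ('D_v f (s *: v + x)).
  by move=> /df; apply: is_derive_line.
have gc a b : (forall s, s \in `[a, b]%R -> `|s| <= `|c|) ->
    {within `[a, b], continuous g}.
  move=> ab; apply: derivable_within_continuous => s /ab sc.
  by have [] := gdf _ sc.
have [c0|c0] := leP 0 c.
- have ab s : s \in `[0, c]%R -> `|s| <= `|c|.
    by rewrite in_itv /= => /andP[s0 sc]; rewrite !ger0_norm.
  have [||s /ab sc] := @MVT_segment R g (fun s => 'D_v f (s *: v + x)) 0 c c0.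
  + by move=> s sc; apply/gdf/ab; apply: subset_itv_oo_cc sc.
  + exact: gc.
  by rewrite g0 subr0 mulrC => e; exists s.
- have ab s : s \in `[c, 0]%R -> `|s| <= `|c|.
    rewrite in_itv /= => /andP[s0 sc]; rewrite !ler0_norm ?(ltW c0)//.
    by rewrite lerN2.
  have [||s /ab sc] := @MVT_segment R g (fun s => 'D_v f (s *: v + x)) c 0 (ltW c0).
  + by move=> s sc; apply/gdf/ab; apply: subset_itv_oo_cc sc.
  + exact: gc.
  rewrite g0 => e; exists s => //; rewrite -/(g c).
  by rewrite -[LHS]opprB e sub0r mulrN opprK mulrC.
Qed.

End MeanValue.

Section Ck.
Context {R : realType} {E F : normedModType R}.
Implicit Types (U : set E) (f g : E -> F) (k : nat).

Lemma Ck_on_cont k U f x : Ck_on k U f -> U x -> {for x, continuous f}.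
Proof. by case: k => [|k] [cf _]; apply: cf. Qed.

Lemma Ck_on_derivable k U f x v : Ck_on k.+1 U f -> U x -> derivable f x v.
Proof. by move=> [_ /(_ v)[df _]]; apply: df. Qed.

Lemma Ck_on_derive k U f v : Ck_on k.+1 U f -> Ck_on k U ('D_v f).
Proof. by move=> [_ /(_ v)[_]]. Qed.

Lemma Ck_onW k U f : Ck_on k.+1 U f -> Ck_on k U f.
Proof.
elim: k f => [|k IH] f; first by case.
by move=> [cf df]; split=> // v; have [d1 d2] := df v; split=> //; apply: IH.
Qed.

Lemma Ck_on_sub k U U' f : U' `<=` U -> Ck_on k U f -> Ck_on k U' f.
Proof.
move=> sU; elim: k f => [|k IH] f [cf df]; split=> //.
- by move=> x /sU; exact: cf.
- by move=> x /sU; exact: cf.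
- move=> v; have [d1 d2] := df v; split=> [x /sU|]; [exact: d1|exact: IH].
Qed.

Lemma Ck_on_eq k U f g : open U -> (forall x, U x -> f x = g x) ->
  Ck_on k U f -> Ck_on k U g.
Proof.
move=> oU.
have near_fg f' g' : (forall x, U x -> f' x = g' x) ->
    forall x, U x -> {near x, f' =1 g'}.
  by move=> fg x Ux; apply: filterS (open_nbhs_nbhs (conj oU Ux)) => y; apply: fg.
have cont_fg f' g' : (forall x, U x -> f' x = g' x) ->
    (forall x, U x -> {for x, continuous f'}) ->
    forall x, U x -> {for x, continuous g'}.
  move=> fg cf x Ux; rewrite /prop_for /continuous_at -(fg x Ux).
  by apply: cvg_trans (cf x Ux); apply/near_eq_cvg/near_fg.
elim: k f g => [|k IH] f g fg [cf df]; split=> //; do ?exact: cont_fg cf.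
move=> v; have [d1 d2] := df v; split=> [x Ux|].
  by apply: near_eq_derivable (near_fg _ _ fg x Ux) (d1 x Ux).
by apply: IH d2 => x Ux; apply: near_eq_derive (near_fg _ _ fg x Ux).
Qed.

Lemma Ck_on_cst k U (a : F) : Ck_on k U (fun=> a).
Proof.
elim: k a => [|k IH] a; split=> //; do ?by move=> x _; exact: cvg_cst.
move=> v; split=> [x _|]; first exact: derivable_cst.
have -> : 'D_v (fun=> a : F) = (fun=> 0) :> (E -> F).
  by apply/funext => x; exact: derive_cst.
exact: IH.
Qed.

Lemma Ck_onD k U f g : open U -> Ck_on k U f -> Ck_on k U g ->
  Ck_on k U (fun x => f x + g x).
Proof.
move=> oU; elim: k f g => [|k IH] f g hf hg; split=> //;
  do ?by move=> x Ux; apply: cvgD; [exact: Ck_on_cont hf Ux|exact: Ck_on_cont hg Ux].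
move=> v; split=> [x Ux|].
  by apply: derivableD; [exact: Ck_on_derivable hf Ux|exact: Ck_on_derivable hg Ux].
apply: Ck_on_eq (IH _ _ (Ck_on_derive v hf) (Ck_on_derive v hg)) => // x Ux.
by rewrite deriveD //;
   [exact: Ck_on_derivable hf Ux|exact: Ck_on_derivable hg Ux].
Qed.

End Ck.

Section CkScalar.
Context {R : realType} {E : normedModType R}.
Implicit Types (U : set E) (f g : E -> R) (k : nat).

Lemma Ck_onM k U f g : open U -> Ck_on k U f -> Ck_on k U g ->
  Ck_on k U (fun x => f x * g x).
Proof.
move=> oU; elim: k f g => [|k IH] f g hf hg; split=> //;
  do ?by move=> x Ux; apply: cvgM; [exact: Ck_on_cont hf Ux|exact: Ck_on_cont hg Ux].
move=> v; split=> [x Ux|].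
  by apply: derivableM; [exact: Ck_on_derivable hf Ux|exact: Ck_on_derivable hg Ux].
apply: Ck_on_eq (Ck_onD oU (IH _ _ (Ck_onW hf) (Ck_on_derive v hg))
                           (IH _ _ (Ck_onW hg) (Ck_on_derive v hf))) => // x Ux.
by rewrite [RHS]deriveM //;
   [exact: Ck_on_derivable hf Ux|exact: Ck_on_derivable hg Ux].
Qed.

Lemma Ck_onV k U f : open U -> (forall x, U x -> f x != 0) -> Ck_on k U f ->
  Ck_on k U (fun x => (f x)^-1).
Proof.
move=> oU f0; elim: k f f0 => [|k IH] f f0 hf; split=> //;
  do ?by move=> x Ux; apply: cvgV; [exact: f0|exact: Ck_on_cont hf Ux].
move=> v; split=> [x Ux|].
  by apply: derivableV; [exact: f0|exact: Ck_on_derivable hf Ux].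
have hV := IH _ f0 (Ck_onW hf).
have h := Ck_onM oU (Ck_on_cst k U (-1 : R)) (Ck_onM oU (Ck_onM oU hV hV) (Ck_on_derive v hf)).
apply: Ck_on_eq h => // x Ux.
rewrite [RHS]deriveV ?f0 //; last exact: Ck_on_derivable hf Ux.
by rewrite /GRing.scale /= expr2 invfM mulN1r mulNr.
Qed.

End CkScalar.

(** * Differentiability of C^1 maps *)

Lemma derive_comp_diff (R : realType) (E E' F : normedModType R)
    (s : E' -> E) (f : E -> F) x v :
  differentiable f (s x) -> derivable s x v ->
  is_derive x v (f \o s) ('d f (s x) ('D_v s x)).
Proof.
move=> df ds; pose c (h : R) := s (h *: v + x).
have c0 : c 0 = s x by rewrite /c scale0r add0r.
have [dc ec] : is_derive (0 : R) (1 : R) c ('D_v s x).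
  by have := @is_derive_line R E' E s x v 0; rewrite scale0r add0r; apply.
have dfc : derivable (f \o c) 0 1.
  apply/derivable1_diffP; apply: differentiable_comp; first exact/derivable1_diffP.
  by rewrite c0.
have dfs : derivable (f \o s) x v by apply/derivable1P.
split=> //.
have [_ <-] : is_derive (0 : R) (1 : R) (f \o c) ('D_v (f \o s) x).
  by have := @is_derive_line R E' F (f \o s) x v 0; rewrite scale0r add0r; apply.
have dc' : differentiable c 0 by apply/derivable1_diffP.
rewrite deriveE; last by apply: differentiable_comp => //; rewrite c0.
by rewrite diff_comp ?c0 //= -ec deriveE.
Qed.

(** Differentiability from the increment estimate alone; the linear map is given as
    a bundled one so that it can be identified with the differential. *)
Lemma diff_intro (R : realType) (V W : normedModType R) (f : V -> W)
    (l : {linear V -> W}) x : continuous l ->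
  (forall e : R, 0 < e ->
     \forall h \near (0 : V), `|f (h + x) - f x - l h| <= e * `|h|) ->
  differentiable f x /\ 'd f x = l :> (V -> W).
Proof.
move=> lc fl; have lo : f \o shift x = cst (f x) + l +o_ 0 id.
  apply/eqaddoP => e e0; have := fl e e0.
  by apply: filterS => h; rewrite -addrA -opprD.
have dE := diff_unique lc lo.
by split=> //; apply/diff_locallyP; rewrite dE.
Qed.

Lemma Ck_on_sum (R : realType) (E F : normedModType R) k (U : set E) (I : Type)
    (r : seq I) (P : pred I) (f : I -> E -> F) :
  open U -> (forall i, Ck_on k U (f i)) -> Ck_on k U (fun x => \sum_(i <- r | P i) f i x).
Proof.
move=> oU hf; elim: r => [|i r IH].
  by apply: Ck_on_eq (Ck_on_cst k U 0) => // x _; rewrite big_nil.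
case: (boolP (P i)) => Pi.
  by apply: Ck_on_eq (Ck_onD oU (hf i) IH) => // x _; rewrite big_cons Pi.
by apply: Ck_on_eq IH => // x _; rewrite big_cons (negPf Pi).
Qed.

Lemma derive_coord (R : realType) p q (x v : 'M[R]_(p, q)) i j :
  is_derive x v (fun y : 'M[R]_(p, q) => y i j) (v i j).
Proof.
have d : derivable (id : 'M[R]_(p, q) -> _) x v by exact: derivable_id.
split; first by have /derivable_mxP := d; apply.
by have := derive_mx d; rewrite derive_id => /matrixP/(_ i j) ->; rewrite mxE.
Qed.

Lemma Ck_on_coord (R : realType) p q k (U : set 'M[R]_(p, q)) i j :
  Ck_on k U (fun y => y i j).
Proof.
have cc x : U x -> {for x, continuous (fun y : 'M[R]_(p, q) => y i j)}.
  by move=> _; exact: coord_continuous.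
case: k => [|k]; split=> // v; split=> [x _|]; first by have [] := derive_coord x v i j.
have -> : 'D_v (fun y : 'M[R]_(p, q) => y i j) = fun=> v i j.
  by apply/funext => x; have [_] := derive_coord x v i j.
exact: Ck_on_cst.
Qed.

Section MatrixValued.
Context {R : realType} {E : normedModType R} {p q : nat}.
Implicit Types (U : set E) (M : E -> 'M[R]_(p, q)).

Lemma continuous_mxP M x : {for x, continuous M} <->
  forall i j, {for x, continuous (fun y => M y i j)}.
Proof.
split=> [cM i j|cM].
  apply: (@continuous_comp _ _ _ M (fun A : 'M[R]_(p, q) => A i j)) => //.
  exact: coord_continuous.
apply/cvgrPdist_le => /= e e0; near=> y.
rewrite /Num.Def.normr/= mx_normrE (bigmax_le _ (ltW e0))//= => ij _.
rewrite !mxE/=; move: ij; near: y; apply: filter_forall => /= ij.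
by have /cvgrPdist_le := cM ij.1 ij.2; apply.
Unshelve. all: by end_near. Qed.

Lemma Ck_on_mxP k U M : open U ->
  Ck_on k U M <-> forall i j, Ck_on k U (fun x => M x i j).
Proof.
move=> oU; elim: k M => [|k IH] M.
  split=> [[cM _] i j|cM]; split=> // x Ux.
    by have /continuous_mxP := cM x Ux; apply.
  by apply/continuous_mxP => i j; have [c _] := cM i j; apply: c.
split=> [hM i j|hM]; split=> [x Ux|v].
- by have /continuous_mxP := Ck_on_cont hM Ux; apply.
- have dM x : U x -> derivable M x v by move=> Ux; exact: Ck_on_derivable hM Ux.
  split=> [x Ux|]; first by have /derivable_mxP := dM x Ux; apply.
  have /IH/(_ i j) := Ck_on_derive v hM.
  by apply: Ck_on_eq => // x Ux; rewrite derive_mx ?mxE //; exact: dM.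
- by apply/continuous_mxP => i j; exact: Ck_on_cont (hM i j) Ux.
- have dM x : U x -> derivable M x v.
    by move=> Ux; apply/derivable_mxP => i j; exact: Ck_on_derivable (hM i j) Ux.
  split=> //; apply/IH => i j; have := Ck_on_derive v (hM i j).
  by apply: Ck_on_eq => // x Ux; rewrite derive_mx ?mxE //; exact: dM.
Qed.

End MatrixValued.

Section Differentiability.
Context {R : realType} {m : nat}.
Local Notation E := 'cV[R]_m.
Implicit Types (U : set E) (f : E -> R).

Definition gradform f x (h : E) : R := \sum_k h k 0 * 'D_(basis_vec R k) f x.

Lemma gradform_linear f x : linear (gradform f x).
Proof.
move=> a u v; rewrite /gradform scaler_sumr -big_split; apply: eq_bigr => k _.
by rewrite !mxE mulrDl -mulrA.
Qed.

Lemma cV_norm_le (v : E) (c : R) : 0 <= c -> (forall i, `|v i 0| <= c) -> `|v| <= c.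
Proof.
move=> c0 vc; rewrite /Num.Def.normr/= mx_normrE (bigmax_le _ c0)//= => -[i j] _.
by rewrite (ord1 j).
Qed.

Lemma cV_entry_le (v : E) i : `|v i 0| <= `|v|.
Proof.
rewrite [leRHS]/Num.Def.normr/= mx_normrE.
exact: (le_bigmax _ (fun ij => `|v ij.1 ij.2|) (i, 0)).
Qed.

(** Used to move from x to h + x one coordinate at a time. *)
Definition trunc_vec (h : E) (k : nat) : E := \col_i (if (i < k)%N then h i 0 else 0).

(** Continuous partial derivatives give the first order expansion: telescope the
    increment over the coordinates and apply the mean value theorem to each step.
    The constant m + 1 rather than m avoids a division by zero when m = 0. *)
Lemma Ck_on_increment U f x (e : R) : open U -> Ck_on 1 U f -> U x -> 0 < e ->
  \forall h \near (0 : E), `|f (h + x) - f x - gradform f x h| <= e * `|h|.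
Proof.
move=> oU hf Ux e0.
have m0 : 0 < m.+1%:R :> R by rewrite ltr0n.
have near_x : \forall y \near x, U y /\
    forall k, `|'D_(basis_vec R k) f y - 'D_(basis_vec R k) f x| <= e / m.+1%:R.
  have closeD : \forall y \near x, forall k,
      `|'D_(basis_vec R k) f y - 'D_(basis_vec R k) f x| <= e / m.+1%:R.
    apply: (@filter_forall _ 'I_m (fun k y => `|'D_(basis_vec R k) f y - 'D_(basis_vec R k) f x| <= e / m.+1%:R) (nbhs x) _) => k.
    have /cvgrPdist_le := Ck_on_cont (Ck_on_derive (basis_vec R k) hf) Ux.
    move=> /(_ (e / m.+1%:R)) /(_ (divr_gt0 e0 m0)).
    by apply: filterS => y; rewrite distrC.
  by near=> y; split; near: y; first exact: open_nbhs_nbhs (conj oU Ux).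
have /nbhs_ballP[d /= d0 dP] := near_x.
apply/nbhs_ballP; exists d => //= h; rewrite -ball_normE /= sub0r normrN => hd.
have close (y : E) : (forall i, `|y i 0| <= `|h|) -> U (y + x) /\
    forall k, `|'D_(basis_vec R k) f (y + x) - 'D_(basis_vec R k) f x| <= e / m.+1%:R.
  move=> yh; apply: dP; rewrite -ball_normE /= opprD addrCA subrr addr0 normrN.
  by apply: le_lt_trans hd; apply: cV_norm_le.
suff step k : (k <= m)%N ->
    `|f (trunc_vec h k + x) - f x - \sum_(i < m | (i < k)%N) h i 0 * 'D_(basis_vec R i) f x|
      <= k%:R * (e / m.+1%:R * `|h|).
  have := step m (leqnn m).
  have -> : trunc_vec h m = h by apply/matrixP => i j; rewrite !mxE ltn_ord (ord1 j).
  have -> : \sum_(i < m | (i < m)%N) h i 0 * 'D_(basis_vec R i) f x = gradform f x h.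
    by apply: eq_bigl => i; rewrite ltn_ord.
  move=> /le_trans; apply; rewrite mulrA; apply: ler_wpM2r => //.
  rewrite mulrCA ger_pMr // ler_pdivrMr // mul1r ler_nat; exact: leqnSn.
elim: k => [_|k IH km].
  rewrite big_pred0 // mul0r.
  have -> : trunc_vec h 0 = 0 by apply/matrixP => i j; rewrite !mxE ltn0.
  by rewrite add0r !subrr normr0.
pose K := Ordinal km.
have -> : trunc_vec h k.+1 = h K 0 *: basis_vec R K + trunc_vec h k.
  apply/matrixP => i j; rewrite !mxE (ord1 j) eqxx andbT ltnS leq_eqVlt.
  rewrite -[i == K]/(val i == k); case: eqVneq => [ik|_] /=; last by rewrite mulr0 add0r.
  by rewrite ik ltnn addr0 mulr1; congr (h _ _); apply: val_inj.
have small s : `|s| <= `|h K 0| -> forall i,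
    `|(s *: basis_vec R K + trunc_vec h k) i 0| <= `|h|.
  move=> sh i; rewrite !mxE eqxx andbT -[i == K]/(val i == k).
  case: eqVneq => [->|_] /=.
    by rewrite ltnn addr0 mulr1 (le_trans sh) // cV_entry_le.
  by rewrite mulr0 add0r; case: ifP => _; rewrite ?normr0 ?cV_entry_le.
have [s sh] : exists2 s, `|s| <= `|h K 0| &
   f (h K 0 *: basis_vec R K + (trunc_vec h k + x)) - f (trunc_vec h k + x) =
   h K 0 * 'D_(basis_vec R K) f (s *: basis_vec R K + (trunc_vec h k + x)).
  apply: mean_value => s /small /close[Us _].
  by apply: Ck_on_derivable hf _; rewrite addrA.
rewrite !addrA => eqf.
have -> : \sum_(i < m | (i < k.+1)%N) h i 0 * 'D_(basis_vec R i) f x =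
    h K 0 * 'D_(basis_vec R K) f x +
    \sum_(i < m | (i < k)%N) h i 0 * 'D_(basis_vec R i) f x.
  rewrite (bigD1 K) ?leqnn //=; congr (_ + _); apply: eq_bigl => i.
  by rewrite ltnS [RHS]ltn_neqAle andbC.
have [_ /(_ K) Ds] := close _ (small s sh).
set S := \sum_(i < m | _) _ in IH *.
set D := 'D_(basis_vec R K) f x in Ds *.
have -> : f (h K 0 *: basis_vec R K + trunc_vec h k + x) - f x - (h K 0 * D + S) =
   h K 0 * ('D_(basis_vec R K) f (s *: basis_vec R K + trunc_vec h k + x) - D) +
   (f (trunc_vec h k + x) - f x - S) by rewrite mulrBr -eqf; ring.
apply: le_trans (ler_normD _ _) _; rewrite -natr1 mulrDl addrC mul1r.
apply: lerD; first exact: IH (ltnW km).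
by rewrite normrM mulrC; apply: ler_pM => //; exact: cV_entry_le.
Unshelve. all: by end_near. Qed.

Lemma Ck_on_differentiable U f x : open U -> Ck_on 1 U f -> U x ->
  differentiable f x /\ 'd f x = gradform f x :> (E -> R).
Proof.
move=> oU hf Ux.
pose L := GRing.isLinear.Build _ _ _ _ _ (gradform_linear f x).
pose l : {linear E -> R} := HB.pack (gradform f x) L.
have lc : continuous l.
  move=> y; have [/(_ y I) + _] : Ck_on 0 setT (gradform f x); last by [].
  apply: Ck_on_sum => [|k]; first exact: openT.
  by apply: Ck_onM; [exact: openT|exact: Ck_on_coord|exact: Ck_on_cst].
exact: (@diff_intro R E R f l x lc (fun e => Ck_on_increment oU hf Ux)).
Qed.

Lemma derive_gradform U f x v : open U -> Ck_on 1 U f -> U x -> 'D_v f x = gradform f x v.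
Proof.
by move=> oU hf Ux; have [df <-] := Ck_on_differentiable oU hf Ux; rewrite deriveE.
Qed.

End Differentiability.

(** * Symmetry of second derivatives and the chain rule *)

Lemma is_derive_translate (R : realType) (E F : normedModType R) (f : E -> F) a y v :
  derivable f (a + y) v -> is_derive y v (fun z => f (a + z)) ('D_v f (a + y)).
Proof.
have eqg : (fun h : R => h^-1 *: (f (a + (h *: v + y)) - f (a + y)))
   = (fun h : R => h^-1 *: (f (h *: v + (a + y)) - f (a + y))).
  by apply/funext => h; rewrite addrCA.
move=> df; split; first by rewrite /derivable /= eqg.
by rewrite /derive /= eqg.
Qed.

Section Schwarz.
Context {R : realType} {E : normedModType R}.
Implicit Types (U : set E) (f : E -> R).

(** Both iterated derivatives are compared with the second difference of f over
    the parallelogram spanned by t u and t v; two mean value steps express it by an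
    intermediate value of one of them. *)
Lemma second_difference U f x u v (t : R) : Ck_on 2 U f ->
  (forall s r, `|s| <= `|t| -> `|r| <= `|t| -> U (r *: v + (s *: u + x))) ->
  exists s r, [/\ `|s| <= `|t|, `|r| <= `|t| &
   f (t *: v + (t *: u + x)) - f (t *: u + x) - (f (t *: v + x) - f x) =
   t * (t * 'D_v ('D_u f) (r *: v + (s *: u + x)))].
Proof.
move=> hf hU; pose phi y := f (t *: v + y) - f y.
have df s r : `|s| <= `|t| -> `|r| <= `|t| ->
    derivable f (r *: v + (s *: u + x)) u.
  by move=> st rt; apply: Ck_on_derivable (Ck_onW hf) (hU _ _ st rt).
have dphi s : `|s| <= `|t| -> is_derive (s *: u + x) u phi
    ('D_u f (t *: v + (s *: u + x)) - 'D_u f (s *: u + x)).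
  move=> st; apply: is_deriveB.
    by apply: is_derive_translate; exact: df.
  apply: derivableP; have := df s 0 st; rewrite scale0r add0r; apply.
  by rewrite normr0.
have [|s st es] := @mean_value R E phi x u t; first by move=> s /dphi[].
have [|r rt er] := @mean_value R E ('D_u f) (s *: u + x) v t.
  move=> r rt; apply: Ck_on_derivable (Ck_on_derive u hf) _; exact: hU.
exists s, r; split=> //; rewrite -/(phi (t *: u + x)) -/(phi x) es.
by have [_ ->] := dphi s st; rewrite er.
Qed.

(** The second difference is symmetric in u and v, so intermediate values of the
    two mixed derivatives coincide at points arbitrarily close to x. *)
Lemma Schwarz U f x u v : open U -> Ck_on 2 U f -> U x ->
  'D_u ('D_v f) x = 'D_v ('D_u f) x.
Proof.
move=> oU hf Ux.
have cD a b : {for x, continuous ('D_a ('D_b f))}.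
  exact: (Ck_on_cont (Ck_on_derive a (Ck_on_derive b hf)) Ux).
apply/eqP; rewrite -subr_eq0 -normr_le0; apply/ler_addgt0Pr => e e0; rewrite add0r.
have e2 : 0 < e / 2 by rewrite divr_gt0.
have near_x : \forall y \near x, U y /\
   (`|'D_u ('D_v f) x - 'D_u ('D_v f) y| <= e / 2 /\
    `|'D_v ('D_u f) x - 'D_v ('D_u f) y| <= e / 2).
  have := cD v u; have := cD u v => /cvgrPdist_le/(_ _ e2) Duv /cvgrPdist_le/(_ _ e2) Dvu.
  exact: filterI (open_nbhs_nbhs (conj oU Ux)) (filterI Duv Dvu).
have /nbhs_ballP[d /= d0 dP] := near_x.
pose t := d / (`|u| + `|v| + 1).
have c0 : 0 < `|u| + `|v| + 1 by rewrite ltr_wpDl // addr_ge0.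
have t0 : 0 < t by rewrite divr_gt0.
have close s r a b : `|s| <= `|t| -> `|r| <= `|t| -> `|a| + `|b| = `|u| + `|v| ->
    ball x d (r *: a + (s *: b + x)).
  move=> st rt ab; rewrite -ball_normE /= addrA opprD addrCA subrr addr0 normrN.
  apply: (@le_lt_trans _ _ (t * (`|u| + `|v|))).
    apply: le_trans (ler_normD _ _) _; rewrite !normrZ -ab mulrDr.
    by rewrite -{1 2}(gtr0_norm t0); apply: lerD; apply: ler_wpM2r.
  by rewrite mulrAC ltr_pdivrMr // ltr_pM2l // ltrDl.
have [s r st rt|s1 [r1 [s1t r1t e1]]] :=
    @second_difference U f x u v t hf.
  by have [] := dP _ (close s r _ _ st rt (addrC _ _)).
have [s r st rt|s2 [r2 [s2t r2t e2']]] := @second_difference U f x v u t hf.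
  by have [] := dP _ (close s r _ _ st rt erefl).
have [_ [_ Dvu]] := dP _ (close s1 r1 v u s1t r1t (addrC _ _)).
have [_ [Duv _]] := dP _ (close s2 r2 u v s2t r2t erefl).
have same : 'D_v ('D_u f) (r1 *: v + (s1 *: u + x)) =
            'D_u ('D_v f) (r2 *: u + (s2 *: v + x)).
  apply: (mulfI (lt0r_neq0 t0)); apply: (mulfI (lt0r_neq0 t0)).
  rewrite -[LHS]e1 -[RHS]e2' (addrCA (t *: v) (t *: u) x).
  by move: (f _) (f _) (f _) (f _) => a1 a2 a3 a4; ring.
rewrite same in Dvu; move: Duv Dvu.
move: ('D_u _ _) ('D_u _ x) ('D_v _ _) => z a b Duv Dvu.
rewrite -(subrKA z) [leRHS]splitr; apply: le_trans (ler_normD _ _) _.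
by rewrite distrC in Dvu; exact: lerD.
Qed.

End Schwarz.

Section Composition.
Context {R : realType} {E' : normedModType R} {m : nat}.
Local Notation E := 'cV[R]_m.
Implicit Types (U : set E') (V : set E) (s : E' -> E).

Lemma derive_comp_grad V s (f : E -> R) x v : open V -> Ck_on 1 V f -> V (s x) ->
  derivable s x v -> is_derive x v (f \o s) (gradform f (s x) ('D_v s x)).
Proof.
move=> oV hf Vs ds; have [df <-] := Ck_on_differentiable oV hf Vs.
exact: derive_comp_diff.
Qed.

(** Induction on k: the derivative of the composite is the gradient expression of
    the chain rule, whose factors are one class less regular. *)
Lemma Ck_on_comp k U V s (f : E -> R) : open U -> open V ->
  (forall x, U x -> V (s x)) -> Ck_on k U s -> Ck_on k V f -> Ck_on k U (f \o s).
Proof.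
move=> oU oV sUV; elim: k f => [|k IH] f hs hf.
  by split=> // x Ux; apply: continuous_comp;
     [exact: Ck_on_cont hs Ux|exact: Ck_on_cont hf (sUV x Ux)].
have hf1 : Ck_on 1 V f.
  by elim: k hf {IH hs} => // k IHk /Ck_onW.
have dfs x v : U x -> is_derive x v (f \o s) (gradform f (s x) ('D_v s x)).
  move=> Ux; apply: derive_comp_grad (sUV x Ux) _ => //.
  exact: Ck_on_derivable hs Ux.
split=> [x Ux|v].
  by apply: continuous_comp;
     [exact: Ck_on_cont hs Ux|exact: Ck_on_cont hf (sUV x Ux)].
split=> [x Ux|]; first by have [] := dfs x v Ux.
have h : Ck_on k U (fun x => gradform f (s x) ('D_v s x)).
  apply: Ck_on_sum => // j; apply: Ck_onM => //.
    by have /(Ck_on_mxP _ _ oU) := Ck_on_derive v hs; apply.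
  apply: (IH ('D_(basis_vec R j) f)); first exact: Ck_onW.
  exact: Ck_on_derive.
by apply: Ck_on_eq h => // x Ux; have [_] := dfs x v Ux.
Qed.

End Composition.

(** * Smooth matrix-valued maps *)

Section SmoothMatrices.
Context {R : realType} {E : normedModType R}.
Implicit Types (U : set E).

Lemma smooth_sub (F : normedModType R) U U' (f : E -> F) :
  U' `<=` U -> smooth_on U f -> smooth_on U' f.
Proof. by move=> sU hf k; apply: Ck_on_sub (hf k). Qed.

Lemma smooth_eq (F : normedModType R) U (f g : E -> F) : open U ->
  (forall x, U x -> f x = g x) -> smooth_on U f -> smooth_on U g.
Proof. by move=> oU fg hf k; apply: Ck_on_eq fg (hf k). Qed.

Lemma smooth_cst (F : normedModType R) U (a : F) : smooth_on U (fun=> a).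
Proof. by move=> k; apply: Ck_on_cst. Qed.

Lemma smoothD (F : normedModType R) U (f g : E -> F) : open U ->
  smooth_on U f -> smooth_on U g -> smooth_on U (fun x => f x + g x).
Proof. by move=> oU hf hg k; apply: Ck_onD. Qed.

Lemma smooth_sum (F : normedModType R) U (I : Type) (r : seq I) (P : pred I)
    (f : I -> E -> F) : open U -> (forall i, smooth_on U (f i)) ->
  smooth_on U (fun x => \sum_(i <- r | P i) f i x).
Proof. by move=> oU hf k; apply: Ck_on_sum => // i; apply: hf. Qed.

Lemma smoothM U (f g : E -> R) : open U ->
  smooth_on U f -> smooth_on U g -> smooth_on U (fun x => f x * g x).
Proof. by move=> oU hf hg k; apply: Ck_onM. Qed.

Lemma smooth_prod U (I : Type) (r : seq I) (P : pred I)
    (f : I -> E -> R) : open U -> (forall i, smooth_on U (f i)) ->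
  smooth_on U (fun x => \prod_(i <- r | P i) f i x).
Proof.
move=> oU hf; elim: r => [|i r IH].
  by apply: smooth_eq (smooth_cst U (1 : R)) => // x _; rewrite big_nil.
case: (boolP (P i)) => Pi.
  by apply: smooth_eq (smoothM oU (hf i) IH) => // x _; rewrite big_cons Pi.
by apply: smooth_eq IH => // x _; rewrite big_cons (negPf Pi).
Qed.

Lemma smoothV U (f : E -> R) : open U -> (forall x, U x -> f x != 0) ->
  smooth_on U f -> smooth_on U (fun x => (f x)^-1).
Proof. by move=> oU f0 hf k; apply: Ck_onV. Qed.

Lemma smooth_derive (F : normedModType R) U (f : E -> F) v :
  smooth_on U f -> smooth_on U ('D_v f).
Proof. by move=> hf k; apply: Ck_on_derive (hf k.+1). Qed.

Lemma smooth_derivable (F : normedModType R) U (f : E -> F) x v :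
  smooth_on U f -> U x -> derivable f x v.
Proof. by move=> hf; apply: Ck_on_derivable (hf 1%N). Qed.

Lemma smooth_continuous (F : normedModType R) U (f : E -> F) x :
  smooth_on U f -> U x -> {for x, continuous f}.
Proof. by move=> hf; apply: Ck_on_cont (hf 0%N). Qed.

Lemma smooth_mxP p q U (M : E -> 'M[R]_(p, q)) : open U ->
  smooth_on U M <-> forall i j, smooth_on U (fun x => M x i j).
Proof.
move=> oU; split=> [hM i j k|hM k]; last by apply/Ck_on_mxP => // i j; exact: hM.
by have /(Ck_on_mxP _ _ oU) := hM k; apply.
Qed.

Lemma smooth_entry p q U (M : E -> 'M[R]_(p, q)) i j : open U -> smooth_on U M ->
  smooth_on U (fun x => M x i j).
Proof. by move=> oU /(smooth_mxP _ oU). Qed.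

Lemma smooth_mulmx p q r U (A : E -> 'M[R]_(p, q)) (B : E -> 'M[R]_(q, r)) :
  open U -> smooth_on U A -> smooth_on U B -> smooth_on U (fun x => A x *m B x).
Proof.
move=> oU hA hB; apply/smooth_mxP => // i j.
have h : smooth_on U (fun x => \sum_k A x i k * B x k j).
  by apply: smooth_sum => // k; apply: smoothM => //; apply: smooth_entry.
by apply: smooth_eq h => // x _; rewrite mxE.
Qed.

Lemma smooth_trmx p q U (A : E -> 'M[R]_(p, q)) :
  open U -> smooth_on U A -> smooth_on U (fun x => (A x)^T).
Proof.
move=> oU hA; apply/smooth_mxP => // i j.
by apply: smooth_eq (smooth_entry j i oU hA) => // x _; rewrite mxE.
Qed.

Lemma smooth_scale p q U (f : E -> R) (A : E -> 'M[R]_(p, q)) :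
  open U -> smooth_on U f -> smooth_on U A -> smooth_on U (fun x => f x *: A x).
Proof.
move=> oU hf hA; apply/smooth_mxP => // i j.
by apply: smooth_eq (smoothM oU hf (smooth_entry i j oU hA)) => // x _; rewrite mxE.
Qed.

Lemma smoothN p q U (A : E -> 'M[R]_(p, q)) :
  open U -> smooth_on U A -> smooth_on U (fun x => - A x).
Proof.
move=> oU hA; apply: smooth_eq (smooth_scale oU (smooth_cst U (-1 : R)) hA) => // x _.
by rewrite scaleN1r.
Qed.

Lemma smoothB p q U (A B : E -> 'M[R]_(p, q)) : open U ->
  smooth_on U A -> smooth_on U B -> smooth_on U (fun x => A x - B x).
Proof. by move=> oU hA hB; apply: smoothD => //; apply: smoothN. Qed.

Lemma smooth_tr p U (A : E -> 'M[R]_p) : open U -> smooth_on U A ->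
  smooth_on U (fun x => \tr (A x)).
Proof. by move=> oU hA; apply: smooth_sum => // i; apply: smooth_entry. Qed.

Lemma smooth_det p U (A : E -> 'M[R]_p) : open U -> smooth_on U A ->
  smooth_on U (fun x => \det (A x)).
Proof.
move=> oU hA; apply: smooth_sum => // s; apply: smoothM => //; first exact: smooth_cst.
by apply: smooth_prod => // i; apply: smooth_entry.
Qed.

(** By Cramer's rule the inverse is rational in the entries. *)
Lemma smooth_invmx p U (A : E -> 'M[R]_p) : open U ->
  (forall x, U x -> A x \in unitmx) -> smooth_on U A ->
  smooth_on U (fun x => invmx (A x)).
Proof.
move=> oU uA hA.
have h : smooth_on U (fun x => (\det (A x))^-1 *: \adj (A x)).
  apply: smooth_scale => //.
    apply: smoothV => //; last exact: smooth_det.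
    by move=> x /uA; rewrite unitmxE unitfE.
  apply/smooth_mxP => // i j.
  have h : smooth_on U (fun x => cofactor (A x) j i).
    apply: smoothM => //; first exact: smooth_cst.
    apply: smooth_det => //; apply/smooth_mxP => // k l.
    by apply: smooth_eq (smooth_entry (lift j k) (lift i l) oU hA) => // x _; rewrite !mxE.
  by apply: smooth_eq h => // x _; rewrite mxE.
by apply: smooth_eq h => // x Ux; rewrite /invmx uA.
Qed.

End SmoothMatrices.

Section DeriveMatrices.
Context {R : realType} {E : normedModType R}.
Implicit Types (x v : E).

Lemma is_derive_mxP p q (M : E -> 'M[R]_(p, q)) x v (D : 'M[R]_(p, q)) :
  (forall i j, is_derive x v (fun y => M y i j) (D i j)) -> is_derive x v M D.
Proof.
move=> h; have dM : derivable M x v by apply/derivable_mxP => i j; have [] := h i j.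
split=> //; rewrite derive_mx //; apply/matrixP => i j; rewrite mxE.
by have [_] := h i j.
Qed.

Lemma is_derive_entry p q (M : E -> 'M[R]_(p, q)) x v i j : derivable M x v ->
  is_derive x v (fun y => M y i j) ('D_v M x i j).
Proof.
move=> dM; split; first by have /derivable_mxP := dM; apply.
by rewrite derive_mx // mxE.
Qed.

Lemma is_derive_mulmx p q r (A : E -> 'M[R]_(p, q)) (B : E -> 'M[R]_(q, r)) x v :
  derivable A x v -> derivable B x v ->
  is_derive x v (fun y => A y *m B y) ('D_v A x *m B x + A x *m 'D_v B x).
Proof.
move=> dA dB; apply: is_derive_mxP => i j.
have -> : (fun y => (A y *m B y) i j) = \sum_k (fun y => A y i k * B y k j).
  by apply/funext => y; rewrite mxE fct_sumE.
apply: is_derive_eq.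
  apply: is_derive_sum => k; apply: is_deriveM; exact: is_derive_entry.
rewrite !mxE -big_split /=; apply: eq_bigr => k _.
by rewrite addrC mulrC; congr (_ + _); rewrite mulrC.
Qed.

Lemma is_derive_trmx p q (A : E -> 'M[R]_(p, q)) x v :
  derivable A x v -> is_derive x v (fun y => (A y)^T) ('D_v A x)^T.
Proof.
move=> dA; apply: is_derive_mxP => i j; rewrite mxE.
have -> : (fun y => (A y)^T i j) = (fun y => A y j i) by apply/funext => y; rewrite mxE.
exact: is_derive_entry.
Qed.

Lemma is_derive_scale p q (f : E -> R) (A : E -> 'M[R]_(p, q)) x v :
  derivable f x v -> derivable A x v ->
  is_derive x v (fun y => f y *: A y) ('D_v f x *: A x + f x *: 'D_v A x).
Proof.
move=> df dA; apply: is_derive_mxP => i j; rewrite !mxE.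
have -> : (fun y => (f y *: A y) i j) = (fun y => f y * A y i j).
  by apply/funext => y; rewrite mxE.
apply: is_derive_eq.
  by apply: is_deriveM; [exact: derivableP|exact: is_derive_entry].
by rewrite addrC; congr (_ + _); rewrite mulrC.
Qed.

Lemma is_derive_tr p (A : E -> 'M[R]_p) x v :
  derivable A x v -> is_derive x v (fun y => \tr (A y)) (\tr ('D_v A x)).
Proof.
move=> dA; have -> : (fun y => \tr (A y)) = \sum_k (fun y => A y k k).
  by apply/funext => y; rewrite fct_sumE.
by apply: is_derive_sum => k; exact: is_derive_entry.
Qed.

End DeriveMatrices.

Section DirectionalLinear.
Context {R : realType} {m p q : nat}.
Local Notation E := 'cV[R]_m.
Implicit Types (U : set E) (f : E -> 'M[R]_(p, q)).

Lemma derive_sum_basis U f x v : open U -> smooth_on U f -> U x ->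
  'D_v f x = \sum_k v k 0 *: 'D_(basis_vec R k) f x.
Proof.
move=> oU hf Ux; apply/matrixP => i j.
have dE w : ('D_w f x) i j = 'D_w (fun y => f y i j) x.
  have df : derivable f x w by exact: smooth_derivable hf Ux.
  by have [_ ->] := is_derive_entry i j df.
rewrite dE (derive_gradform v oU (smooth_entry i j oU hf 1%N) Ux) summxE.
by apply: eq_bigr => k _; rewrite !mxE dE.
Qed.

Lemma Schwarz_mx U f x u v : open U -> smooth_on U f -> U x ->
  'D_u ('D_v f) x = 'D_v ('D_u f) x.
Proof.
move=> oU hf Ux.
have dE a b i j : ('D_a ('D_b f) x) i j = 'D_a ('D_b (fun y => f y i j)) x.
  have df : derivable ('D_b f) x a by exact: smooth_derivable (smooth_derive b hf) Ux.
  have [_ <-] := is_derive_entry i j df.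
  apply: near_eq_derive; apply: filterS (open_nbhs_nbhs (conj oU Ux)) => y Uy.
  have dfy : derivable f y b by exact: smooth_derivable hf Uy.
  by have [_ ->] := is_derive_entry i j dfy.
apply/matrixP => i j; rewrite [LHS]dE [RHS]dE.
exact: (Schwarz u v oU (smooth_entry i j oU hf 2%N) Ux).
Qed.

End DirectionalLinear.

(** * Trilinear algebra over a quaternion action *)

Section QuaternionAction.
Variables (R : realFieldType) (V : zmodType).

(** Only the values of the forms below on vectors obtained from finitely many
    given ones by I, J, K matter, so additivity is replaced by compatibility with
    the opposite; accordingly [odd2] and [odd3] ask for oddness instead of
    multilinearity. *)
Definition quaternion_action (I J K : V -> V) :=
  [/\ [/\ forall x, I (- x) = - I x, forall x, J (- x) = - J x &
          forall x, K (- x) = - K x],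
      [/\ forall x, I (I x) = - x, forall x, J (J x) = - x &
          forall x, K (K x) = - x],
      [/\ forall x, I (J x) = K x, forall x, J (K x) = I x &
          forall x, K (I x) = J x] &
      [/\ forall x, J (I x) = - K x, forall x, K (J x) = - I x &
          forall x, I (K x) = - J x]].

Lemma quaternion_action_rot I J K : quaternion_action I J K -> quaternion_action J K I.
Proof. by case=> [[? ? ?] [? ? ?] [? ? ?] [? ? ?]]; split; split. Qed.

Definition odd2 (b : V -> V -> R) :=
  (forall x y, b (- x) y = - b x y) /\ (forall x y, b x (- y) = - b x y).

Definition odd3 (T : V -> V -> V -> R) :=
  (forall x y z, T (- x) y z = - T x y z) /\ (forall x, odd2 (T x)).

(** The projection onto the Hermitian forms. *)
Definition herm_avg (I J K : V -> V) (b : V -> V -> R) (x y : V) : R :=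
  4^-1 * (b x y + b (I x) (I y) + b (J x) (J y) + b (K x) (K y)).

(** For T = D P this is the exterior derivative of (y, z) |-> P(y, Iz) - P(z, Iy),
    up to the terms coming from D I. *)
Definition bianchi_sum (I : V -> V) (T : V -> V -> V -> R) (x y z : V) : R :=
  (T x y (I z) - T x z (I y)) + (T y z (I x) - T y x (I z))
  + (T z x (I y) - T z y (I x)).

(** The only possible torsion 3-form of a metric connection obtained from a
    torsion-free one, with h = D g, by a change commuting with I. *)
Definition torsion3 (I : V -> V) (h : V -> V -> V -> R) (x y z : V) : R :=
  - (h (I x) y (I z) + h (I y) z (I x) + h (I z) x (I y)).

(** These tactics use the symmetry [Ts] to bring the arguments built from x before
    those built from u, so that linear arithmetic sees one atom for each value. *)
Ltac orient_at Ts I J K u x :=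
  rewrite ?(Ts _ u x) ?(Ts _ u (I x)) ?(Ts _ u (J x)) ?(Ts _ u (K x)).
Ltac orient Ts I J K u x :=
  orient_at Ts I J K u x; orient_at Ts I J K (I u) x;
  orient_at Ts I J K (J u) x; orient_at Ts I J K (K u) x.

(** The difference of the two sides is a linear combination of the eight instances
    of the cyclic identities used in the proof. *)
Lemma torsion3_herm_avg I J K T : quaternion_action I J K -> odd3 T ->
  (forall x y z, T x y z = T x z y) ->
  (forall x y z, bianchi_sum I T x y z = 0) ->
  (forall x y z, bianchi_sum J T x y z = 0) ->
  (forall x y z, bianchi_sum K T x y z = 0) ->
  forall x y z, torsion3 I (fun w => herm_avg I J K (T w)) x y z
              = torsion3 J (fun w => herm_avg I J K (T w)) x y z.
Proof.
case=> [[nI nJ nK] [II JJ KK] [IJ JK KI] [JI KJ IK]] [T1 T23] Ts BI BJ BK x y z.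
have T2 w u v : T w (- u) v = - T w u v by have [-> _] := T23 w.
have T3 w u v : T w u (- v) = - T w u v by have [_ ->] := T23 w.
have nE := (nI, nJ, nK, II, JJ, KK, IJ, JK, KI, JI, KJ, IK, T1, T2, T3, @opprK V, @opprK R).
have := BI (I x) (I y) (I z); have := BJ (J x) (J y) (J z).
have := BK (I x) (J y) z; have := BK (I y) (J z) x; have := BK (I z) (J x) y.
have := BK (I y) (J x) z; have := BK (I z) (J y) x; have := BK (I x) (J z) y.
rewrite /torsion3 /herm_avg /bianchi_sum !nE.
orient Ts I J K y x; orient Ts I J K z x; orient Ts I J K z y.
move=> h1 h2 h3 h4 h5 h6 h7 h8; lra.
Qed.

(** The relation between the Ricci form and the three curvature forms, as obtained
    by contracting the first Bianchi identity with I. *)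
Definition curv_eq (I J K : V -> V) (m : R) (ric aI aJ aK : V -> V -> R) :=
  forall y z, ric y (I z) - ric z (I y) = m * aI y z
    + 2 * (aJ (K y) z + aJ y (K z)) - 2 * (aK (J y) z + aK y (J z)).

Section CurvatureType.
Variables (I J K : V -> V) (m : R) (ric aI aJ aK : V -> V -> R).
Hypotheses (qIJK : quaternion_action I J K) (m4 : 4 < m).
Hypotheses (odd_ric : odd2 ric) (sym_ric : forall x y, ric x y = ric y x).
Hypotheses (odd_I : odd2 aI) (odd_J : odd2 aJ) (odd_K : odd2 aK).
Hypotheses (eqI : curv_eq I J K m ric aI aJ aK) (eqJ : curv_eq J K I m ric aJ aK aI)
  (eqK : curv_eq K I J m ric aK aI aJ).

(** The part of a_I that is anti-invariant under I splits further according to the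
    sign under J.  On each piece X, the relations couple X to one component Y of a_J
    or of a_K by m X + 4 Y = 0 and m Y + 4 X = 0, and m <> 4, -4 gives X = 0. *)
Lemma curv_invariant x y : aI (I x) (I y) = aI x y.
Proof.
have [[nI nJ nK] [II JJ KK] [IJ JK KI] [JI KJ IK]] := qIJK.
have [[[[r1 r2] [a1 a2]] [b1 b2]] [c1 c2]] := (odd_ric, odd_I, odd_J, odd_K).
have nE := (nI, nJ, nK, II, JJ, KK, IJ, JK, KI, JI, KJ, IK, r1, r2, a1, a2,
  b1, b2, c1, c2, @opprK V, @opprK R).
have rs := (sym_ric y (I x), sym_ric y (J x), sym_ric y (K x), sym_ric (J y) x,
  sym_ric (K y) x, sym_ric (I y) (J x), sym_ric (I y) (K x), sym_ric (J y) (I x),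
  sym_ric (K y) (I x), sym_ric (I y) x, sym_ric (J y) (K x), sym_ric (K y) (J x)).
(* the two pieces of the anti-invariant part: even and odd under J *)
pose X1 := aI x y - aI (I x) (I y) + aI (J x) (J y) - aI (K x) (K y).
pose X2 := aI x y - aI (I x) (I y) - aI (J x) (J y) + aI (K x) (K y).
have solve2 u v : m * u + 4 * v = 0 -> m * v + 4 * u = 0 -> u = 0.
  move=> E F; have p : 0 < (m - 4) * (m + 4) by apply: mulr_gt0; have := m4; lra.
  apply: (mulfI (lt0r_neq0 p)); rewrite mulr0.
  have -> : (m - 4) * (m + 4) * u = m * (m * u + 4 * v) - 4 * (m * v + 4 * u) by ring.
  by rewrite E F; ring.
have X10 : X1 = 0.
  have e1 := eqI x y; have e2 := eqI (I x) (I y).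
  have e3 := eqI (J x) (J y); have e4 := eqI (K x) (K y).
  have f1 := eqJ (K x) y; have f2 := eqJ (J x) (I y).
  have f3 := eqJ (I x) (J y); have f4 := eqJ x (K y).
  rewrite !nE ?rs in e1 e2 e3 e4 f1 f2 f3 f4.
  pose Y := aJ (K x) y - aJ (J x) (I y) - aJ (I x) (J y) + aJ x (K y).
  have E : m * X1 + 4 * Y = 0 by rewrite /X1 /Y; lra.
  have F : m * Y + 4 * X1 = 0 by rewrite /X1 /Y; lra.
  exact: solve2 E F.
have X20 : X2 = 0.
  have e1 := eqI x y; have e2 := eqI (I x) (I y).
  have e3 := eqI (J x) (J y); have e4 := eqI (K x) (K y).
  have f1 := eqK (J x) y; have f2 := eqK (K x) (I y).
  have f3 := eqK x (J y); have f4 := eqK (I x) (K y).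
  rewrite !nE ?rs in e1 e2 e3 e4 f1 f2 f3 f4.
  pose Y := aK (J x) y + aK (K x) (I y) + aK x (J y) + aK (I x) (K y).
  have E : m * X2 + 4 * - Y = 0 by rewrite /X2 /Y; lra.
  have F : m * - Y + 4 * X2 = 0 by rewrite /X2 /Y; lra.
  exact: solve2 E F.
by move: X10 X20; rewrite /X1 /X2; lra.
Qed.

(** If a_I(y, z) = P(y, Iz) - P(z, Iy) with P symmetric, this is the I-invariant
    part (P(x, y) + P(Ix, Iy)) / 2 of P. *)
Definition ric_part (I : V -> V) (a : V -> V -> R) (x y : V) : R :=
  - 2^-1 * a x (I y).

(** The Hermitian part of a common potential P must be recovered from each of the
    three curvature forms; that it is the same one is where m <> 4 enters again. *)
Lemma ric_part_avg x y :
  herm_avg I J K (ric_part I aI) x y = herm_avg I J K (ric_part J aJ) x y.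
Proof.
have [[nI nJ nK] [II JJ KK] [IJ JK KI] [JI KJ IK]] := qIJK.
have [[[[r1 r2] [a1 a2]] [b1 b2]] [c1 c2]] := (odd_ric, odd_I, odd_J, odd_K).
have nE := (nI, nJ, nK, II, JJ, KK, IJ, JK, KI, JI, KJ, IK, r1, r2, a1, a2,
  b1, b2, c1, c2, @opprK V, @opprK R).
have rs := (sym_ric y x, sym_ric (I y) (I x), sym_ric (J y) (J x), sym_ric (K y) (K x)).
have m4' : m - 4 != 0 by apply: lt0r_neq0; have := m4; lra.
have e1 := eqI x (I y); have e2 := eqI (I x) y.
have e3 := eqI (J x) (K y); have e4 := eqI (K x) (J y).
have f1 := eqJ x (J y); have f2 := eqJ (I x) (K y).
have f3 := eqJ (J x) y; have f4 := eqJ (K x) (I y).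
rewrite !nE ?rs in e1 e2 e3 e4 f1 f2 f3 f4.
apply: (mulfI m4'); rewrite /herm_avg /ric_part !nE.
lra.
Qed.

End CurvatureType.

(** A form is the sum of its Hermitian part and of three parts, each invariant under
    exactly one of I, J, K.  The first three terms contain each of the latter once
    and the Hermitian part three times, whence the correction by 2. *)
Definition ric_pot (I J K : V -> V) (aI aJ aK : V -> V -> R) (x y : V) : R :=
  ric_part I aI x y + ric_part J aJ x y + ric_part K aK x y
  - 2 * herm_avg I J K (ric_part I aI) x y.

Section InvariantForm.
Variables (I J K : V -> V) (a : V -> V -> R).
Hypotheses (qIJK : quaternion_action I J K) (odd_a : odd2 a).
Hypotheses (sk_a : forall x y, a y x = - a x y) (inv_a : forall x y, a (I x) (I y) = a x y).

Lemma ric_part_sym x y : ric_part I a y x = ric_part I a x y.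
Proof.
have [_ [II _ _] _ _] := qIJK; have [_ a2] := odd_a.
by rewrite /ric_part -(inv_a x (I y)) II (sk_a (I x) y) a2 sk_a opprK.
Qed.

Lemma ric_part_inv x y : ric_part I a (I x) (I y) = ric_part I a x y.
Proof. by rewrite /ric_part inv_a. Qed.

End InvariantForm.

Section RicciPotential.
Variables (I J K : V -> V) (aI aJ aK : V -> V -> R).
Hypotheses (qIJK : quaternion_action I J K).
Hypotheses (odd_I : odd2 aI) (odd_J : odd2 aJ) (odd_K : odd2 aK).
Hypotheses (skI : forall x y, aI y x = - aI x y) (skJ : forall x y, aJ y x = - aJ x y)
  (skK : forall x y, aK y x = - aK x y).
Hypotheses (invI : forall x y, aI (I x) (I y) = aI x y)
  (invJ : forall x y, aJ (J x) (J y) = aJ x y)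
  (invK : forall x y, aK (K x) (K y) = aK x y).
Hypotheses (avgIJ : forall x y,
    herm_avg I J K (ric_part I aI) x y = herm_avg I J K (ric_part J aJ) x y)
  (avgIK : forall x y,
    herm_avg I J K (ric_part I aI) x y = herm_avg I J K (ric_part K aK) x y).

Lemma ric_pot_sym x y : ric_pot I J K aI aJ aK y x = ric_pot I J K aI aJ aK x y.
Proof.
have sI := ric_part_sym qIJK odd_I skI invI.
have qJ := quaternion_action_rot qIJK.
have sJ := ric_part_sym qJ odd_J skJ invJ.
have sK := ric_part_sym (quaternion_action_rot qJ) odd_K skK invK.
by rewrite /ric_pot /herm_avg !(sI x, sI (I x), sI (J x), sI (K x), sJ x, sK x).
Qed.

(** The term attached to J plus its conjugate by I is twice the Hermitian part, and
    so for K (the facts rJ and rK below).  Hence in P(x, Iy) - P(y, Ix) these terms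
    cancel against the correction, and the term attached to I remains. *)
Lemma ric_potE x y :
  aI x y = ric_pot I J K aI aJ aK x (I y) - ric_pot I J K aI aJ aK y (I x).
Proof.
have [[nI nJ nK] [II JJ KK] [IJ JK KI] [JI KJ IK]] := qIJK.
have [[[a1 a2] [b1 b2]] [c1 c2]] := (odd_I, odd_J, odd_K).
pose sI := ric_part I aI; pose sJ := ric_part J aJ; pose sK := ric_part K aK.
have qJ := quaternion_action_rot qIJK.
have sIs u v : sI u v = sI v u := ric_part_sym qIJK odd_I skI invI v u.
have sJs u v : sJ u v = sJ v u := ric_part_sym qJ odd_J skJ invJ v u.
have sKs u v : sK u v = sK v u :=
  ric_part_sym (quaternion_action_rot qJ) odd_K skK invK v u.
have oJ u v : sJ (- u) v = - sJ u v by rewrite /sJ /ric_part b1; ring.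
have oK u v : sK (- u) v = - sK u v by rewrite /sK /ric_part c1; ring.
have oJ' u v : sJ u (- v) = - sJ u v by rewrite sJs oJ sJs.
have oK' u v : sK u (- v) = - sK u v by rewrite sKs oK sKs.
have oI u v : sI (- u) v = - sI u v by rewrite /sI /ric_part a1; ring.
have oI' u v : sI u (- v) = - sI u v by rewrite sIs oI sIs.
pose p := herm_avg I J K sI.
have pI u v : p (I u) (I v) = p u v.
  by rewrite /p /herm_avg !(II, JI, KI, oI, oI'); ring.
have ps u v : p u v = p v u.
  by rewrite /p /herm_avg (sIs u) (sIs (I u)) (sIs (J u)) (sIs (K u)).
have p1 u v : p (- u) v = - p u v.
  by rewrite /p /herm_avg nI nJ nK !oI; ring.
have rJ u v : sJ u v + sJ (I u) (I v) = 2 * p u v.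
  rewrite /p avgIJ /herm_avg -/sJ.
  have -> : sJ (J u) (J v) = sJ u v by exact: ric_part_inv.
  have -> : sJ (K u) (K v) = sJ (I u) (I v).
    by have := ric_part_inv invJ (I u) (I v); rewrite !JI -/sJ oJ oJ' opprK.
  by field.
have rK u v : sK u v + sK (I u) (I v) = 2 * p u v.
  rewrite /p avgIK /herm_avg -/sK.
  have -> : sK (K u) (K v) = sK u v by exact: ric_part_inv.
  have -> : sK (J u) (J v) = sK (I u) (I v).
    by have := ric_part_inv invK (I u) (I v); rewrite !KI.
  by field.
have EJ := rJ x (I y); have EK := rK x (I y).
rewrite II oJ' in EJ; rewrite II oK' in EK.
have pE : p y (I x) = - p x (I y) by rewrite ps -pI II p1.
have sIE u v : sI u (I v) = 2^-1 * aI u v by rewrite /sI /ric_part II a2; ring.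
rewrite /ric_pot -/sI -/sJ -/sK -/p pE !sIE (skI x y) (sJs y) (sKs y).
lra.
Qed.

End RicciPotential.

Section SkewTorsion.
Variables (I J K : V -> V) (h : V -> V -> V -> R).
Hypotheses (qIJK : quaternion_action I J K) (odd_h : odd3 h).
Hypotheses (sym_h : forall x y z, h x y z = h x z y)
  (inv_h : forall x y z, h x (I y) (I z) = h x y z).

(** A Hermitian form makes I skew-adjoint. *)
Lemma herm_swap x y z : h x (I y) z = - h x y (I z).
Proof.
have [_ [II _ _] _ _] := qIJK; have [_ h23] := odd_h.
by rewrite -(inv_h x y (I z)) II; have [_ ->] := h23 x; rewrite opprK.
Qed.

Lemma torsion3_skew x y z :
  torsion3 I h y x z = - torsion3 I h x y z /\
  torsion3 I h x z y = - torsion3 I h x y z.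
Proof.
have sw a u v : h a u (I v) = - h a v (I u) by rewrite sym_h herm_swap.
by rewrite /torsion3; split;
  rewrite (sw (I y) x z) (sw (I x) z y) (sw (I z) y x); ring.
Qed.

(** The first three terms are those of the Koszul formula, which alone would give
    a torsion-free metric connection; adding the skew form t_I restores the
    invariance under I. *)
Definition contorsion3 (x y z : V) : R :=
  2^-1 * (h x y z + h y x z - h z x y + torsion3 I h x y z).

Lemma contorsion3_inv x y z : contorsion3 x (I y) (I z) = contorsion3 x y z.
Proof.
have [[nI _ _] [II _ _] _ _] := qIJK; have [h1 h23] := odd_h.
have h2 a b c : h a (- b) c = - h a b c by have [-> _] := h23 a.
have h3 a b c : h a b (- c) = - h a b c by have [_ ->] := h23 a.
rewrite /contorsion3 /torsion3 inv_h !II !(h1, h2, h3).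
have sw a u v : h a u (I v) = - h a v (I u) by rewrite sym_h herm_swap.
rewrite (sym_h y (I z)) inv_h (herm_swap (I x) y z) (sw (I y) z x); ring.
Qed.

Lemma contorsion3_metric x y z : contorsion3 x y z + contorsion3 x z y = h x y z.
Proof.
have [_ t] := torsion3_skew x y z; rewrite /contorsion3 t (sym_h x z y).
by field.
Qed.

Lemma contorsion3_torsion x y z :
  contorsion3 x y z - contorsion3 y x z = torsion3 I h x y z.
Proof.
have [t _] := torsion3_skew x y z; rewrite /contorsion3 t (sym_h z y x); by field.
Qed.

End SkewTorsion.

(** When the change a commutes with I, its skew-symmetrisation in the torsion slots
    satisfies the real identity that kills the (3,0) and (0,3) parts. *)
Lemma type_of_invariant (I : V -> V) (a c : V -> V -> V -> R) :
  (forall x, I (I x) = - x) -> odd3 a ->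
  (forall x y z, a x (I y) (I z) = a x y z) ->
  (forall x y z, c x y z = a y z x - a z y x) ->
  forall x y z, c x y z = c x (I y) (I z) + c (I x) y (I z) + c (I x) (I y) z.
Proof.
move=> II [a1 a23] inv_a ce x y z.
have a2 u v w : a u (- v) w = - a u v w by have [-> _] := a23 u.
have sw u v w : a u (I v) w = - a u v (I w).
  by rewrite -(inv_a u v (I w)) II; have [_ ->] := a23 u; rewrite opprK.
have a3 u v w : a u v (- w) = - a u v w by have [_ ->] := a23 u.
by rewrite !ce !sw !II !a3; ring.
Qed.

End QuaternionAction.

(** * Bilinear forms and quaternionic matrices *)

Section Bilin.
Context {R : realType} {m : nat}.
Implicit Types (A B : 'M[R]_m) (u v w : 'cV[R]_m).

Lemma bilinE B u v : bilin B u v = \sum_i \sum_j u i 0 * B i j * v j 0.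
Proof.
rewrite /bilin mxE exchange_big /=; apply: eq_bigr => j _.
rewrite mxE mulr_suml; apply: eq_bigr => i _; by rewrite mxE.
Qed.

Lemma bilinDl B u v w : bilin B (u + v) w = bilin B u w + bilin B v w.
Proof. by rewrite /bilin linearD /= !mulmxDl mxE. Qed.
Lemma bilinDr B u v w : bilin B u (v + w) = bilin B u v + bilin B u w.
Proof. by rewrite /bilin mulmxDr mxE. Qed.
Lemma bilinZl B a u v : bilin B (a *: u) v = a * bilin B u v.
Proof. by rewrite /bilin linearZ /= -!scalemxAl mxE. Qed.
Lemma bilinZr B a u v : bilin B u (a *: v) = a * bilin B u v.
Proof. by rewrite /bilin -!scalemxAr mxE. Qed.
Lemma bilinNl B u v : bilin B (- u) v = - bilin B u v.
Proof. by rewrite -scaleN1r bilinZl mulN1r. Qed.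
Lemma bilinNr B u v : bilin B u (- v) = - bilin B u v.
Proof. by rewrite -scaleN1r bilinZr mulN1r. Qed.
Lemma bilinD A B u v : bilin (A + B) u v = bilin A u v + bilin B u v.
Proof. by rewrite /bilin mulmxDr mulmxDl mxE. Qed.
Lemma bilinZ a B u v : bilin (a *: B) u v = a * bilin B u v.
Proof. by rewrite /bilin -scalemxAr -scalemxAl mxE. Qed.
Lemma bilinN B u v : bilin (- B) u v = - bilin B u v.
Proof. by rewrite -scaleN1r bilinZ mulN1r. Qed.
Lemma bilin_tr B u v : bilin B^T u v = bilin B v u.
Proof. by rewrite /bilin -[in RHS]trace_mx11 -mxtrace_tr trace_mx11 !trmx_mul trmxK mulmxA. Qed.
Lemma bilinMl A B u v : bilin (A^T *m B) u v = bilin B (A *m u) v.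
Proof. by rewrite /bilin trmx_mul !mulmxA. Qed.
Lemma bilinMr A B u v : bilin (B *m A) u v = bilin B u (A *m v).
Proof. by rewrite /bilin !mulmxA. Qed.

Lemma bilin_basis B i j : bilin B (basis_vec R i) (basis_vec R j) = B i j.
Proof.
rewrite /bilin /basis_vec trmx_delta -rowE -colE.
by rewrite !mxE.
Qed.

Lemma bilin_ext A B : (forall u v, bilin A u v = bilin B u v) -> A = B.
Proof. by move=> AB; apply/matrixP => i j; rewrite -!bilin_basis. Qed.

Lemma unit_of_inj (A : 'M[R]_m) : (forall v : 'cV[R]_m, A *m v = 0 -> v = 0) ->
  A \in unitmx.
Proof.
move=> injA; rewrite -unitmx_tr -row_free_unit -kermx_eq0; apply/eqP/row_matrixP => i.
apply: trmx_inj; rewrite row0 trmx0; apply: injA.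
by apply: trmx_inj; rewrite trmx_mul trmxK -row_mul mulmx_ker row0 trmx0.
Qed.

Lemma posdef_unit B : (forall v, v != 0 -> 0 < bilin B v v) -> B \in unitmx.
Proof.
move=> pB; apply: unit_of_inj => v Bv; apply/eqP; apply: contraT => /pB.
by rewrite /bilin -mulmxA Bv mulmx0 mxE ltxx.
Qed.

End Bilin.

Section QuaternionMatrices.
Context {R : realType} {m : nat}.
Variables (I J K : 'M[R]_m).
Hypothesis qIJK : quaternion_relations I J K.

Lemma quaternion_table : [/\ J *m K = I, K *m J = - I, K *m I = J & I *m K = - J].
Proof.
have [II JJ KK IJ JI] := qIJK.
have KJ : K *m J = - I by rewrite -IJ -mulmxA JJ mulmxN mulmx1.
have IK : I *m K = - J by rewrite -IJ mulmxA II mulNmx mul1mx.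
have KI : K *m I = J by rewrite -IJ -mulmxA JI mulmxN IK opprK.
split=> //.
by rewrite -KI -mulmxA IK mulmxN KJ opprK.
Qed.

Lemma quaternion_rot : quaternion_relations J K I.
Proof.
have [II JJ KK IJ JI] := qIJK; have [JK KJ KI IK] := quaternion_table.
by split.
Qed.

Lemma quaternion_mx_action :
  quaternion_action (fun v : 'cV[R]_m => I *m v) (fun v => J *m v) (fun v => K *m v).
Proof.
have [II JJ KK IJ JI] := qIJK; have [JK KJ KI IK] := quaternion_table.
by split; split=> v; rewrite ?mulmxN // mulmxA
   ?(II, JJ, KK, IJ, JI, JK, KJ, KI, IK) ?mulNmx ?mul1mx.
Qed.

(** I = JK = -KJ is a commutator up to a factor. *)
Lemma quaternion_tr : \tr I = 0.
Proof.
have [JK KJ _ _] := quaternion_table.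
have : \tr I = - \tr I by rewrite -{1}JK mxtrace_mulC KJ raddfN.
by move: (\tr I) => t; lra.
Qed.

End QuaternionMatrices.

Section HermAvgMx.
Context {R : realType} {m : nat}.
Variables (I J K : 'M[R]_m).

Definition havg_mx (B : 'M[R]_m) : 'M[R]_m :=
  4^-1 *: (B + I^T *m B *m I + J^T *m B *m J + K^T *m B *m K).

Lemma bilin_havg B u v : bilin (havg_mx B) u v =
  herm_avg (fun v => I *m v) (fun v => J *m v) (fun v => K *m v) (bilin B) u v.
Proof. by rewrite /havg_mx /herm_avg bilinZ !bilinD (bilinMr I) (bilinMr J) (bilinMr K) !bilinMl. Qed.

End HermAvgMx.

(** * Torsion-free changes of a quaternionic connection *)

Section ConnShift.
Context {R : realType} {m : nat}.
Implicit Types (I J K : 'M[R]_m) (xi : 'rV[R]_m) (v w : 'cV[R]_m).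

Definition cov xi v : R := (xi *m v) 0 0.

Definition shift_term (q : 'M[R]_m) xi v : 'M[R]_m :=
  cov xi (q *m v) *: q + (q *m v) *m (xi *m q).

(** Up to normalisation, the general symmetric endomorphism-valued 1-form with values
    in gl(n, H) + sp(1): it is determined by a covector xi. *)
Definition conn_shift I J K xi v : 'M[R]_m :=
  cov xi v *: 1%:M + v *m xi
  - (shift_term I xi v + shift_term J xi v + shift_term K xi v).

Lemma mul_cov v w xi : v *m xi *m w = cov xi w *: v.
Proof.
rewrite -mulmxA [xi *m w]mx11_scalar mul_mx_scalar.
by rewrite /cov.
Qed.

Lemma conn_shift_sym I J K xi v w :
  conn_shift I J K xi v *m w = conn_shift I J K xi w *m v.
Proof.
have t q : shift_term q xi v *m w = shift_term q xi w *m v.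
  rewrite /shift_term !mulmxDl -!scalemxAl !(mulmxA _ xi) -!(mulmxA _ q).
  by rewrite !mul_cov addrC.
rewrite /conn_shift (mulmxBl _ _ w) (mulmxBl _ _ v); congr (_ - _).
  by rewrite !mulmxDl -!scalemxAl !mul1mx !mul_cov addrC.
move: (t I) (t J) (t K); move: (shift_term I _ v) (shift_term J _ v) (shift_term K _ v).
move: (shift_term I _ w) (shift_term J _ w) (shift_term K _ w) => A' B' C' A B C hA hB hC.
by rewrite !mulmxDl hA hB hC.
Qed.

Lemma covD xi v w : cov xi (v + w) = cov xi v + cov xi w.
Proof. by rewrite /cov mulmxDr mxE. Qed.
Lemma covZ xi a v : cov xi (a *: v) = a * cov xi v.
Proof. by rewrite /cov -scalemxAr mxE. Qed.
Lemma covN xi v : cov xi (- v) = - cov xi v.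
Proof. by rewrite /cov mulmxN mxE. Qed.
Lemma cov_trace xi v : \tr (v *m xi) = cov xi v.
Proof. by rewrite mxtrace_mulC trace_mx11. Qed.

Lemma conn_shift_linear I J K xi : linear (conn_shift I J K xi).
Proof.
move=> a v w.
have t q : shift_term q xi (a *: v + w) = a *: shift_term q xi v + shift_term q xi w.
  rewrite /shift_term mulmxDr -scalemxAr covD covZ mulmxDl -scalemxAl !scalerDr scalerDl.
  by rewrite scalerA addrACA.
rewrite /conn_shift !t covD covZ mulmxDl -scalemxAl.
move: (cov _ _) (cov _ _) (1%:M) (v *m xi) (w *m xi) => c d one vx wx.
move: (shift_term I _ v) (shift_term J _ v) (shift_term K _ v) => A B C.
move: (shift_term I _ w) (shift_term J _ w) (shift_term K _ w) => A' B' C'.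
mx_ring.
Qed.

Lemma conn_shift0 I J K v : conn_shift I J K 0 v = 0.
Proof.
have c0 u : cov 0 u = 0 by rewrite /cov mul0mx mxE.
by rewrite /conn_shift /shift_term !c0 !mul0mx !mulmx0 !scale0r !addr0 subrr.
Qed.

Section Quaternionic.
Variables (I J K : 'M[R]_m).
Hypothesis qIJK : quaternion_relations I J K.

Lemma tr_shape (A B C D : 'M[R]_m) :
  \tr (A - (B + C + D)) = \tr A - (\tr B + \tr C + \tr D).
Proof. by rewrite raddfB /= !mxtraceD. Qed.

(** The shift preserves the span of I, J, K: its gl(n, H) part commutes with I. *)
Lemma conn_shift_comm xi v :
  conn_shift I J K xi v *m I - I *m conn_shift I J K xi v =
  (2 * cov xi (J *m v)) *: K - (2 * cov xi (K *m v)) *: J.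
Proof.
have [II JJ KK IJ JI] := qIJK; have [JK KJ KI IK] := quaternion_table qIJK.
have tl q : shift_term q xi v *m I =
    cov xi (q *m v) *: (q *m I) + (q *m v) *m (xi *m (q *m I)).
  by rewrite /shift_term mulmxDl -scalemxAl !mulmxA.
have tr q : I *m shift_term q xi v =
    cov xi (q *m v) *: (I *m q) + (I *m q *m v) *m (xi *m q).
  by rewrite /shift_term mulmxDr -scalemxAr !mulmxA.
have dl (A B C D : 'M[R]_m) : (A - (B + C + D)) *m I = A *m I - (B *m I + C *m I + D *m I).
  by rewrite mulmxBl !mulmxDl.
have dr (A B C D : 'M[R]_m) : I *m (A - (B + C + D)) = I *m A - (I *m B + I *m C + I *m D).
  by rewrite mulmxBr !mulmxDr.
rewrite /conn_shift dl dr !tl !tr (mulmxDl (_ *: _)) (mulmxDr I (_ *: _)).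
rewrite -!scalemxAl -!scalemxAr mul1mx mulmx1 ?(II, IJ, JI, KI, IK).
rewrite !(mulmxN, mulNmx, mulmx1, mul1mx, mulmxA).
move: (cov _ _) (cov _ _) (cov _ _) (cov _ _) => c0 c1 c2 c3.
move: (v *m xi *m I) (I *m v *m xi) (v *m xi) => A B C.
move: (I *m v *m xi *m I) (J *m v *m xi *m K) (K *m v *m xi *m J) => F G H.
mx_ring.
Qed.

Lemma conn_shift_tr xi v : \tr (conn_shift I J K xi v) = (m%:R + 4) * cov xi v.
Proof.
have t q : \tr q = 0 -> q *m q = - 1%:M -> \tr (shift_term q xi v) = - cov xi v.
  move=> q0 qq; rewrite /shift_term mxtraceD mxtraceZ q0 mulr0 add0r.
  by rewrite cov_trace /cov !mulmxA -(mulmxA xi) qq mulmxN mulmx1 mulNmx mxE.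
have [II JJ KK _ _] := qIJK; have rJ := quaternion_rot qIJK.
rewrite /conn_shift tr_shape mxtraceD mxtraceZ mxtrace1 cov_trace.
rewrite !t ?(quaternion_tr qIJK) ?(quaternion_tr rJ) //.
  by ring.
by rewrite (quaternion_tr (quaternion_rot rJ)).
Qed.

(** This trace is what enters the change of the curvature form of I. *)
Lemma conn_shift_trI xi v : \tr (conn_shift I J K xi v *m I) = m%:R * cov xi (I *m v).
Proof.
have [II JJ KK IJ JI] := qIJK; have [JK KJ KI IK] := quaternion_table qIJK.
have rJ := quaternion_rot qIJK; have rK := quaternion_rot rJ.
have t q : \tr (shift_term q xi v *m I) =
   cov xi (q *m v) * \tr (q *m I) + cov xi (q *m I *m q *m v).
  by rewrite /shift_term mulmxDl mxtraceD -scalemxAl mxtraceZ -(mulmxA (q *m v)) cov_trace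
     /cov !mulmxA.
have dl (A B C D : 'M[R]_m) : (A - (B + C + D)) *m I = A *m I - (B *m I + C *m I + D *m I).
  by rewrite mulmxBl !mulmxDl.
have IIv : I *m I *m I *m v = - (I *m v) by rewrite II mulNmx mul1mx mulNmx.
have JIJv : J *m I *m J *m v = I *m v by rewrite JI mulNmx KJ opprK.
have KIKv : K *m I *m K *m v = I *m v by rewrite KI JK.
rewrite /conn_shift dl tr_shape (t I) (t J) (t K) IIv JIJv KIKv covN.
rewrite (mulmxDl (cov xi v *: 1%:M)) mxtraceD.
rewrite -scalemxAl mul1mx mxtraceZ (quaternion_tr qIJK) II JI KI.
rewrite !raddfN /= mxtrace1 (quaternion_tr rJ) (quaternion_tr rK).
rewrite -mulmxA cov_trace /cov -mulmxA -/(cov xi (I *m v)).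
by move: (cov xi (I *m v)) => c; ring.
Qed.

End Quaternionic.
End ConnShift.

(** * Contorsion of a Hermitian metric *)

Section ContorsionMatrix.
Context {R : realType} {m : nat}.
Implicit Types (u v w : 'cV[R]_m).

(** The matrix A such that g(A y, z) = a(y, z). *)
Definition form_endo (g : 'M[R]_m) (a : 'cV[R]_m -> 'cV[R]_m -> R) : 'M[R]_m :=
  invmx g *m \matrix_(i, j) a (basis_vec R j) (basis_vec R i).

Lemma bilin_of_form (a : 'cV[R]_m -> 'cV[R]_m -> R) :
  (forall c u v w, a (c *: u + v) w = c * a u w + a v w) ->
  (forall c u v w, a w (c *: u + v) = c * a w u + a w v) ->
  forall u v, bilin (\matrix_(i, j) a (basis_vec R j) (basis_vec R i)) v u = a u v.
Proof.
move=> al ar u v.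
rewrite bilinE (linear_form_sum (f := fun u => a u v)) // exchange_big /=.
apply: eq_bigr => j _; rewrite (linear_form_sum (f := fun v => a _ v)) // mulr_sumr.
by apply: eq_bigr => i _; rewrite mxE mulrC mulrA mulrAC -mulrA mulrC.
Qed.

Section Contorsion.
Variables (I J K g : 'M[R]_m) (H : 'cV[R]_m -> 'M[R]_m).
Hypothesis qIJK : quaternion_relations I J K.
Hypothesis gpos : forall v, v != 0 -> 0 < bilin g v v.
Hypothesis gsym : g^T = g.
Hypothesis H_lin : linear H.
Hypothesis H_sym : forall v, (H v)^T = H v.
Hypotheses (gI : I^T *m g *m I = g) (gJ : J^T *m g *m J = g) (gK : K^T *m g *m K = g).
Hypotheses (HI : forall v, I^T *m H v *m I = H v) (HJ : forall v, J^T *m H v *m J = H v).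

Local Notation h := (fun x y z => bilin (H x) y z).
Local Notation lm A := (fun v : 'cV[R]_m => A *m v).
Local Notation a := (contorsion3 (lm I) h).

Hypothesis qkt : forall x y z, torsion3 (lm I) h x y z = torsion3 (lm J) h x y z.

Definition contorsion_mx (x : 'cV[R]_m) : 'M[R]_m := form_endo g (a x).

Let HD x y : H (x + y) = H x + H y := lin_funD H_lin x y.
Let HZ c x : H (c *: x) = c *: H x := lin_funZ H_lin c x.
Let HN x : H (- x) = - H x := lin_funN H_lin x.

Let odd_h : odd3 h.
Proof. by split=> [x y z|x]; [rewrite /= HN bilinN|split=> y z; rewrite /= ?bilinNl ?bilinNr]. Qed.
Let h_sym x y z : h x y z = h x z y. Proof. by rewrite /= -bilin_tr H_sym. Qed.
Let h_I x y z : h x (I *m y) (I *m z) = h x y z.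
Proof. by rewrite /= -bilinMr -bilinMl mulmxA HI. Qed.
Let h_J x y z : h x (J *m y) (J *m z) = h x y z.
Proof. by rewrite /= -bilinMr -bilinMl mulmxA HJ. Qed.
Let qA := quaternion_mx_action qIJK.

Lemma contorsion_mxE x y z : bilin g z (contorsion_mx x *m y) = a x y z.
Proof.
rewrite -bilinMr /contorsion_mx /form_endo mulKVmx ?posdef_unit //.
apply: (@bilin_of_form (a x)) => c u v w;
  rewrite /contorsion3 /torsion3 /= ?(mulmxDr, HD, HZ, bilinDl, bilinDr, bilinD);
  rewrite -?scalemxAr ?(HZ, bilinZl, bilinZr, bilinZ); ring.
Qed.

Lemma contorsion_mx_ext x (A : 'M[R]_m) :
  (forall y z, bilin g z (A *m y) = a x y z) -> A = contorsion_mx x.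
Proof.
move=> hA; have gu := posdef_unit gpos.
rewrite -[A](mulKmx gu) -[contorsion_mx x](mulKmx gu); congr (_ *m _).
by apply: bilin_ext => z y; rewrite !bilinMr hA contorsion_mxE.
Qed.

Lemma contorsion_mx_lin : linear contorsion_mx.
Proof.
move=> c x w; apply/esym/contorsion_mx_ext => y z.
rewrite mulmxDl -scalemxAl bilinDr bilinZr !contorsion_mxE /contorsion3 /torsion3.
rewrite ?(mulmxDr, HD, bilinDl, bilinDr, bilinD) -?scalemxAr.
rewrite ?(HZ, bilinZl, bilinZr, bilinZ); ring.
Qed.

(** An endomorphism commutes with a g-orthogonal Q, Q^2 = -1, as soon as the form
    it defines is Q-invariant. *)
Lemma contorsion_mx_comm_of (Q : 'M[R]_m) x : Q *m Q = - 1%:M -> Q^T *m g *m Q = g ->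
  (forall y z, a x (Q *m y) (Q *m z) = a x y z) ->
  contorsion_mx x *m Q = Q *m contorsion_mx x.
Proof.
move=> QQ gQ aQ; have gu := posdef_unit gpos.
have key z u : bilin g z (Q *m u) = - bilin g (Q *m z) u.
  by rewrite -{1}gQ bilinMr bilinMl mulmxA QQ mulNmx mul1mx bilinNr.
suff e : - (Q *m (contorsion_mx x *m Q)) = contorsion_mx x.
  by rewrite -[X in _ = Q *m X]e mulmxN (mulmxA Q Q) QQ mulNmx mul1mx opprK.
apply: contorsion_mx_ext => y z.
by rewrite -(aQ y z) -contorsion_mxE mulNmx bilinNr -!mulmxA key opprK.
Qed.

Lemma contorsion_mx_comm x :
  [/\ contorsion_mx x *m I = I *m contorsion_mx x,
      contorsion_mx x *m J = J *m contorsion_mx x &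
      contorsion_mx x *m K = K *m contorsion_mx x].
Proof.
have [II JJ KK IJ JI] := qIJK.
have cI : contorsion_mx x *m I = I *m contorsion_mx x.
  by apply: contorsion_mx_comm_of => // y z; exact: (contorsion3_inv qA odd_h h_sym h_I).
have cJ : contorsion_mx x *m J = J *m contorsion_mx x.
  apply: contorsion_mx_comm_of => // y z.
  have aJ u v : a x u v = contorsion3 (lm J) h x u v by rewrite /contorsion3 qkt.
  by rewrite !aJ; exact: (contorsion3_inv (quaternion_action_rot qA) odd_h h_sym h_J).
by split=> //; rewrite -IJ mulmxA cI -mulmxA cJ mulmxA.
Qed.

Lemma contorsion_mx_metric x :
  (contorsion_mx x)^T *m g + g *m contorsion_mx x = H x.
Proof.
apply: bilin_ext => y z; rewrite bilinD bilinMl bilinMr contorsion_mxE.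
rewrite -gsym bilin_tr contorsion_mxE.
exact: (contorsion3_metric qA odd_h h_sym h_I).
Qed.

Lemma contorsion_mx_torsion u v w :
  bilin g u (contorsion_mx v *m w - contorsion_mx w *m v) = torsion3 (lm I) h u v w.
Proof.
rewrite bilinDr bilinNr !contorsion_mxE (contorsion3_torsion qA odd_h h_sym h_I).
by rewrite /torsion3; ring.
Qed.

Lemma contorsion_mx_skew u v w :
  let t u v w := bilin g u (contorsion_mx v *m w - contorsion_mx w *m v) in
  t v u w = - t u v w /\ t u w v = - t u v w.
Proof. by rewrite /= !contorsion_mx_torsion; exact: (torsion3_skew qA odd_h h_sym h_I). Qed.

End Contorsion.

(** The mechanism behind the type condition: a metric change of connection that
    commutes with Q has torsion of type (2,1) + (1,2) for Q. *)
Lemma torsion_type (g Q : 'M[R]_m) (A : 'cV[R]_m -> 'M[R]_m) :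
  linear A -> Q *m Q = - 1%:M -> Q^T *m g *m Q = g ->
  (forall x, A x *m Q = Q *m A x) ->
  let t u v w := bilin g u (A v *m w - A w *m v) in
  forall u v w, t u v w = t u (Q *m v) (Q *m w) + t (Q *m u) v (Q *m w)
    + t (Q *m u) (Q *m v) w.
Proof.
move=> A_lin QQ gQ AQ t u v w.
have AN x : A (- x) = - A x := lin_funN A_lin x.
apply: (@type_of_invariant R 'cV[R]_m (fun v => Q *m v)
   (fun x y z => bilin g z (A x *m y)) t).
- by move=> x; rewrite mulmxA QQ mulNmx mul1mx.
- split=> [x y z|x]; first by rewrite AN mulNmx bilinNr.
  by split=> y z; rewrite ?mulmxN ?bilinNl ?bilinNr.
- by move=> x y z; rewrite mulmxA AQ -mulmxA -bilinMl -bilinMr gQ.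
- by move=> x y z; rewrite /t bilinDr bilinNr.
Qed.

End ContorsionMatrix.

(** * The QKT condition in dimension four *)

Section DimensionFour.
Context {R : realType} {m : nat}.
Hypothesis m4 : m = 4%N.

Section Quaternions.
Variables (I J K : 'M[R]_m).
Hypothesis qIJK : quaternion_relations I J K.
Variables (e : 'cV[R]_m).
Hypothesis e0 : e != 0.

(** The quaternion with coordinates c, acting on the left. *)
Definition quat_comb (c : 'I_4 -> R) : 'M[R]_m :=
  c 0 *: 1%:M + c 1 *: I + c 2 *: J + c 3 *: K.

Lemma quat_combE c i : (quat_comb c *m e) i 0 =
  c 0 * e i 0 + c 1 * (I *m e) i 0 + c 2 * (J *m e) i 0 + c 3 * (K *m e) i 0.
Proof.
rewrite /quat_comb !mulmxDl -!scalemxAl mul1mx.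
by move: (I *m e) (J *m e) (K *m e) => Ie Je Ke; rewrite !mxE.
Qed.

(** Multiplying by the conjugate quaternion leaves |c|^2 e. *)
Lemma quat_comb_inj (c : 'I_4 -> R) : quat_comb c *m e = 0 -> forall i, c i = 0.
Proof.
have [II JJ KK IJ JI] := qIJK; have [JK KJ KI IK] := quaternion_table qIJK.
move=> ce.
pose N := c 0 * c 0 + c 1 * c 1 + c 2 * c 2 + c 3 * c 3.
have : (c 0 *: 1%:M - c 1 *: I - c 2 *: J - c 3 *: K) *m (quat_comb c *m e) = N *: e.
  rewrite mulmxA; have -> : (c 0 *: 1%:M - c 1 *: I - c 2 *: J - c 3 *: K) *m quat_comb c = N%:M.
    rewrite /quat_comb !(mulmxDl, mulmxDr, mulNmx) -!scalemxAl -!scalemxAr.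
    rewrite !mulmx1 !mul1mx II JJ KK IJ JI JK KJ KI IK -scalemx1 /N.
    mx_ring.
  by rewrite mul_scalar_mx.
rewrite ce mulmx0 => /esym/eqP; rewrite scaler_eq0 (negPf e0) orbF => /eqP N0.
have sq i : 0 <= c i * c i by rewrite -expr2 sqr_ge0.
have z i : c i * c i <= 0 -> c i = 0.
  move=> ci; have /eqP : c i * c i = 0 by apply/le_anti; rewrite ci sq.
  by rewrite mulf_eq0 orbb => /eqP.
have s0 := sq 0; have s1 := sq 1; have s2 := sq 2; have s3 := sq 3.
by case; case=> [|[|[|[|//]]]] lti;
  [have -> : Ordinal lti = 0 by exact: val_inj|have -> : Ordinal lti = 1 by exact: val_inj
  |have -> : Ordinal lti = 2 by exact: val_inj|have -> : Ordinal lti = 3 by exact: val_inj];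
  apply: z; move: N0; rewrite /N; lra.
Qed.

(** Injectivity of the orbit map of e between spaces of the same dimension 4. *)
Lemma quat_comb_surj v : exists c, v = quat_comb c *m e.
Proof.
pose cs (x : 'cV[R]_m) (i : 'I_4) : R := x (cast_ord (esym m4) i) 0.
pose B : 'M[R]_m := \matrix_(i, j)
  (quat_comb (fun k => (k == cast_ord m4 j)%:R) *m e) i 0.
have BE x : B *m x = quat_comb (cs x) *m e.
  apply/matrixP => i j; rewrite (ord1 j) [LHS]mxE.
  have Bij k : B i k = (quat_comb (fun l => (l == cast_ord m4 k)%:R) *m e) i 0.
    by rewrite [LHS]mxE.
  rewrite (reindex (cast_ord (esym m4))) /=; last first.
    by exists (cast_ord m4) => k _; rewrite ?cast_ordK ?cast_ordKV.
  rewrite quat_combE !big_ord_recl big_ord0 !Bij !cast_ordKV !quat_combE /cs.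
  have -> : lift ord0 ord0 = 1 :> 'I_4 by exact: val_inj.
  have -> : lift ord0 (lift ord0 ord0) = 2 :> 'I_4 by exact: val_inj.
  have -> : lift ord0 (lift ord0 (lift ord0 ord0)) = 3 :> 'I_4 by exact: val_inj.
  rewrite /=; ring.
have Bu : B \in unitmx.
  apply: unit_of_inj => x; rewrite BE => /quat_comb_inj cx.
  apply/matrixP => i j; rewrite (ord1 j) mxE -(cx (cast_ord m4 i)) /cs.
  by rewrite cast_ordK.
by exists (cs (invmx B *m v)); rewrite -BE mulKVmx.
Qed.

Lemma vanish_on_frame (f : 'cV[R]_m -> R) :
  (forall c u v, f (c *: u + v) = c * f u + f v) ->
  f e = 0 -> f (I *m e) = 0 -> f (J *m e) = 0 -> f (K *m e) = 0 -> forall v, f v = 0.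
Proof.
move=> fl f0 fI fJ fK v; have [c ->] := quat_comb_surj v.
rewrite /quat_comb !mulmxDl -!scalemxAl mul1mx -!addrA !fl f0 fI fJ.
have -> : c 3 *: (K *m e) = c 3 *: (K *m e) + 0 by rewrite addr0.
have fz : f 0 = 0 by have := fl 1 0 0; rewrite scale1r addr0; lra.
by rewrite fl fK fz !mulr0 !addr0.
Qed.

End Quaternions.

(** Hermitian forms are diagonal with equal entries on e, Ie, Je, Ke, so both sides
    reduce on basis vectors to the values h(x, e, e). *)
Lemma torsion3_dim4 (I J K : 'M[R]_m) (H : 'cV[R]_m -> 'M[R]_m) :
  quaternion_relations I J K -> linear H -> (forall v, (H v)^T = H v) ->
  (forall v, I^T *m H v *m I = H v) -> (forall v, J^T *m H v *m J = H v) ->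
  (forall v, K^T *m H v *m K = H v) ->
  forall x y z, torsion3 (fun v => I *m v) (fun x y z => bilin (H x) y z) x y z =
                torsion3 (fun v => J *m v) (fun x y z => bilin (H x) y z) x y z.
Proof.
move=> qIJK H_lin H_sym HI HJ HK x y z.
have HD u v : H (u + v) = H u + H v := lin_funD H_lin u v.
have HZ c u : H (c *: u) = c *: H u := lin_funZ H_lin c u.
have HN u : H (- u) = - H u := lin_funN H_lin u.
have [[nI nJ nK] [II JJ KK] [IJ JK KI] [JI KJ IK]] := quaternion_mx_action qIJK.
have h_sym w u v : bilin (H w) u v = bilin (H w) v u by rewrite -bilin_tr H_sym.
have h_I w u v : bilin (H w) (I *m u) (I *m v) = bilin (H w) u v.
  by rewrite -bilinMr -bilinMl mulmxA HI.
have h_J w u v : bilin (H w) (J *m u) (J *m v) = bilin (H w) u v.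
  by rewrite -bilinMr -bilinMl mulmxA HJ.
have h_K w u v : bilin (H w) (K *m u) (K *m v) = bilin (H w) u v.
  by rewrite -bilinMr -bilinMl mulmxA HK.
pose e : 'cV[R]_m := \col_i 1.
have e0 : e != 0.
  apply/eqP => /matrixP/(_ (cast_ord (esym m4) 0) 0); rewrite !mxE => /eqP.
  by rewrite oner_eq0.
(* each H w is diagonal, with equal entries, on the frame e, Ie, Je, Ke *)
have z1 w : bilin (H w) e (I *m e) = 0.
  by have := h_I w e (I *m e); rewrite II bilinNr h_sym; lra.
have z2 w : bilin (H w) e (J *m e) = 0.
  by have := h_J w e (J *m e); rewrite JJ bilinNr h_sym; lra.
have z3 w : bilin (H w) e (K *m e) = 0.
  by have := h_K w e (K *m e); rewrite KK bilinNr h_sym; lra.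
have z4 w : bilin (H w) (I *m e) (J *m e) = 0.
  by have := h_I w (I *m e) (J *m e); rewrite II IJ bilinNl z3 => <-; rewrite oppr0.
have z5 w : bilin (H w) (I *m e) (K *m e) = 0.
  by have := h_I w (I *m e) (K *m e); rewrite II IK bilinNl bilinNr z2 => <-; rewrite oppr0 oppr0.
have z6 w : bilin (H w) (J *m e) (K *m e) = 0.
  by have := h_J w (J *m e) (K *m e); rewrite JJ JK bilinNl z1 => <-; rewrite oppr0.
have zs w := (z1 w, z2 w, z3 w, z4 w, z5 w, z6 w,
  h_sym w (I *m e) e, h_sym w (J *m e) e, h_sym w (K *m e) e,
  h_sym w (J *m e) (I *m e), h_sym w (K *m e) (I *m e), h_sym w (K *m e) (J *m e),
  h_I w e e, h_J w e e, h_K w e e).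
pose d u v w := torsion3 (fun v => I *m v) (fun x y z => bilin (H x) y z) u v w -
                torsion3 (fun v => J *m v) (fun x y z => bilin (H x) y z) u v w.
have dl v w c u1 u2 : d (c *: u1 + u2) v w = c * d u1 v w + d u2 v w.
  rewrite /d /torsion3 !(mulmxDr, HD, bilinDl, bilinDr, bilinD) -!scalemxAr.
  by rewrite !(HZ, bilinZ, bilinZr, bilinZl); ring.
have dm u w c u1 u2 : d u (c *: u1 + u2) w = c * d u u1 w + d u u2 w.
  rewrite /d /torsion3 !(mulmxDr, HD, bilinDl, bilinDr, bilinD) -!scalemxAr.
  by rewrite !(HZ, bilinZ, bilinZr, bilinZl); ring.
have dr u v c u1 u2 : d u v (c *: u1 + u2) = c * d u v u1 + d u v u2.
  rewrite /d /torsion3 !(mulmxDr, HD, bilinDl, bilinDr, bilinD) -!scalemxAr.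
  by rewrite !(HZ, bilinZ, bilinZr, bilinZl); ring.
suff d0 : d x y z = 0 by apply/eqP; rewrite -subr_eq0; apply/eqP.
have nE := (nI, nJ, nK, II, JJ, KK, IJ, JK, KI, JI, KJ, IK).
have frame := vanish_on_frame qIJK e0.
by apply: (frame (fun x => d x y z)) => //; apply: (frame (fun y => d _ y z)) => //;
  apply: (frame (fun z => d _ _ z)) => //;
  rewrite /d /torsion3 ?nE ?(HN, bilinN, bilinNl, bilinNr) ?zs; ring.
Qed.

End DimensionFour.

(** * Connections in a chart *)

Lemma is_derive_val (R : realType) (V F : normedModType R) (f : V -> F) x v d :
  is_derive x v f d -> 'D_v f x = d.
Proof. by case. Qed.

Lemma derive_lincomb (R : realType) (V F : normedModType R) (f g : V -> F) (a : R) x v :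
  derivable f x v -> derivable g x v ->
  'D_v (fun y => a *: f y + g y) x = a *: 'D_v f x + 'D_v g x.
Proof.
move=> df dg; apply: is_derive_val.
exact: (is_deriveD (is_deriveZ a (derivableP df)) (derivableP dg)).
Qed.

Section NablaCalculus.
Context {R : realType} {m : nat}.
Local Notation E := 'cV[R]_m.
Local Notation M := 'M[R]_m.
Implicit Types (W : set E) (Gam : 'I_m -> E -> M) (A B : E -> M) (x u v w : E).

Lemma conn_mx_lin Gam x : linear (conn_mx Gam x).
Proof.
move=> a u v; rewrite /conn_mx scaler_sumr -big_split; apply: eq_bigr => k _.
by rewrite !mxE scalerDl scalerA.
Qed.

Lemma conn_mx_smooth W Gam v : open W -> (forall k, smooth_on W (Gam k)) ->
  smooth_on W (fun x => conn_mx Gam x v).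
Proof.
by move=> oW sG; apply: smooth_sum => // k; apply: smooth_scale => //; exact: smooth_cst.
Qed.

Lemma conn_mx_add Gam (C : 'I_m -> E -> M) x v :
  conn_mx (fun k y => Gam k y + C k y) x v = conn_mx Gam x v + conn_mx C x v.
Proof. by rewrite /conn_mx -big_split; apply: eq_bigr => k _; rewrite scalerDr. Qed.

(** Lets a connection be defined by a formula for the whole endomorphism of v. *)
Lemma linear_conn_mx (f : E -> E -> M) x v : linear (f x) ->
  conn_mx (fun k y => f y (basis_vec R k)) x v = f x v.
Proof.
move=> fl; rewrite /conn_mx [in RHS](cV_sum_basis v).
elim: (index_enum _) => [|k r IH]; first by rewrite !big_nil (lin_fun0 fl).
by rewrite !big_cons fl IH.
Qed.

Lemma nabla_endo_smooth W Gam A v : open W -> (forall k, smooth_on W (Gam k)) ->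
  smooth_on W A -> smooth_on W (nabla_endo Gam v A).
Proof.
move=> oW sG sA; apply: smoothB => //; last first.
  by apply: smooth_mulmx => //; exact: conn_mx_smooth.
apply: smoothD => //; first exact: smooth_derive.
by apply: smooth_mulmx => //; exact: conn_mx_smooth.
Qed.

Lemma nabla_bilin_smooth W Gam A v : open W -> (forall k, smooth_on W (Gam k)) ->
  smooth_on W A -> smooth_on W (nabla_bilin Gam v A).
Proof.
move=> oW sG sA; apply: smoothB => //; last first.
  by apply: smooth_mulmx => //; exact: conn_mx_smooth.
apply: smoothB => //; first exact: smooth_derive.
by apply: smooth_mulmx => //; apply: smooth_trmx => //; exact: conn_mx_smooth.
Qed.

Lemma near_on W (T : Type) (f g : E -> T) x : open W -> W x ->
  (forall y, W y -> f y = g y) -> \forall y \near x, f y = g y.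
Proof. by move=> oW Wx fg; apply: filterS (open_nbhs_nbhs (conj oW Wx)) => y /fg. Qed.

Lemma derive_on W (F : normedModType R) (f g : E -> F) x v : open W -> W x ->
  (forall y, W y -> f y = g y) -> 'D_v f x = 'D_v g x.
Proof. by move=> oW Wx fg; apply: near_eq_derive; exact: near_on fg. Qed.

Lemma nabla_endo_on W Gam A B x v : open W -> W x -> (forall y, W y -> A y = B y) ->
  nabla_endo Gam v A x = nabla_endo Gam v B x.
Proof. by move=> oW Wx AB; rewrite /nabla_endo (derive_on _ oW Wx AB) AB. Qed.

Lemma nabla_bilin_on W Gam A B x v : open W -> W x -> (forall y, W y -> A y = B y) ->
  nabla_bilin Gam v A x = nabla_bilin Gam v B x.
Proof. by move=> oW Wx AB; rewrite /nabla_bilin (derive_on _ oW Wx AB) AB. Qed.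

Lemma nabla_endoM Gam A B x v : derivable A x v -> derivable B x v ->
  nabla_endo Gam v (fun y => A y *m B y) x =
  nabla_endo Gam v A x *m B x + A x *m nabla_endo Gam v B x.
Proof.
move=> dA dB; rewrite /nabla_endo; have [_ ->] := is_derive_mulmx dA dB.
move: ('D_v A x) ('D_v B x) (conn_mx _ _ _) (A x) (B x) => DA DB C a b.
rewrite !(mulmxDl, mulmxBl, mulmxDr, mulmxBr, mulmxA, mulNmx, mulmxN).
move: (DA *m b) (a *m DB) (C *m a *m b) (a *m C *m b) (a *m b *m C) => x1 x2 x3 x4 x5.
mx_ring.
Qed.

Lemma nabla_endo_cst Gam c x v : nabla_endo Gam v (fun=> c%:M) x = 0.
Proof.
rewrite /nabla_endo derive_cst add0r mul_scalar_mx mul_mx_scalar subrr //.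
Qed.

Lemma nabla_endoZ Gam (f : E -> R) A x v : derivable f x v -> derivable A x v ->
  nabla_endo Gam v (fun y => f y *: A y) x =
  'D_v f x *: A x + f x *: nabla_endo Gam v A x.
Proof.
move=> df dA; rewrite /nabla_endo; have [_ ->] := is_derive_scale df dA.
rewrite -scalemxAl -scalemxAr; move: ('D_v f x) ('D_v A x) (conn_mx Gam x v *m A x) (A x *m conn_mx Gam x v) (A x).
move=> d D a b c; mx_ring.
Qed.

Lemma nabla_endoD Gam A B x v : derivable A x v -> derivable B x v ->
  nabla_endo Gam v (fun y => A y + B y) x =
  nabla_endo Gam v A x + nabla_endo Gam v B x.
Proof.
move=> dA dB; rewrite /nabla_endo deriveD //.
move: ('D_v A x) ('D_v B x) (conn_mx _ _ _) (A x) (B x) => DA DB C a b.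
rewrite mulmxDl mulmxDr.
move: (C *m a) (C *m b) (a *m C) (b *m C) => x1 x2 x3 x4.
mx_ring.
Qed.

Lemma nabla_endoN Gam A x v : derivable A x v ->
  nabla_endo Gam v (fun y => - A y) x = - nabla_endo Gam v A x.
Proof.
move=> dA; rewrite /nabla_endo (_ : 'D_v (fun y => - A y) x = - 'D_v A x).
  rewrite mulmxN mulNmx; move: ('D_v A x) (conn_mx Gam x v *m A x) (A x *m conn_mx Gam x v).
  move=> a b c; mx_ring.
exact: deriveN.
Qed.

Lemma nabla_bilinD Gam A B x v : derivable A x v -> derivable B x v ->
  nabla_bilin Gam v (fun y => A y + B y) x =
  nabla_bilin Gam v A x + nabla_bilin Gam v B x.
Proof.
move=> dA dB; rewrite /nabla_bilin deriveD // mulmxDl mulmxDr.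
move: ('D_v A x) ('D_v B x) => DA DB.
move: (_ *m A x) (_ *m B x) (A x *m _) (B x *m _) => x1 x2 x3 x4.
mx_ring.
Qed.

Lemma nabla_bilinZ Gam c A x v : derivable A x v ->
  nabla_bilin Gam v (fun y => c *: A y) x = c *: nabla_bilin Gam v A x.
Proof.
move=> dA; rewrite /nabla_bilin (_ : 'D_v (fun y => c *: A y) x = c *: 'D_v A x).
  by rewrite -scalemxAl -scalemxAr !scalerBr.
exact: deriveZ.
Qed.

Lemma nabla_bilin_mulr Gam A B x v : derivable A x v -> derivable B x v ->
  nabla_bilin Gam v (fun y => B y *m A y) x =
  nabla_bilin Gam v B x *m A x + B x *m nabla_endo Gam v A x.
Proof.
move=> dA dB; rewrite /nabla_endo /nabla_bilin; have [_ ->] := is_derive_mulmx dB dA.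
move: ('D_v A x) ('D_v B x) (conn_mx _ _ _) (A x) (B x) => DA DB C a b.
rewrite !(mulmxDl, mulmxBl, mulmxDr, mulmxBr, mulmxA, mulNmx, mulmxN).
move: (DB *m a) (b *m DA) (C^T *m b *m a) (b *m C *m a) (b *m a *m C) => x1 x2 x3 x4 x5.
mx_ring.
Qed.

Lemma nabla_bilin_tr Gam B x v : derivable B x v ->
  nabla_bilin Gam v (fun y => (B y)^T) x = (nabla_bilin Gam v B x)^T.
Proof.
move=> dB; rewrite /nabla_bilin; have [_ ->] := is_derive_trmx dB.
by rewrite !linearB /= !trmx_mul trmxK addrAC.
Qed.

Lemma nabla_bilin_lin W Gam A x : open W -> smooth_on W A -> W x ->
  linear (fun v => nabla_bilin Gam v A x).
Proof.
move=> oW sA Wx a u v; rewrite /nabla_bilin.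
have -> : 'D_(a *: u + v) A x = a *: 'D_u A x + 'D_v A x.
  rewrite !(derive_sum_basis _ oW sA Wx) scaler_sumr -big_split.
  by apply: eq_bigr => k _; rewrite !mxE scalerDl scalerA.
rewrite conn_mx_lin linearD linearZ /= !(mulmxDl, mulmxDr) -!scalemxAl -!scalemxAr.
move: ('D_u A x) ('D_v A x) => x1 x2.
move: ((conn_mx _ _ u)^T *m _) ((conn_mx _ _ v)^T *m _).
move: (_ *m conn_mx _ _ u) (_ *m conn_mx _ _ v).
move=> x3 x4 x5 x6; mx_ring.
Qed.

(** The curvature, written for constant fields u and v. *)
Definition curv Gam u v x : M :=
  'D_u (fun y => conn_mx Gam y v) x - 'D_v (fun y => conn_mx Gam y u) x
  + conn_mx Gam x u *m conn_mx Gam x v - conn_mx Gam x v *m conn_mx Gam x u.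

Lemma curv_skew Gam u v x : curv Gam v u x = - curv Gam u v x.
Proof.
rewrite /curv; move: ('D_u _ x) ('D_v _ x) (_ *m _) (_ *m conn_mx _ _ u) => a b c d.
mx_ring.
Qed.

Section OnOpen.
Variables (W : set E) (Gam : 'I_m -> E -> M).
Hypotheses (oW : open W) (sG : forall k, smooth_on W (Gam k)).
Let sC v := conn_mx_smooth v oW sG.

Lemma curv_linl v x : W x -> linear (fun u => curv Gam u v x).
Proof.
move=> Wx a u w; rewrite /curv.
have -> : 'D_(a *: u + w) (fun y => conn_mx Gam y v) x =
    a *: 'D_u (fun y => conn_mx Gam y v) x + 'D_w (fun y => conn_mx Gam y v) x.
  rewrite !(derive_sum_basis _ oW (sC v) Wx) scaler_sumr -big_split.
  by apply: eq_bigr => k _; rewrite !mxE scalerDl scalerA.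
have -> : (fun y => conn_mx Gam y (a *: u + w)) =
    (fun y => a *: conn_mx Gam y u + conn_mx Gam y w).
  by apply/funext => y; rewrite conn_mx_lin.
have du : derivable (fun y => conn_mx Gam y u) x v by exact: smooth_derivable (sC u) Wx.
have dw : derivable (fun y => conn_mx Gam y w) x v by exact: smooth_derivable (sC w) Wx.
have -> : 'D_v (fun y => a *: conn_mx Gam y u + conn_mx Gam y w) x =
    a *: 'D_v (fun y => conn_mx Gam y u) x + 'D_v (fun y => conn_mx Gam y w) x.
  exact: derive_lincomb.
rewrite conn_mx_lin mulmxDl mulmxDr -scalemxAl -scalemxAr.
move: ('D_v _ x) ('D_v _ x) ('D_u _ x) ('D_w _ x) => x1 x2 x3 x4.
move: (_ *m conn_mx _ _ u) (_ *m conn_mx _ _ w) (conn_mx _ _ u *m _) (conn_mx _ _ w *m _).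
move=> x5 x6 x7 x8; mx_ring.
Qed.

(** The Ricci identity on endomorphisms, for constant fields u and v, whose bracket
    vanishes. *)
Lemma nabla_endo_comm A u v x : smooth_on W A -> W x ->
  nabla_endo Gam u (nabla_endo Gam v A) x - nabla_endo Gam v (nabla_endo Gam u A) x =
  curv Gam u v x *m A x - A x *m curv Gam u v x.
Proof.
move=> sA Wx.
have dn a b : 'D_a (nabla_endo Gam b A) x = 'D_a ('D_b A) x
   + ('D_a (fun y => conn_mx Gam y b) x *m A x + conn_mx Gam x b *m 'D_a A x)
   - ('D_a A x *m conn_mx Gam x b + A x *m 'D_a (fun y => conn_mx Gam y b) x).
  have dA : derivable A x a by exact: smooth_derivable sA Wx.
  have dC : derivable (fun y => conn_mx Gam y b) x a by exact: smooth_derivable (sC b) Wx.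
  have dDA : derivable ('D_b A) x a by exact: smooth_derivable (smooth_derive b sA) Wx.
  apply: is_derive_val; apply: is_deriveB (is_derive_mulmx dA dC).
  exact: is_deriveD (derivableP dDA) (is_derive_mulmx dC dA).
rewrite {1 3}/nabla_endo !dn (Schwarz_mx u v oW sA Wx) /nabla_endo /curv.
move: ('D_v ('D_u A) x) ('D_v A x) ('D_u A x) => DD Dv Du.
move: ('D_u _ x) ('D_v _ x) (conn_mx _ _ u) (conn_mx _ _ v) (A x) => Cuv Cvu Cu Cv a.
rewrite !(mulmxDl, mulmxBl, mulmxDr, mulmxBr, mulmxA, mulNmx, mulmxN).
move: (Cuv *m a) (a *m Cuv) (Cvu *m a) (a *m Cvu) => x1 x2 x3 x4.
move: (Cu *m Dv) (Dv *m Cu) (Cv *m Du) (Du *m Cv) => x5 x6 x7 x8.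
move: (Cu *m Cv *m a) (Cv *m Cu *m a) (a *m Cu *m Cv) (a *m Cv *m Cu) => y1 y2 y3 y4.
move: (Cu *m a *m Cv) (Cv *m a *m Cu) => y5 y6.
mx_ring.
Qed.

Hypothesis symG : forall x, W x -> forall u v,
  conn_mx Gam x u *m v = conn_mx Gam x v *m u.

Lemma curv_bianchi1 u v w x : W x ->
  curv Gam u v x *m w + curv Gam v w x *m u + curv Gam w u x *m v = 0.
Proof.
move=> Wx.
have sD a b c : 'D_a (fun y => conn_mx Gam y b) x *m c =
                'D_a (fun y => conn_mx Gam y c) x *m b.
  have e (z t : E) : 'D_a (fun y => conn_mx Gam y z) x *m t = 'D_a (fun y => conn_mx Gam y z *m t) x.
    have dC : derivable (fun y => conn_mx Gam y z) x a by exact: smooth_derivable (sC z) Wx.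
    have dt : derivable (fun=> t : E) x a by exact: derivable_cst.
    by have [_ ->] := is_derive_mulmx dC dt; rewrite derive_cst mulmx0 addr0.
  by rewrite !e; apply: derive_on oW Wx _ => y Wy; exact: symG.
pose D a b := 'D_a (fun y => conn_mx Gam y b) x.
have cE a b c : curv Gam a b x *m c = D a b *m c - D b a *m c
    + conn_mx Gam x a *m (conn_mx Gam x b *m c) - conn_mx Gam x b *m (conn_mx Gam x a *m c).
  rewrite /curv -/(D a b) -/(D b a); move: (D a b) (D b a) (conn_mx _ _ _) (conn_mx _ _ _).
  by move=> d d' f g; rewrite mulmxBl mulmxDl mulmxBl -!mulmxA.
have sD' a b c : D a b *m c = D a c *m b := sD a b c.
rewrite !cE; move: D sD' {sD cE} => D sD.
rewrite (sD u v w) (sD v w u) (sD w u v) (symG Wx v w) (symG Wx w u) (symG Wx u v).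
move: (D u _ *m _) (D v _ *m _) (D w _ *m _) => x1 x2 x3.
move: (_ *m (_ *m _)) (_ *m (_ *m _)) (_ *m (_ *m _)) => x4 x5 x6.
mx_ring.
Qed.

End OnOpen.

End NablaCalculus.

(** * Connections preserving the quaternionic bundle *)

Section Adapted.
Context {R : realType} {m : nat}.
Local Notation E := 'cV[R]_m.
Local Notation M := 'M[R]_m.

Definition qspan (I J K A : M) := exists a b c, A = a *: I + b *: J + c *: K.

(** A torsion-free connection in a chart (symmetric Christoffel symbols) preserving
    the span of a quaternion basis. *)
Record adapted (W : set E) (Gam : 'I_m -> E -> M) (I J K : E -> M) : Prop := Adapted {
  adapted_open : open W;
  adapted_smooth : [/\ smooth_on W I, smooth_on W J & smooth_on W K];
  adapted_rel : forall x, W x -> quaternion_relations (I x) (J x) (K x);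
  adapted_conn : forall k, smooth_on W (Gam k);
  adapted_sym : forall x, W x -> forall u v,
    conn_mx Gam x u *m v = conn_mx Gam x v *m u;
  adapted_preserves : forall x, W x -> forall v,
    [/\ qspan (I x) (J x) (K x) (nabla_endo Gam v I x),
        qspan (I x) (J x) (K x) (nabla_endo Gam v J x) &
        qspan (I x) (J x) (K x) (nabla_endo Gam v K x)] }.

Lemma qspan_rot I J K A : qspan I J K A -> qspan J K I A.
Proof. by case=> a [b [c ->]]; exists b, c, a; rewrite -addrA addrC. Qed.

(** Hermitian with respect to I, J, K means that they are skew-adjoint; so is then
    any combination Q, and a skew-adjoint Q with Q^2 = -1 is orthogonal. *)
Lemma qspan_herm (I J K g Q : M) : quaternion_relations I J K ->
  [/\ I^T *m g *m I = g, J^T *m g *m J = g & K^T *m g *m K = g] ->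
  qspan I J K Q -> Q *m Q = - 1%:M -> Q^T *m g *m Q = g.
Proof.
move=> [II JJ KK _ _] [gI gJ gK] [a [b [c Qe]]] QQ.
have anti B : B *m B = - 1%:M -> B^T *m g *m B = g -> B^T *m g = - (g *m B).
  by move=> BB gB; rewrite -{2}gB -!mulmxA BB !mulmxN mulmx1 opprK.
have -> : Q^T *m g = - (g *m Q).
  have -> : Q^T = a *: I^T + b *: J^T + c *: K^T.
    by apply/matrixP => i j; rewrite Qe !mxE.
  rewrite Qe !mulmxDl !mulmxDr -!scalemxAl -!scalemxAr.
  by rewrite (anti I) // (anti J) // (anti K) // !scalerN !opprD.
by rewrite mulNmx -mulmxA QQ mulmxN mulmx1 opprK.
Qed.

Lemma adapted_rot W Gam I J K : adapted W Gam I J K -> adapted W Gam J K I.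
Proof.
case=> oW [sI sJ sK] rel sG sym pres; split=> // [x Wx|x Wx v].
  exact: quaternion_rot (rel x Wx).
by have [pI pJ pK] := pres x Wx v; split; apply: qspan_rot.
Qed.

Lemma adapted_sub W W' Gam I J K : open W' -> W' `<=` W ->
  adapted W Gam I J K -> adapted W' Gam I J K.
Proof.
move=> oW' sW [oW [sI sJ sK] rel sG sym pres]; split=> //.
- by split; apply: smooth_sub sW _.
- by move=> x /sW; exact: rel.
- by move=> k; apply: smooth_sub sW _.
- by move=> x /sW; exact: sym.
- by move=> x /sW; exact: pres.
Qed.

(** The coefficient of B in D_v A, read off by the inner product -tr(AB)/m, for
    which I, J, K are orthonormal. *)
Definition nabla_coef (Gam : 'I_m -> E -> M) (A B : E -> M) (v x : E) : R :=
  - (m%:R)^-1 * \tr (nabla_endo Gam v A x *m B x).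

(** One component of the curvature of the so(3)-connection with coefficients
    (a, b, c), halved because the elements of the bundle act by commutators. *)
Definition so3_curv (a b c : E -> E -> R) (u v x : E) : R :=
  2^-1 * ('D_u (a v) x - 'D_v (a u) x + b u x * c v x - b v x * c u x).

Definition sp1_curv (Gam : 'I_m -> E -> M) (I J K : E -> M) : E -> E -> E -> R :=
  so3_curv (nabla_coef Gam J K) (nabla_coef Gam K I) (nabla_coef Gam I J).

Section Theory.
Hypothesis m_gt0 : (0 < m)%N.
Let m0 : m%:R != 0 :> R. Proof. by rewrite pnatr_eq0 -lt0n. Qed.

(** Differentiate IJ + JI = 0 and take traces. *)
Lemma nabla_coef_skew W Gam I J K x v : adapted W Gam I J K -> W x ->
  nabla_coef Gam I J v x = - nabla_coef Gam J I v x.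
Proof.
case=> oW [sI sJ sK] rel sG sym pres Wx.
have dI : derivable I x v by exact: smooth_derivable sI Wx.
have dJ : derivable J x v by exact: smooth_derivable sJ Wx.
have dIJ : derivable (fun y => I y *m J y) x v by have [] := is_derive_mulmx dI dJ.
have dJI : derivable (fun y => J y *m I y) x v by have [] := is_derive_mulmx dJ dI.
have z : nabla_endo Gam v (fun y => I y *m J y + J y *m I y) x = 0.
  rewrite -(nabla_endo_cst Gam 0 x v); apply: nabla_endo_on oW Wx _ => y Wy.
  by have [_ _ _ -> ->] := rel y Wy; rewrite subrr -scalemx1 scale0r.
move: z; rewrite (nabla_endoD Gam dIJ dJI) (nabla_endoM Gam dI dJ) (nabla_endoM Gam dJ dI).
rewrite /nabla_coef; move: (nabla_endo _ _ _ _) (nabla_endo _ _ _ _) => NJ NI.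
move=> /(congr1 mxtrace); rewrite !mxtraceD mxtrace0.
rewrite (mxtrace_mulC (I x)) (mxtrace_mulC (J x)).
move: (\tr _) (\tr _) => s t e; have -> : s = - t by lra.
by ring.
Qed.

(** The I-component of D I vanishes since I^2 is constant. *)
Lemma nabla_adapted W Gam I J K x v : adapted W Gam I J K -> W x ->
  nabla_endo Gam v I x =
  nabla_coef Gam I J v x *: J x - nabla_coef Gam K I v x *: K x.
Proof.
move=> ad Wx.
have -> : nabla_coef Gam K I v x = - nabla_coef Gam I K v x.
  exact: nabla_coef_skew (adapted_rot (adapted_rot ad)) Wx.
case: ad => oW [sI sJ sK] rel sG sym pres.
have q := rel x Wx; have [II JJ KK IJ JI] := q; have [JK KJ KI IK] := quaternion_table q.
have tI := quaternion_tr q; have tJ := quaternion_tr (quaternion_rot q).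
have tK := quaternion_tr (quaternion_rot (quaternion_rot q)).
have dI : derivable I x v by exact: smooth_derivable sI Wx.
have z : nabla_endo Gam v (fun y => I y *m I y) x = 0.
  rewrite -(nabla_endo_cst Gam (-1) x v); apply: nabla_endo_on oW Wx _ => y Wy.
  by have [-> _ _ _ _] := rel y Wy; rewrite raddfN.
have [[p [r [s e]]] _ _] := pres x Wx v.
have trs B : \tr (nabla_endo Gam v I x *m B) =
    p * \tr (I x *m B) + r * \tr (J x *m B) + s * \tr (K x *m B).
  by rewrite e !mulmxDl -!scalemxAl !mxtraceD !mxtraceZ.
(* the component of D I along I *)
have p0 : p = 0.
  move: z; rewrite (nabla_endoM Gam dI dI) => /(congr1 mxtrace).
  rewrite mxtraceD mxtrace0 (mxtrace_mulC (I x)) trs II JI KI tJ !raddfN /= mxtrace1 tK.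
  move=> h; apply: (mulIf m0); move: h; move: (m%:R) => n h; lra.
rewrite /nabla_coef !trs p0 IJ JJ KJ IK JK KK !raddfN /= mxtrace1 tI tJ tK.
have -> : - m%:R^-1 * (0 * 0 + r * - m%:R + s * - 0) = r by field.
have -> : - m%:R^-1 * (0 * - 0 + r * 0 + s * - m%:R) = s by field.
by rewrite e p0 scale0r add0r scaleNr opprK.
Qed.

Lemma nabla_coef_smooth W Gam I J K v : adapted W Gam I J K ->
  smooth_on W (nabla_coef Gam I J v).
Proof.
case=> oW [sI sJ sK] rel sG sym pres.
apply: smoothM => //; first exact: smooth_cst.
apply: smooth_tr => //; apply: smooth_mulmx => //.
exact: nabla_endo_smooth.
Qed.

(** The curvature acts on the bundle by the curvature of the induced connection:
    apply the Ricci identity to I and differentiate the formula for D I. *)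
Lemma curv_bracket W Gam I J K u v x : adapted W Gam I J K -> W x ->
  curv Gam u v x *m I x - I x *m curv Gam u v x =
  (2 * sp1_curv Gam K I J u v x) *: J x - (2 * sp1_curv Gam J K I u v x) *: K x.
Proof.
move=> ad Wx; have adJ := adapted_rot ad; have adK := adapted_rot adJ.
have sIJ z := nabla_coef_smooth z ad; have sJK z := nabla_coef_smooth z adJ.
have sKI z := nabla_coef_smooth z adK.
have [oW [sI sJ sK] rel sG sym pres] := ad.
rewrite -(nabla_endo_comm oW sG) //.
have nn a b : nabla_endo Gam a (nabla_endo Gam b I) x =
    'D_a (nabla_coef Gam I J b) x *: J x
    + nabla_coef Gam I J b x *: nabla_endo Gam a J x
    - ('D_a (nabla_coef Gam K I b) x *: K x
       + nabla_coef Gam K I b x *: nabla_endo Gam a K x).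
  have dJ : derivable J x a by exact: smooth_derivable sJ Wx.
  have dK : derivable K x a by exact: smooth_derivable sK Wx.
  have d1 : derivable (nabla_coef Gam I J b) x a by exact: smooth_derivable (sIJ b) Wx.
  have d2 : derivable (nabla_coef Gam K I b) x a by exact: smooth_derivable (sKI b) Wx.
  rewrite (nabla_endo_on Gam a oW Wx (fun y Wy => nabla_adapted b ad Wy)).
  have [e1 _] := is_derive_scale d1 dJ; have [e2 _] := is_derive_scale d2 dK.
  have e3 : derivable (fun y => - (nabla_coef Gam K I b y *: K y)) x a by exact: derivableN.
  rewrite (nabla_endoD Gam e1 e3) (nabla_endoN Gam e2) (nabla_endoZ Gam d1 dJ).
  by rewrite (nabla_endoZ Gam d2 dK).
rewrite !nn !(nabla_adapted _ adJ Wx) !(nabla_adapted _ adK Wx) /sp1_curv /so3_curv.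
move: ('D_u _ x) ('D_u _ x) ('D_v _ x) ('D_v _ x) => x1 x2 x3 x4.
move: (nabla_coef Gam I J u x) (nabla_coef Gam I J v x) => cu cv.
move: (nabla_coef Gam J K u x) (nabla_coef Gam J K v x) => au av.
move: (nabla_coef Gam K I u x) (nabla_coef Gam K I v x) (I x) (J x) (K x) => bu bv i j k.
mx_field.
Qed.

Lemma curv_trace W Gam I J K u v x : adapted W Gam I J K -> W x ->
  \tr (curv Gam u v x *m I x) = - m%:R * sp1_curv Gam I J K u v x.
Proof.
move=> ad Wx; have adJ := adapted_rot ad.
have q := adapted_rel ad Wx; have [II JJ KK IJ JI] := q.
have [JK KJ KI IK] := quaternion_table q.
have := curv_bracket u v adJ Wx; move: (curv Gam u v x) => r.
move=> /(congr1 (fun A => \tr (A *m K x))).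
rewrite !mulmxBl -!mulmxA JK -!scalemxAl KK IK !raddfB /= !mxtraceZ.
rewrite (mxtrace_mulC (J x)) -mulmxA KJ mulmxN !raddfN /= mxtrace1.
rewrite (quaternion_tr (quaternion_rot q)).
by move: (\tr _) (m%:R) => t n h; lra.
Qed.

Lemma sp1_curvE W Gam I J K u v x : adapted W Gam I J K -> W x ->
  sp1_curv Gam I J K u v x = - (m%:R)^-1 * \tr (curv Gam u v x *m I x).
Proof. by move=> ad Wx; rewrite (curv_trace _ _ ad Wx) mulrA mulrNN mulVf ?mul1r. Qed.

Lemma sp1_curv_skew Gam I J K u v x : sp1_curv Gam I J K v u x = - sp1_curv Gam I J K u v x.
Proof.
rewrite /sp1_curv /so3_curv; move: ('D_u _ x) ('D_v _ x) => a b; ring.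
Qed.

Lemma sp1_curv_linl W Gam I J K v x a u w : adapted W Gam I J K -> W x ->
  sp1_curv Gam I J K (a *: u + w) v x =
  a * sp1_curv Gam I J K u v x + sp1_curv Gam I J K w v x.
Proof.
move=> ad Wx; rewrite !(sp1_curvE _ _ ad Wx).
have [oW _ _ sG _ _] := ad.
rewrite (curv_linl oW sG v Wx) mulmxDl -scalemxAl mxtraceD mxtraceZ.
by move: (\tr _) (\tr _) (m%:R^-1) => s t n; ring.
Qed.

Lemma sp1_curv_linr W Gam I J K v x a u w : adapted W Gam I J K -> W x ->
  sp1_curv Gam I J K v (a *: u + w) x =
  a * sp1_curv Gam I J K v u x + sp1_curv Gam I J K v w x.
Proof.
move=> ad Wx; rewrite !(sp1_curv_skew _ _ _ _ _ v) (sp1_curv_linl _ _ _ _ ad Wx).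
by ring.
Qed.

(** The second Bianchi identity of the so(3)-connection; after the definitions are
    unfolded it is the symmetry of second derivatives. *)
Lemma sp1_bianchi W Gam I J K u v w x : adapted W Gam I J K -> W x ->
  let a := sp1_curv Gam I J K in let b := sp1_curv Gam J K I in
  let c := sp1_curv Gam K I J in
  let t u v w := 'D_u (a v w) x - nabla_coef Gam I J u x * b v w x
                 + nabla_coef Gam K I u x * c v w x in
  t u v w + t v w u + t w u v = 0.
Proof.
move=> ad Wx /=; have adJ := adapted_rot ad; have adK := adapted_rot adJ.
have sIJ z := nabla_coef_smooth z ad; have sJK z := nabla_coef_smooth z adJ.
have sKI z := nabla_coef_smooth z adK.
have oW := adapted_open ad.
rewrite /sp1_curv; move: (nabla_coef Gam J K) (nabla_coef Gam K I) (nabla_coef Gam I J)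
  sJK sKI sIJ => a b c sa sb sc.
have da p q r : 'D_p (so3_curv a b c q r) x = 2^-1 *
   ('D_p ('D_q (a r)) x - 'D_p ('D_r (a q)) x
    + (b q x * 'D_p (c r) x + c r x * 'D_p (b q) x)
    - (b r x * 'D_p (c q) x + c q x * 'D_p (b r) x)).
  have d1 (f : E -> E -> R) (sf : forall z, smooth_on W (f z)) z : derivable (f z) x p.
    exact: smooth_derivable (sf z) Wx.
  have d2 z t : derivable ('D_z (a t)) x p.
    exact: smooth_derivable (smooth_derive z (sa t)) Wx.
  have m1 z t : is_derive x p (fun y => b z y * c t y)
      (b z x * 'D_p (c t) x + c t x * 'D_p (b z) x).
    exact: (is_deriveM (derivableP (d1 b sb z)) (derivableP (d1 c sc t))).
  apply: is_derive_val; apply: is_deriveZ.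
  apply: is_deriveB (m1 r q); apply: is_deriveD (m1 q r).
  exact: (is_deriveB (derivableP (d2 q r)) (derivableP (d2 r q))).
rewrite !da.
have sw p q r : 'D_p ('D_q (a r)) x = 'D_q ('D_p (a r)) x.
  exact: (Schwarz p q oW (sa r 2%N) Wx).
rewrite (sw v u w) (sw w v u) (sw w u v) /so3_curv.
move: ('D_u ('D_v _) x) ('D_u ('D_w _) x) ('D_v ('D_w _) x) => y1 y2 y3.
move: ('D_u (b _) x) ('D_u (b _) x) ('D_v (b _) x) ('D_v (b _) x) ('D_w (b _) x) ('D_w (b _) x).
move: ('D_u (c _) x) ('D_u (c _) x) ('D_v (c _) x) ('D_v (c _) x) ('D_w (c _) x) ('D_w (c _) x).
move: (a u x) (a v x) (a w x) (b u x) (b v x) (b w x) (c u x) (c v x) (c w x).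
by intros; field.
Qed.

End Theory.
End Adapted.

(** * Ricci form and curvature of the bundle *)

Section RicciForm.
Context {R : realType} {m : nat}.
Local Notation E := 'cV[R]_m.
Local Notation M := 'M[R]_m.
Local Notation lm A x := (fun v : 'cV[R]_m => A x *m v).

Definition ricci_form (Gam : 'I_m -> E -> M) (x y z : E) : R :=
  \sum_k (curv Gam (basis_vec R k) y x *m z) k 0.

Section Theory.
Hypothesis m_gt0 : (0 < m)%N.
Lemma sp1_curv_contract W Gam I J K x (w y : E) : adapted W Gam I J K -> W x ->
  \sum_k w k 0 * sp1_curv Gam I J K (basis_vec R k) y x = sp1_curv Gam I J K w y x.
Proof.
move=> ad Wx.
symmetry; apply: (linear_form_sum (f := fun u => sp1_curv Gam I J K u y x)) => a u v.
exact: (sp1_curv_linl m_gt0 _ _ _ _ ad Wx).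
Qed.

Variables (W : set E) (Gam : 'I_m -> E -> M) (I J K : E -> M) (x : E).
Hypotheses (ad : adapted W Gam I J K) (Wx : W x).

Lemma col_basis (A : M) k j : (A *m basis_vec R k) j 0 = A j k.
Proof. by rewrite /basis_vec -colE mxE. Qed.

Lemma curv_linr u : linear (fun v => curv Gam u v x).
Proof.
have [oW _ _ sG _ _] := ad; move=> a v w.
by rewrite !(curv_skew _ _ u) (curv_linl oW sG _ Wx) opprD scalerN.
Qed.

(** The first Bianchi identity composed with A and contracted. *)
Lemma curv_swap (A : M) y z :
  \sum_k (A *m curv Gam (basis_vec R k) y x *m z) k 0
  - \sum_k (A *m curv Gam (basis_vec R k) z x *m y) k 0 = - \tr (curv Gam y z x *m A).
Proof.
have [oW _ _ sG sym _] := ad.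
rewrite -sumrB mxtrace_mulC -sumrN; apply: eq_bigr => k _.
rewrite -col_basis; set e := basis_vec R k.
have ek : curv Gam e y x *m z - curv Gam e z x *m y = - (curv Gam y z x *m e).
  apply/eqP; rewrite -subr_eq0 opprK -(curv_bianchi1 oW sG sym e y z Wx).
  by rewrite (curv_skew _ e z) mulNmx addrAC.
have := congr1 (mulmx A) ek; rewrite mulmxBr mulmxN -!mulmxA.
move: (A *m _) (A *m _) (A *m _) => a b c /matrixP/(_ k 0).
by rewrite !mxE.
Qed.

(** The skew part of the Ricci form is, up to sign, the curvature of the volume
    connection. *)
Lemma ricci_sym (trR : forall u v, \tr (curv Gam u v x) = 0) y z :
  ricci_form Gam x y z = ricci_form Gam x z y.
Proof.
have := curv_swap 1%:M y z; rewrite mulmx1 trR oppr0 => /eqP.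
by rewrite subr_eq0 => /eqP h; rewrite /ricci_form; move: h; under eq_bigr do rewrite mul1mx;
  under [X in _ = X -> _]eq_bigr do rewrite mul1mx.
Qed.

Lemma ricci_odd : odd2 (ricci_form Gam x).
Proof.
split=> y z; rewrite /ricci_form -sumrN; apply: eq_bigr => k _; last first.
  by rewrite mulmxN !mxE.
by rewrite (lin_funN (curv_linr (basis_vec R k))) mulNmx mxE.
Qed.

Lemma sp1_curv_odd : odd2 (fun u v => sp1_curv Gam I J K u v x).
Proof.
have f0 v : sp1_curv Gam I J K 0 v x = 0.
  by have := sp1_curv_linl m_gt0 v 1 0 0 ad Wx; rewrite scale1r addr0; lra.
have nl u v : sp1_curv Gam I J K (- u) v x = - sp1_curv Gam I J K u v x.
  by have := sp1_curv_linl m_gt0 v (-1) u 0 ad Wx; rewrite f0 !addr0 scaleN1r mulN1r.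
split=> u v; first exact: nl.
by rewrite (sp1_curv_skew Gam I J K (- v) u x) nl opprK (sp1_curv_skew Gam I J K u v x).
Qed.

(** Contract the first Bianchi identity with I, then move I across the curvature:
    the commutators contribute the terms in a_J and a_K. *)
Lemma curv_eq_adapted : curv_eq (lm I x) (lm J x) (lm K x) m%:R (ricci_form Gam x)
  (fun u v => sp1_curv Gam I J K u v x) (fun u v => sp1_curv Gam J K I u v x)
  (fun u v => sp1_curv Gam K I J u v x).
Proof.
move=> /= y z.
have adJ := adapted_rot ad; have adK := adapted_rot adJ.
pose ricI (u w : E) := \sum_k (I x *m curv Gam (basis_vec R k) u x *m w) k 0.
have shift (u w : E) : ricci_form Gam x u (I x *m w) = ricI u w
    + 2 * sp1_curv Gam K I J (J x *m w) u x - 2 * sp1_curv Gam J K I (K x *m w) u x.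
  rewrite -(sp1_curv_contract _ _ adK Wx) -(sp1_curv_contract _ _ adJ Wx).
  rewrite !mulr_sumr -big_split -sumrB /=; apply: eq_bigr => k _.
  have := curv_bracket m_gt0 (basis_vec R k) u ad Wx.
  move: (curv _ _ _ _) (sp1_curv _ _ _ _ _ _ _) (sp1_curv _ _ _ _ _ _ _) => r s t h.
  have := congr1 (fun A => A *m w) h; rewrite /= !mulmxBl -!scalemxAl -!mulmxA.
  move: (r *m _) (I x *m _) (J x *m w) (K x *m w) => a b c d /matrixP/(_ k 0).
  by rewrite !mxE; lra.
rewrite !shift /=; have := curv_swap (I x) y z; rewrite -/(ricI y z) -/(ricI z y).
rewrite (curv_trace m_gt0 y z ad Wx).
rewrite (sp1_curv_skew Gam K I J y) (sp1_curv_skew Gam J K I y).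
move: (ricI _ _) (ricI _ _) (sp1_curv _ _ _ _ _ _ _) => a b c.
move: (sp1_curv _ _ _ _ _ _ _) (sp1_curv _ _ _ _ _ _ _) (sp1_curv _ _ _ _ _ _ _) (sp1_curv _ _ _ _ _ _ _) => d e f g.
by move: (m%:R) => n h; lra.
Qed.

End Theory.
End RicciForm.

(** * The symmetric potential of the curvature *)

Section CurvaturePotential.
Context {R : realType} {m : nat}.
Local Notation E := 'cV[R]_m.
Local Notation M := 'M[R]_m.
Local Notation lm A x := (fun v : 'cV[R]_m => A x *m v).

Definition sp1_curv_mx (Gam : 'I_m -> E -> M) (I J K : E -> M) (x : E) : M :=
  \matrix_(i, j) sp1_curv Gam I J K (basis_vec R i) (basis_vec R j) x.

Definition ric_part_mx Gam I J K (x : E) : M :=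
  (- 2^-1) *: (sp1_curv_mx Gam I J K x *m I x).

(** The matrix of [ric_pot] for the three curvature forms. *)
Definition potential (Gam : 'I_m -> E -> M) (I J K : E -> M) (x : E) : M :=
  ric_part_mx Gam I J K x + ric_part_mx Gam J K I x + ric_part_mx Gam K I J x
  - 2 *: havg_mx (I x) (J x) (K x) (ric_part_mx Gam I J K x).

Lemma havg_smooth (W : set E) (I J K B : E -> M) : open W -> smooth_on W I ->
  smooth_on W J -> smooth_on W K -> smooth_on W B ->
  smooth_on W (fun x => havg_mx (I x) (J x) (K x) (B x)).
Proof.
move=> oW sI sJ sK sB.
have t A : smooth_on W A -> smooth_on W (fun x => (A x)^T *m B x *m A x).
  by move=> sA; do 2 (apply: smooth_mulmx => //); exact: smooth_trmx.
apply: smooth_scale => //; first exact: smooth_cst.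
by do 3 (apply: smoothD => //; last exact: t).
Qed.

Section Theory.
Hypothesis m_gt0 : (0 < m)%N.

Lemma sp1_curv_mx_smooth W Gam I J K : adapted W Gam I J K ->
  smooth_on W (sp1_curv_mx Gam I J K).
Proof.
move=> ad; have oW := adapted_open ad.
have adJ := adapted_rot ad; have adK := adapted_rot adJ.
have sa z := nabla_coef_smooth z ad; have sb z := nabla_coef_smooth z adJ.
have sc z := nabla_coef_smooth z adK.
have sB (f g : E -> R) : smooth_on W f -> smooth_on W g -> smooth_on W (fun x => f x - g x).
  move=> sf sg; apply: smoothD => //.
  apply: smooth_eq (smoothM oW (smooth_cst W (-1 : R)) sg) => // x _.
  by rewrite mulN1r.
apply/smooth_mxP => // i j.
suff h : smooth_on W (sp1_curv Gam I J K (basis_vec R i) (basis_vec R j)).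
  by apply: smooth_eq h => // x _; rewrite mxE.
apply: smoothM => //; first exact: smooth_cst.
apply: (sB); last exact: smoothM.
by apply: smoothD => //; [apply: (sB); exact: smooth_derive|exact: smoothM].
Qed.

Lemma ric_part_mx_smooth W Gam I J K : adapted W Gam I J K ->
  smooth_on W (ric_part_mx Gam I J K).
Proof.
move=> ad; have [oW [sI sJ sK] _ _ _ _] := ad.
apply: smooth_scale => //; first exact: smooth_cst.
by apply: smooth_mulmx => //; exact: sp1_curv_mx_smooth.
Qed.

Lemma potential_smooth W Gam I J K : adapted W Gam I J K ->
  smooth_on W (potential Gam I J K).
Proof.
move=> ad; have [oW [sI sJ sK] _ _ _ _] := ad.
have adJ := adapted_rot ad; have adK := adapted_rot adJ.
apply: smoothB => //.
  apply: smoothD => //; last exact: ric_part_mx_smooth.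
  by apply: smoothD => //; exact: ric_part_mx_smooth.
apply: smooth_scale => //; first exact: smooth_cst.
by apply: havg_smooth => //; exact: ric_part_mx_smooth.
Qed.

Lemma bilin_sp1_curv_mx W Gam I J K x u v : adapted W Gam I J K -> W x ->
  bilin (sp1_curv_mx Gam I J K x) u v = sp1_curv Gam I J K u v x.
Proof.
move=> ad Wx.
apply: (@bilin_of_form R m (fun a b => sp1_curv Gam I J K b a x)) => c a b w /=.
  exact: (sp1_curv_linr m_gt0 w c a b ad Wx).
exact: (sp1_curv_linl m_gt0 w c a b ad Wx).
Qed.

Lemma bilin_potential W Gam I J K x u v : adapted W Gam I J K -> W x ->
  bilin (potential Gam I J K x) u v =
  ric_pot (lm I x) (lm J x) (lm K x) (fun u v => sp1_curv Gam I J K u v x)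
    (fun u v => sp1_curv Gam J K I u v x) (fun u v => sp1_curv Gam K I J u v x) u v.
Proof.
move=> ad Wx; have adJ := adapted_rot ad; have adK := adapted_rot adJ.
have rp I' J' K' (ad' : adapted W Gam I' J' K') a b :
    bilin (ric_part_mx Gam I' J' K' x) a b =
    ric_part (lm I' x) (fun u v => sp1_curv Gam I' J' K' u v x) a b.
  by rewrite /ric_part_mx bilinZ bilinMr (bilin_sp1_curv_mx _ _ ad' Wx).
rewrite /potential !bilinD bilinN bilinZ bilin_havg (rp _ _ _ ad) (rp _ _ _ adJ) (rp _ _ _ adK).
by rewrite /ric_pot /herm_avg !(rp _ _ _ ad).
Qed.

Section Large.
Hypothesis m_gt4 : 4 < m%:R :> R.
Variables (W : set E) (Gam : 'I_m -> E -> M) (I J K : E -> M).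
Hypothesis ad : adapted W Gam I J K.
Hypothesis trR : forall x u v, W x -> \tr (curv Gam u v x) = 0.

Let adJ := adapted_rot ad.
Let adK := adapted_rot adJ.

Section AtPoint.
Variables (x : E).
Hypothesis Wx : W x.
Let q := quaternion_mx_action (adapted_rel ad Wx).
Let aI := fun u v => sp1_curv Gam I J K u v x.
Let aJ := fun u v => sp1_curv Gam J K I u v x.
Let aK := fun u v => sp1_curv Gam K I J u v x.
Let oI := sp1_curv_odd m_gt0 ad Wx : odd2 aI.
Let oJ := sp1_curv_odd m_gt0 adJ Wx : odd2 aJ.
Let oK := sp1_curv_odd m_gt0 adK Wx : odd2 aK.
Let ro := ricci_odd ad Wx.
Let rs := ricci_sym ad Wx (fun u v => trR u v Wx).
Let eI := curv_eq_adapted m_gt0 ad Wx.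
Let eJ := curv_eq_adapted m_gt0 adJ Wx.
Let eK := curv_eq_adapted m_gt0 adK Wx.
Let qJ := quaternion_action_rot q.
Let qK := quaternion_action_rot qJ.

Let invI := curv_invariant q m_gt4 ro rs oI oJ oK eI eJ eK.
Let invJ := curv_invariant qJ m_gt4 ro rs oJ oK oI eJ eK eI.
Let invK := curv_invariant qK m_gt4 ro rs oK oI oJ eK eI eJ.
Let avgIJ := ric_part_avg q m_gt4 ro rs oI oJ oK eI eJ.

Let avg_rot (b : E -> E -> R) u v :
  herm_avg (lm J x) (lm K x) (lm I x) b u v = herm_avg (lm I x) (lm J x) (lm K x) b u v.
Proof. by rewrite /herm_avg; ring. Qed.

Let avgJK u v : herm_avg (lm I x) (lm J x) (lm K x) (ric_part (lm J x) aJ) u v =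
  herm_avg (lm I x) (lm J x) (lm K x) (ric_part (lm K x) aK) u v.
Proof. by rewrite -!avg_rot; exact: (ric_part_avg qJ m_gt4 ro rs oJ oK oI eJ eK). Qed.

Let avgIK u v : herm_avg (lm I x) (lm J x) (lm K x) (ric_part (lm I x) aI) u v =
  herm_avg (lm I x) (lm J x) (lm K x) (ric_part (lm K x) aK) u v.
Proof. by rewrite avgIJ avgJK. Qed.

Let skI u v : aI v u = - aI u v. Proof. exact: sp1_curv_skew. Qed.
Let skJ u v : aJ v u = - aJ u v. Proof. exact: sp1_curv_skew. Qed.
Let skK u v : aK v u = - aK u v. Proof. exact: sp1_curv_skew. Qed.

Lemma potential_sym : (potential Gam I J K x)^T = potential Gam I J K x.
Proof.
apply: bilin_ext => u v; rewrite bilin_tr !(bilin_potential _ _ ad Wx).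
exact: (ric_pot_sym q oI oJ oK skI skJ skK invI invJ invK).
Qed.

Lemma sp1_curv_potential_pt : sp1_curv_mx Gam I J K x =
  potential Gam I J K x *m I x - (potential Gam I J K x *m I x)^T.
Proof.
apply: bilin_ext => u v; rewrite (bilin_sp1_curv_mx _ _ ad Wx).
rewrite bilinD bilinN bilin_tr !bilinMr !(bilin_potential _ _ ad Wx).
exact: (ric_potE q oI oJ oK skI skJ skK invI invJ invK avgIJ avgIK).
Qed.

Lemma ric_part_avg_pt u v :
  herm_avg (lm I x) (lm J x) (lm K x) (ric_part (lm I x) aI) u v =
  herm_avg (lm I x) (lm J x) (lm K x) (ric_part (lm J x) aJ) u v.
Proof. exact: avgIJ. Qed.

End AtPoint.

Lemma potential_rot x : W x -> potential Gam J K I x = potential Gam I J K x.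
Proof.
move=> Wx; apply: bilin_ext => u v.
rewrite (bilin_potential _ _ adJ Wx) (bilin_potential _ _ ad Wx).
have := ric_part_avg_pt Wx u v; rewrite /ric_pot /herm_avg.
move: (ric_part (lm I x) _) (ric_part (lm J x) _) (ric_part (lm K x) _) => a b c h.
lra.
Qed.

End Large.

Section QKTCondition.
Hypothesis m_gt4 : 4 < m%:R :> R.

Lemma nabla_sp1_curv W Gam I J K x w u v : adapted W Gam I J K -> W x ->
  bilin (nabla_bilin Gam w (sp1_curv_mx Gam I J K) x) u v =
  'D_w (sp1_curv Gam I J K u v) x - sp1_curv Gam I J K (conn_mx Gam x w *m u) v x
  - sp1_curv Gam I J K u (conn_mx Gam x w *m v) x.
Proof.
move=> ad Wx; have oW := adapted_open ad; have sA := sp1_curv_mx_smooth ad.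
rewrite /nabla_bilin !bilinD !bilinN bilinMl bilinMr !(bilin_sp1_curv_mx _ _ ad Wx).
do 2 congr (_ - _); symmetry.
have -> : 'D_w (sp1_curv Gam I J K u v) x =
          'D_w (fun y => \sum_i \sum_j u i 0 * v j 0 * sp1_curv_mx Gam I J K y i j) x.
  apply: derive_on oW Wx _ => y Wy; rewrite -(bilin_sp1_curv_mx _ _ ad Wy) bilinE.
  by apply: eq_bigr => i _; apply: eq_bigr => j _; rewrite mulrAC.
have dA : derivable (sp1_curv_mx Gam I J K) x w by exact: smooth_derivable sA Wx.
rewrite bilinE; apply: is_derive_val.
have -> : (fun y => \sum_i \sum_j u i 0 * v j 0 * sp1_curv_mx Gam I J K y i j) =
   \sum_i \sum_j (u i 0 * v j 0) *: (fun y => sp1_curv_mx Gam I J K y i j).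
  apply/funext => y; rewrite fct_sumE; apply: eq_bigr => i _.
  by rewrite fct_sumE; apply: eq_bigr => j _.
apply: is_derive_eq.
  apply: is_derive_sum => i; apply: is_derive_sum => j; apply: is_deriveZ.
  exact: is_derive_entry dA.
by apply: eq_bigr => i _; apply: eq_bigr => j _; rewrite [LHS]mulrAC.
Qed.

Definition curv_form (P I : E -> M) (x : E) : M := P x *m I x - (P x *m I x)^T.

Lemma nabla_curv_form W Gam I J K P x w : adapted W Gam I J K -> W x ->
  smooth_on W P -> (forall y, W y -> (P y)^T = P y) ->
  nabla_bilin Gam w (curv_form P I) x =
  nabla_bilin Gam w P x *m I x - (nabla_bilin Gam w P x *m I x)^T
  + (nabla_coef Gam I J w x *: curv_form P J x - nabla_coef Gam K I w x *: curv_form P K x).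
Proof.
move=> ad Wx sP Ps; have [oW [sI sJ sK] _ _ _ _] := ad.
have dP : derivable P x w by exact: smooth_derivable sP Wx.
have dI : derivable I x w by exact: smooth_derivable sI Wx.
have [dPI _] := is_derive_mulmx dP dI; have [dPIt _] := is_derive_trmx dPI.
have -> : curv_form P I = (fun y => P y *m I y + (-1) *: (P y *m I y)^T).
  by apply/funext => y; rewrite scaleN1r.
have dPIn : derivable (fun y => (-1) *: (P y *m I y)^T) x w by exact: derivableZ.
rewrite (nabla_bilinD Gam dPI dPIn) (nabla_bilinZ Gam (-1) dPIt) (nabla_bilin_tr Gam dPI).
rewrite (nabla_bilin_mulr Gam dI dP) (nabla_adapted m_gt0 w ad Wx) /curv_form.
rewrite mulmxBr -!scalemxAr; move: (nabla_coef _ _ _ _ _) (nabla_coef _ _ _ _ _) => c b.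
move: (_ *m I x) (_ *m J x) (_ *m K x) => a1 a2 a3.
mx_ring.
Qed.

(** Substituting a_I = P(., I.) - P(I., .) in the second Bianchi identity: the terms
    from D I are the ones in a_J and a_K, and the Christoffel terms cancel in the
    cyclic sum by torsion-freeness. *)
Lemma potential_bianchi W Gam I J K (P : E -> M) (x u v w : E) : adapted W Gam I J K -> W x ->
  smooth_on W P -> (forall y, W y -> (P y)^T = P y) ->
  (forall y, W y -> sp1_curv_mx Gam I J K y = curv_form P I y) ->
  (forall y, W y -> sp1_curv_mx Gam J K I y = curv_form P J y) ->
  (forall y, W y -> sp1_curv_mx Gam K I J y = curv_form P K y) ->
  bianchi_sum (lm I x) (fun w u v => bilin (nabla_bilin Gam w P x) u v) u v w = 0.
Proof.
move=> ad Wx sP Ps PI PJ PK; have adJ := adapted_rot ad; have adK := adapted_rot adJ.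
have oW := adapted_open ad; have sym := adapted_sym ad Wx.
have key a b c : bilin (nabla_bilin Gam a P x) b (I x *m c) -
   bilin (nabla_bilin Gam a P x) c (I x *m b) =
   'D_a (sp1_curv Gam I J K b c) x - nabla_coef Gam I J a x * sp1_curv Gam J K I b c x
   + nabla_coef Gam K I a x * sp1_curv Gam K I J b c x
   - sp1_curv Gam I J K (conn_mx Gam x a *m b) c x
   - sp1_curv Gam I J K b (conn_mx Gam x a *m c) x.
  have := nabla_sp1_curv a b c ad Wx; rewrite (nabla_bilin_on Gam a oW Wx PI).
  rewrite (nabla_curv_form a ad Wx sP Ps) -(PJ x Wx) -(PK x Wx).
  move: (nabla_bilin Gam a P x) => Ta; rewrite !bilinD !bilinN !bilinZ bilin_tr !bilinMr.
  rewrite (bilin_sp1_curv_mx _ _ adJ Wx) (bilin_sp1_curv_mx _ _ adK Wx).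
  move: (bilin _ _ _) (bilin _ _ _) ('D_a _ x) => t1 t2 d.
  move: (nabla_coef _ _ _ _ _) (nabla_coef _ _ _ _ _).
  move: (sp1_curv _ _ _ _ b c x) (sp1_curv _ _ _ _ b c x) => *; lra.
rewrite /bianchi_sum !key.
have := sp1_bianchi u v w ad Wx; rewrite /=.
rewrite (sym v u) (sym w v) (sym u w).
have sk := sp1_curv_skew Gam I J K.
rewrite (sk (conn_mx Gam x u *m v)) (sk (conn_mx Gam x v *m w)) (sk (conn_mx Gam x w *m u)).
move: ('D_u _ x) ('D_v _ x) ('D_w _ x) => d1 d2 d3.
move: (nabla_coef _ _ _ u x) (nabla_coef _ _ _ u x) (nabla_coef _ _ _ v x).
move: (nabla_coef _ _ _ v x) (nabla_coef _ _ _ w x) (nabla_coef _ _ _ w x).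
move: (sp1_curv _ _ _ _ v w x) (sp1_curv _ _ _ _ v w x) (sp1_curv _ _ _ _ w u x).
move: (sp1_curv _ _ _ _ w u x) (sp1_curv _ _ _ _ u v x) (sp1_curv _ _ _ _ u v x).
move: (sp1_curv _ _ _ _ _ _ x) (sp1_curv _ _ _ _ _ _ x) (sp1_curv _ _ _ _ _ _ x).
by move=> *; lra.
Qed.

Section Pot.
Variables (W : set E) (Gam : 'I_m -> E -> M) (I J K : E -> M).
Hypothesis ad : adapted W Gam I J K.
Hypothesis trR : forall x u v, W x -> \tr (curv Gam u v x) = 0.
Variables (x : E).
Hypothesis Wx : W x.
Let oW := adapted_open ad.
Let P := potential Gam I J K.
Let T w := nabla_bilin Gam w P x.

Lemma nabla_potential_sym w : (T w)^T = T w.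
Proof.
have dP : derivable P x w by exact: smooth_derivable (potential_smooth ad) Wx.
rewrite -(nabla_bilin_tr _ dP); apply: nabla_bilin_on oW Wx _ => y Wy.
exact: (potential_sym m_gt4 ad trR Wy).
Qed.

Lemma sp1_curv_potentials :
  [/\ forall y, W y -> sp1_curv_mx Gam I J K y = P y *m I y - (P y *m I y)^T,
      forall y, W y -> sp1_curv_mx Gam J K I y = P y *m J y - (P y *m J y)^T &
      forall y, W y -> sp1_curv_mx Gam K I J y = P y *m K y - (P y *m K y)^T].
Proof.
have adJ := adapted_rot ad; have adK := adapted_rot adJ.
split=> y Wy.
- exact: (sp1_curv_potential_pt m_gt4 ad trR Wy).
- rewrite /P -(potential_rot m_gt4 ad trR Wy).
  exact: (sp1_curv_potential_pt m_gt4 adJ trR Wy).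
- rewrite /P -(potential_rot m_gt4 ad trR Wy) -(potential_rot m_gt4 adJ trR Wy).
  exact: (sp1_curv_potential_pt m_gt4 adK trR Wy).
Qed.

Lemma potential_qkt u v w :
  let h w := herm_avg (lm I x) (lm J x) (lm K x) (bilin (T w)) in
  torsion3 (lm I x) h u v w = torsion3 (lm J x) h u v w.
Proof.
have [PI PJ PK] := sp1_curv_potentials.
have adJ := adapted_rot ad; have adK := adapted_rot adJ.
have sP := potential_smooth ad.
have Ps y : W y -> (P y)^T = P y by move=> Wy; exact: (potential_sym m_gt4 ad trR Wy).
have lin := nabla_bilin_lin Gam oW sP Wx.
have TN y : T (- y) = - T y := lin_funN lin y.
apply: (@torsion3_herm_avg R E _ _ _ (fun w u v => bilin (T w) u v)
  (quaternion_mx_action (adapted_rel ad Wx))).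
- split=> [a b c|a]; first by rewrite TN bilinN.
  by split=> b c; rewrite ?bilinNl ?bilinNr.
- by move=> a b c; rewrite -bilin_tr nabla_potential_sym.
- by move=> a b c; apply: (potential_bianchi _ _ _ ad).
- by move=> a b c; apply: (potential_bianchi _ _ _ adJ).
- by move=> a b c; apply: (potential_bianchi _ _ _ adK).
Qed.

End Pot.
End QKTCondition.
End Theory.
End CurvaturePotential.

(** * Hermitian averages and changes of connection *)

Lemma derivable_fun_add (R : realType) (V F : normedModType R) (f g : V -> F) x v :
  derivable f x v -> derivable g x v -> derivable (fun y => f y + g y) x v.
Proof. exact: derivableD. Qed.

Section HermitianAverage.
Context {R : realType} {m : nat}.
Local Notation E := 'cV[R]_m.
Local Notation M := 'M[R]_m.

Lemma havg_tr (I J K B : M) : B^T = B -> (havg_mx I J K B)^T = havg_mx I J K B.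
Proof.
move=> Bs; rewrite /havg_mx linearZ /= !linearD /= !trmx_mul !trmxK Bs.
by rewrite !mulmxA.
Qed.

Lemma havg_rot (I J K B : M) : havg_mx J K I B = havg_mx I J K B.
Proof.
rewrite /havg_mx; congr (_ *: _); move: (_ *m I) (_ *m J) (_ *m K) => a b c.
mx_ring.
Qed.

(** The four terms of the average are permuted by I. *)
Lemma havg_inv (I J K B : M) : quaternion_relations I J K ->
  I^T *m havg_mx I J K B *m I = havg_mx I J K B.
Proof.
move=> q; have [II JJ KK IJ JI] := q; have [JK KJ KI IK] := quaternion_table q.
apply: bilin_ext => u v; rewrite bilinMr bilinMl !bilin_havg /herm_avg.
rewrite !mulmxA II JI KI !mulNmx !mul1mx !(bilinNl, bilinNr) !opprK.
by move: (bilin B _ _) (bilin B _ _) (bilin B _ _) (bilin B _ _) => a b c d; ring.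
Qed.

Lemma havg_herm (I J K B : M) : quaternion_relations I J K ->
  let h := havg_mx I J K B in
  [/\ I^T *m h *m I = h, J^T *m h *m J = h & K^T *m h *m K = h].
Proof.
move=> q h; have qJ := quaternion_rot q; split; first exact: havg_inv.
  by rewrite /h -(havg_rot I); exact: havg_inv.
by rewrite /h -(havg_rot I) -(havg_rot J); apply: havg_inv; exact: quaternion_rot.
Qed.

(** The derivatives of I, J, K rotate the three conjugates of B into each other
    skew-symmetrically, so their contributions cancel in the average. *)
Lemma nabla_havg (W : set E) Gam (I J K B : E -> M) x w : (0 < m)%N ->
  adapted W Gam I J K -> W x -> smooth_on W B ->
  nabla_bilin Gam w (fun y => havg_mx (I y) (J y) (K y) (B y)) x =
  havg_mx (I x) (J x) (K x) (nabla_bilin Gam w B x).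
Proof.
move=> m_gt0 ad Wx sB; have adJ := adapted_rot ad; have adK := adapted_rot adJ.
have [oW [sI sJ sK] _ _ _ _] := ad.
have dB : derivable B x w by exact: smooth_derivable sB Wx.
have term A : smooth_on W A -> is_derive x w (fun y => (A y)^T *m B y *m A y)
     ('D_w (fun y => (A y)^T *m B y *m A y) x) /\
   nabla_bilin Gam w (fun y => (A y)^T *m B y *m A y) x =
   (A x)^T *m nabla_bilin Gam w B x *m A x
   + (nabla_endo Gam w A x)^T *m B x *m A x + (A x)^T *m B x *m nabla_endo Gam w A x.
  move=> sA; have dA : derivable A x w by exact: smooth_derivable sA Wx.
  have [dBA _] := is_derive_mulmx dB dA; have [dAt _] := is_derive_trmx dA.
  have [dBt _] := is_derive_trmx dB; have [dBtA _] := is_derive_mulmx dBt dA.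
  have [dAB _] := is_derive_trmx dBtA.
  have eAB : (fun y => (A y)^T *m B y) = (fun y => ((B y)^T *m A y)^T).
    by apply/funext => y; rewrite trmx_mul trmxK.
  have dAB' : derivable (fun y => (A y)^T *m B y) x w by rewrite eAB.
  have [dABA _] := is_derive_mulmx dAB' dA; split; first exact: derivableP.
  rewrite (nabla_bilin_mulr Gam dA dAB') eAB (nabla_bilin_tr Gam dBtA).
  rewrite (nabla_bilin_mulr Gam dA dBt) (nabla_bilin_tr Gam dB).
  by rewrite linearD /= !trmx_mul !trmxK mulmxDl.
have [[dI _] nI] := term I sI; have [[dJ _] nJ] := term J sJ; have [[dK _] nK] := term K sK.
pose F (A : E -> M) y := (A y)^T *m B y *m A y.
have d1 : derivable (fun y => B y + F I y) x w := derivable_fun_add dB dI.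
have d2 : derivable (fun y => B y + F I y + F J y) x w := derivable_fun_add d1 dJ.
have d3 : derivable (fun y => B y + F I y + F J y + F K y) x w := derivable_fun_add d2 dK.
rewrite /havg_mx (nabla_bilinZ Gam _ d3) (nabla_bilinD Gam d2 dK).
rewrite (nabla_bilinD Gam d1 dJ) (nabla_bilinD Gam dB dI) nI nJ nK.
rewrite (nabla_adapted m_gt0 w ad Wx) (nabla_adapted m_gt0 w adJ Wx).
rewrite (nabla_adapted m_gt0 w adK Wx); congr (_ *: _).
move: (nabla_coef _ _ _ _ _) (nabla_coef _ _ _ _ _) (nabla_coef _ _ _ _ _) => c b a.
move: (nabla_bilin _ _ _ _) (I x) (J x) (K x) (B x) => T i j k b0.
have hL s t (A A' : M) C D : (s *: A - t *: A')^T *m C *m D =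
    s *: (A^T *m C *m D) - t *: (A'^T *m C *m D).
  have -> : (s *: A - t *: A')^T = s *: A^T - t *: A'^T.
    by apply/matrixP => p q; rewrite !mxE.
  by rewrite !mulmxBl -!scalemxAl.
have hR s t (A A' : M) (C : M) : C *m (s *: A - t *: A') = s *: (C *m A) - t *: (C *m A').
  by rewrite mulmxBr -!scalemxAr.
rewrite !hL !hR.
move: (i^T *m b0 *m j) (i^T *m b0 *m k) (j^T *m b0 *m i) (j^T *m b0 *m k)
  (k^T *m b0 *m i) (k^T *m b0 *m j) => x1 x2 x3 x4 x5 x6.
move: (i^T *m T *m i) (j^T *m T *m j) (k^T *m T *m k) => y1 y2 y3.
mx_ring.
Qed.

End HermitianAverage.

Section ConnectionChange.
Context {R : realType} {m : nat}.
Local Notation E := 'cV[R]_m.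
Local Notation M := 'M[R]_m.

Definition shifted (Gam : 'I_m -> E -> M) (I J K : E -> M) (xi : E -> 'rV[R]_m)
    (k : 'I_m) (x : E) : M :=
  Gam k x + conn_shift (I x) (J x) (K x) (xi x) (basis_vec R k).

Lemma conn_mx_shifted Gam I J K xi x v : conn_mx (shifted Gam I J K xi) x v =
  conn_mx Gam x v + conn_shift (I x) (J x) (K x) (xi x) v.
Proof.
rewrite /shifted conn_mx_add; congr (_ + _).
exact: (@linear_conn_mx R m (fun y u => conn_shift (I y) (J y) (K y) (xi y) u) x v
  (conn_shift_linear (I x) (J x) (K x) (xi x))).
Qed.

Lemma conn_shift_smooth (W : set E) (I J K : E -> M) xi (v : E) : open W ->
  smooth_on W I -> smooth_on W J -> smooth_on W K -> smooth_on W xi ->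
  smooth_on W (fun x => conn_shift (I x) (J x) (K x) (xi x) v).
Proof.
move=> oW sI sJ sK sx.
have sc (f : E -> E) : smooth_on W f -> smooth_on W (fun x => cov (xi x) (f x)).
  by move=> sf; exact: (smooth_entry 0 0 oW (smooth_mulmx oW sx sf)).
have sv := smooth_cst W v.
have st A : smooth_on W A -> smooth_on W (fun x => shift_term (A x) (xi x) v).
  move=> sA; have sAv := smooth_mulmx oW sA sv.
  apply: smoothD => //; first by apply: smooth_scale => //; exact: sc.
  by apply: smooth_mulmx => //; exact: smooth_mulmx.
apply: smoothB => //.
  apply: smoothD => //; last exact: smooth_mulmx.
  by apply: smooth_scale => //; [exact: sc|exact: smooth_cst].
apply: smoothD => //; last exact: st.
by apply: smoothD => //; exact: st.
Qed.

Lemma nabla_endo_shift Gam I J K xi A x v :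
  nabla_endo (shifted Gam I J K xi) v A x = nabla_endo Gam v A x +
  (conn_shift (I x) (J x) (K x) (xi x) v *m A x -
   A x *m conn_shift (I x) (J x) (K x) (xi x) v).
Proof.
rewrite /nabla_endo conn_mx_shifted; move: (conn_shift _ _ _ _ _) ('D_v A x) => s d.
rewrite mulmxDl mulmxDr; move: (_ *m A x) (s *m A x) (_ *m s) (A x *m _) => a b e f.
mx_ring.
Qed.

Lemma conn_shift_rot (I J K : M) xi v : conn_shift J K I xi v = conn_shift I J K xi v.
Proof. by rewrite /conn_shift; congr (_ - _); rewrite addrC addrA. Qed.

Lemma conn_shift_qspan (I J K : M) xi v : quaternion_relations I J K ->
  let s := conn_shift I J K xi v in
  [/\ qspan I J K (s *m I - I *m s), qspan I J K (s *m J - J *m s) &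
      qspan I J K (s *m K - K *m s)].
Proof.
move=> q /=; have qJ := quaternion_rot q; have qK := quaternion_rot qJ.
split.
- rewrite (conn_shift_comm q); exists 0, (- (2 * cov xi (K *m v))), (2 * cov xi (J *m v)).
  by rewrite scale0r add0r scaleNr addrC.
- rewrite -(conn_shift_rot I) (conn_shift_comm qJ).
  exists (2 * cov xi (K *m v)), 0, (- (2 * cov xi (I *m v))).
  by rewrite scale0r addr0 scaleNr.
- rewrite -(conn_shift_rot I) -(conn_shift_rot J) (conn_shift_comm qK).
  exists (- (2 * cov xi (J *m v))), (2 * cov xi (I *m v)), 0.
  by rewrite scale0r addr0 scaleNr addrC.
Qed.

Lemma qspanD (I J K A B : M) : qspan I J K A -> qspan I J K B -> qspan I J K (A + B).
Proof.
move=> [a [b [c ->]]] [a' [b' [c' ->]]]; exists (a + a'), (b + b'), (c + c').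
mx_ring.
Qed.

Lemma adapted_shifted W Gam I J K xi : adapted W Gam I J K -> smooth_on W xi ->
  adapted W (shifted Gam I J K xi) I J K.
Proof.
move=> [oW [sI sJ sK] rel sG sym pres] sx; split=> //.
- by move=> k; apply: smoothD => //; exact: conn_shift_smooth.
- move=> x Wx u v; rewrite !conn_mx_shifted.
  rewrite (mulmxDl (conn_mx _ _ u)) (mulmxDl (conn_mx _ _ v)) sym //.
  by rewrite (conn_shift_sym (I x) (J x) (K x)).
- move=> x Wx v; rewrite !nabla_endo_shift.
  have [p1 p2 p3] := pres x Wx v; have [s1 s2 s3] := conn_shift_qspan (xi x) v (rel x Wx).
  by split; apply: qspanD.
Qed.

Lemma shifted_tr W Gam I J K xi x v : adapted W Gam I J K -> W x ->
  \tr (conn_mx (shifted Gam I J K xi) x v) =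
  \tr (conn_mx Gam x v) + (m%:R + 4) * cov (xi x) v.
Proof.
move=> ad Wx; rewrite conn_mx_shifted mxtraceD; congr (_ + _).
exact: (conn_shift_tr (adapted_rel ad Wx)).
Qed.

End ConnectionChange.

(** * QKT data in a chart *)

Section ChartQKT.
Context {R : realType} {m : nat}.
Local Notation E := 'cV[R]_m.
Local Notation M := 'M[R]_m.
Local Notation lm A x := (fun v : 'cV[R]_m => A x *m v).

(** The torsion form of D + C when D is torsion-free. *)
Definition skew_part (g : M) (C : E -> M) (u v w : E) : R :=
  bilin g u (C v *m w - C w *m v).

(** A metric g and a change C of the connection Gam such that Gam + C is a QKT
    connection for g, with each condition stated relative to Gam: as tensors, g and
    C can then be carried to other charts by Jacobians.  The last field is the real
    form of the type condition. *)
Record chart_qkt (W : set E) (Gam : 'I_m -> E -> M) (I J K g : E -> M)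
    (C : 'I_m -> E -> M) : Prop := ChartQKT {
  chart_qkt_open : open W;
  chart_qkt_metric : smooth_on W g;
  chart_qkt_conn : forall k, smooth_on W (C k);
  chart_qkt_sym : forall x, W x -> (g x)^T = g x;
  chart_qkt_pos : forall x, W x -> forall v, v != 0 -> 0 < bilin (g x) v v;
  chart_qkt_herm : forall x, W x ->
    [/\ (I x)^T *m g x *m I x = g x, (J x)^T *m g x *m J x = g x &
        (K x)^T *m g x *m K x = g x];
  chart_qkt_span : forall x v, W x -> let Cv := conn_mx C x v in
    [/\ qspan (I x) (J x) (K x) (Cv *m I x - I x *m Cv),
        qspan (I x) (J x) (K x) (Cv *m J x - J x *m Cv) &
        qspan (I x) (J x) (K x) (Cv *m K x - K x *m Cv)];
  chart_qkt_nabla : forall x v, W x -> nabla_bilin Gam v g x =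
    (conn_mx C x v)^T *m g x + g x *m conn_mx C x v;
  chart_qkt_skew : forall x u v w, W x ->
    let t := skew_part (g x) (conn_mx C x) in
    t v u w = - t u v w /\ t u w v = - t u v w;
  chart_qkt_type : forall x Q u v w, W x ->
    qspan (I x) (J x) (K x) Q -> Q *m Q = - 1%:M ->
    let t := skew_part (g x) (conn_mx C x) in
    t u v w = t u (Q *m v) (Q *m w) + t (Q *m u) v (Q *m w) + t (Q *m u) (Q *m v) w }.

Lemma smooth_bilin (W : set E) (B : E -> M) (u v : E -> E) : open W ->
  smooth_on W B -> smooth_on W u -> smooth_on W v ->
  smooth_on W (fun x => bilin (B x) (u x) (v x)).
Proof.
move=> oW sB su sv; apply: (smooth_entry 0 0 oW).
by apply: smooth_mulmx => //; apply: smooth_mulmx => //; exact: smooth_trmx.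
Qed.

(** Smoothness when the direction of differentiation varies too. *)
Lemma smooth_contract (W : set E) Gam (g : E -> M) (u v w : E -> E) : open W ->
  (forall k, smooth_on W (Gam k)) -> smooth_on W g ->
  smooth_on W u -> smooth_on W v -> smooth_on W w ->
  smooth_on W (fun x => bilin (nabla_bilin Gam (u x) g x) (v x) (w x)).
Proof.
move=> oW sG sg su sv sw.
have h : smooth_on W (fun x => \sum_k u x k 0 *
    bilin (nabla_bilin Gam (basis_vec R k) g x) (v x) (w x)).
  apply: smooth_sum => // k; apply: smoothM => //; first exact: smooth_entry.
  by apply: smooth_bilin => //; exact: nabla_bilin_smooth.
apply: smooth_eq h => // x Wx.
have lin := nabla_bilin_lin Gam oW sg Wx.
symmetry; apply: (linear_form_sum (f := fun a => bilin (nabla_bilin Gam a g x) (v x) (w x))) => a b c.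
by rewrite lin (bilinD (a *: _)) bilinZ.
Qed.

Section Assembly.
Hypothesis m_gt0 : (0 < m)%N.
Variables (W : set E) (Gam Gam' : 'I_m -> E -> M) (I J K g : E -> M).
Hypotheses (ad : adapted W Gam I J K) (ad' : adapted W Gam' I J K).
Hypotheses (sg : smooth_on W g) (gs : forall x, W x -> (g x)^T = g x)
  (gp : forall x, W x -> forall v, v != 0 -> 0 < bilin (g x) v v)
  (gh : forall x, W x ->
    [/\ (I x)^T *m g x *m I x = g x, (J x)^T *m g x *m J x = g x &
        (K x)^T *m g x *m K x = g x]).
Let H x v := nabla_bilin Gam' v g x.
Hypothesis qkt : forall x, W x -> forall u v w,
  torsion3 (lm I x) (fun a b c => bilin (H x a) b c) u v w =
  torsion3 (lm J x) (fun a b c => bilin (H x a) b c) u v w.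

Let oW := adapted_open ad.

Let H_lin x : W x -> linear (H x).
Proof. by move=> Wx; exact: (nabla_bilin_lin Gam' oW sg Wx). Qed.

Let H_sym x : W x -> forall v, (H x v)^T = H x v.
Proof.
move=> Wx v; have dg : derivable g x v by exact: smooth_derivable sg Wx.
rewrite -(nabla_bilin_tr _ dg); apply: nabla_bilin_on oW Wx _ => y Wy.
exact: gs.
Qed.

Let H_herm x : W x -> forall v, [/\ (I x)^T *m H x v *m I x = H x v,
  (J x)^T *m H x v *m J x = H x v & (K x)^T *m H x v *m K x = H x v].
Proof.
move=> Wx v.
have e : H x v = havg_mx (I x) (J x) (K x) (H x v).
  rewrite -(nabla_havg v m_gt0 ad' Wx sg); apply: nabla_bilin_on oW Wx _ => y Wy.
  rewrite /havg_mx; have [-> -> ->] := gh Wy.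
  mx_field.
by rewrite e; exact: havg_herm (adapted_rel ad Wx).
Qed.

Let A x v := contorsion_mx (I x) (g x) (H x) v.

Let A_smooth k : smooth_on W (fun x => A x (basis_vec R k)).
Proof.
have [_ [sI sJ sK] _ sG' _ _] := ad'.
apply: smooth_mulmx => //.
  by apply: smooth_invmx => // x Wx; apply: posdef_unit; exact: gp.
apply/smooth_mxP => // i j.
have sc (v : E) := smooth_cst W v.
have sIv (v : E) : smooth_on W (fun x => I x *m v) by exact: smooth_mulmx.
have hb u v w (su : smooth_on W u) (sv : smooth_on W v) (sw : smooth_on W w) :=
  smooth_contract oW sG' sg su sv sw.
have sN (f : E -> R) : smooth_on W f -> smooth_on W (fun x => - f x).
  move=> sf; apply: smooth_eq (smoothM oW (smooth_cst W (-1 : R)) sf) => // x _.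
  by rewrite mulN1r.
suff h : smooth_on W (fun x => contorsion3 (lm I x) (fun a b c => bilin (H x a) b c)
    (basis_vec R k) (basis_vec R j) (basis_vec R i)).
  by apply: smooth_eq h => // x _; rewrite mxE.
apply: smoothM => //; first exact: smooth_cst.
apply: smoothD => //; first apply: smoothD => //.
- by apply: smoothD => //; exact: hb.
- by apply: sN; exact: hb.
apply: (sN); apply: smoothD => //; last exact: hb.
by apply: smoothD => //; exact: hb.
Qed.

(** From Gam to the auxiliary connection Gam', then the contorsion of g for Gam'. *)
Definition qkt_change (k : 'I_m) (x : E) : M :=
  Gam' k x - Gam k x + contorsion_mx (I x) (g x) (H x) (basis_vec R k).

Let A_lin x : W x -> linear (A x).
Proof. by move=> Wx; exact: (contorsion_mx_lin (I x) (gp Wx) (H_lin Wx)). Qed.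

Lemma conn_mx_qkt_change x v : W x ->
  conn_mx qkt_change x v = conn_mx Gam' x v - conn_mx Gam x v + A x v.
Proof.
move=> Wx; rewrite /qkt_change conn_mx_add; congr (_ + _); last first.
  exact: (@linear_conn_mx R m (fun y => A y) x v (A_lin Wx)).
rewrite conn_mx_add; congr (_ + _).
by rewrite /conn_mx -sumrN; apply: eq_bigr => l _; rewrite scalerN.
Qed.

Lemma chart_qkt_of : chart_qkt W Gam I J K g qkt_change.
Proof.
have skewE x u v w : W x -> skew_part (g x) (conn_mx qkt_change x) u v w =
    bilin (g x) u (A x v *m w - A x w *m v).
  move=> Wx; rewrite /skew_part !conn_mx_qkt_change //; congr bilin.
  rewrite (mulmxDl (_ - _)) (mulmxDl (conn_mx Gam' x w - _)) !mulmxBl.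
  rewrite (adapted_sym ad Wx w v) (adapted_sym ad' Wx w v).
  move: (_ *m w) (_ *m w) (_ *m w) (_ *m v) => a b c d.
  mx_ring.
have comm x v : W x -> [/\ A x v *m I x = I x *m A x v,
    A x v *m J x = J x *m A x v & A x v *m K x = K x *m A x v].
  move=> Wx; have [gI gJ _] := gh Wx.
  apply: (contorsion_mx_comm (adapted_rel ad Wx) (gp Wx) (H_lin Wx) (H_sym Wx) gI gJ _ _ (qkt Wx)).
    by move=> z; have [] := H_herm Wx z.
  by move=> z; have [] := H_herm Wx z.
split=> //.
- move=> k; have [_ _ _ sG _ _] := ad; have [_ _ _ sG' _ _] := ad'.
  by apply: smoothD => //; [exact: smoothB|exact: A_smooth].
- move=> x v Wx /=.
  have [p1 p2 p3] := adapted_preserves ad Wx v.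
  have [q1 q2 q3] := adapted_preserves ad' Wx v.
  have [c1 c2 c3] := comm x v Wx.
  have qN B : qspan (I x) (J x) (K x) B -> qspan (I x) (J x) (K x) (- B).
    move=> [a [b [c ->]]]; exists (- a), (- b), (- c).
    by rewrite !scaleNr !opprD.
  have e B : A x v *m B x = B x *m A x v ->
      conn_mx qkt_change x v *m B x - B x *m conn_mx qkt_change x v =
      nabla_endo Gam' v B x + - nabla_endo Gam v B x.
    move=> cB; rewrite conn_mx_qkt_change // /nabla_endo.
    move: cB; move: (A x v) (conn_mx Gam' x v) (conn_mx Gam x v) ('D_v B x) (B x) => a c' c d b ca.
    rewrite mulmxDl mulmxDr mulmxBl mulmxBr ca.
    move: (b *m a) (_ *m b) (_ *m b) (b *m _) (b *m _) => x1 x2 x3 x4 x5.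
    mx_ring.
  by rewrite !e //; split; apply: qspanD => //; exact: qN.
- move=> x v Wx; rewrite conn_mx_qkt_change //.
  have hI z : (I x)^T *m H x z *m I x = H x z by have [] := H_herm Wx z.
  have := contorsion_mx_metric (adapted_rel ad Wx) (gp Wx) (gs Wx) (H_lin Wx) (H_sym Wx) hI v.
  rewrite -/(A x v) /H /nabla_bilin => h.
  move: h; move: (A x v) (conn_mx Gam' x v) (conn_mx Gam x v) ('D_v g x) (g x) => a c' c d b.
  have -> : (c' - c + a)^T = c'^T - c^T + a^T by apply/matrixP => i j; rewrite !mxE.
  rewrite !mulmxDl !mulmxDr mulNmx mulmxN.
  move: (a^T *m b) (c'^T *m b) (c^T *m b) (b *m a) (b *m c') (b *m c) => x1 x2 x3 x4 x5 x6 h.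
  apply/matrixP => i j; move/matrixP/(_ i j): h; rewrite !mxE => h; lra.
- move=> x u v w Wx /=; rewrite !skewE //.
  have hI z : (I x)^T *m H x z *m I x = H x z by have [] := H_herm Wx z.
  exact: (contorsion_mx_skew (adapted_rel ad Wx) (gp Wx) (H_lin Wx) (H_sym Wx) hI).
- move=> x Q u v w Wx sQ QQ /=; rewrite !skewE //.
  apply: (torsion_type (A_lin Wx) QQ (qspan_herm (adapted_rel ad Wx) (gh Wx) sQ QQ)) => y.
  have [c1 c2 c3] := comm x y Wx; have [a [b [c ->]]] := sQ.
  by rewrite !mulmxDl !mulmxDr -!scalemxAl -!scalemxAr c1 c2 c3.
Qed.

End Assembly.
End ChartQKT.

(** * Making the potential positive *)

Section QuadraticForms.
Context {R : realType} {m : nat}.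
Local Notation E := 'cV[R]_m.
Local Notation M := 'M[R]_m.

Definition dotp (u v : E) : R := bilin 1%:M u v.

Lemma dotpE u v : dotp u v = \sum_i u i 0 * v i 0.
Proof. by rewrite /dotp /bilin mulmx1 mxE; apply: eq_bigr => i _; rewrite mxE. Qed.

Lemma dotpC u v : dotp u v = dotp v u.
Proof. by rewrite !dotpE; apply: eq_bigr => i _; rewrite mulrC. Qed.

Lemma dotp_ge0 v : 0 <= dotp v v.
Proof. by rewrite dotpE; apply: sumr_ge0 => i _; rewrite -expr2 sqr_ge0. Qed.

Lemma dotp_gt0 v : v != 0 -> 0 < dotp v v.
Proof.
move=> v0; rewrite lt_neqAle dotp_ge0 andbT eq_sym; apply: contraNneq v0 => d0.
apply/eqP/matrixP => i j; rewrite (ord1 j) mxE.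
have /eqP := d0; rewrite dotpE psumr_eq0; last by move=> k _; rewrite -expr2 sqr_ge0.
move=> /allP/(_ i); rewrite mem_index_enum => /(_ isT) /=.
by rewrite mulf_eq0 orbb => /eqP.
Qed.

(** A crude norm dominating the quadratic form. *)
Definition mass (B : M) : R := \sum_i \sum_j `|B i j|.

Lemma bilin_le_mass B v : `|bilin B v v| <= mass B * dotp v v.
Proof.
have le1 i : `|v i 0| * `|v i 0| <= dotp v v.
  rewrite dotpE (bigD1 i) //= -normrM ger0_norm -?expr2 ?sqr_ge0 // lerDl.
  by apply: sumr_ge0 => k _; rewrite -expr2 sqr_ge0.
have le2 i j : `|v i 0| * `|v j 0| <= dotp v v.
  have := le1 i; have := le1 j; have : 0 <= (`|v i 0| - `|v j 0|) ^+ 2 by rewrite sqr_ge0.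
  by move: `|v i 0| `|v j 0| (dotp v v) => a b c; nra.
rewrite bilinE /mass mulr_suml; apply: le_trans (ler_norm_sum _ _ _) _.
apply: ler_sum => i _; rewrite mulr_suml; apply: le_trans (ler_norm_sum _ _ _) _.
apply: ler_sum => j _; rewrite !normrM mulrAC mulrC.
by apply: ler_wpM2l => //; exact: le2.
Qed.

Lemma havg_lin (I J K A B : M) (t : R) :
  havg_mx I J K (A + t *: B) = havg_mx I J K A + t *: havg_mx I J K B.
Proof.
rewrite /havg_mx !mulmxDr !mulmxDl -!scalemxAr -!scalemxAl.
move: (_ *m I) (_ *m I) (_ *m J) (_ *m J) (_ *m K) (_ *m K) => a b c d e f.
mx_ring.
Qed.

Lemma havg1_pos (I J K : M) v : 4^-1 * dotp v v <= bilin (havg_mx I J K 1%:M) v v.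
Proof.
rewrite bilin_havg /herm_avg -!/(dotp _ _).
have := dotp_ge0 (I *m v); have := dotp_ge0 (J *m v); have := dotp_ge0 (K *m v).
by move: (dotp _ _) (dotp _ _) (dotp _ _) (dotp _ _) => a b c d *; lra.
Qed.

End QuadraticForms.

Lemma is_derive_translation (R : realType) (V : normedModType R) (x0 x u : V) :
  is_derive x u (fun y : V => y - x0) u.
Proof.
have := is_deriveB (is_derive_id x u) (is_derive_cst x0 x u).
by rewrite subr0.
Qed.

Section Normalisation.
Context {R : realType} {m : nat}.
Local Notation E := 'cV[R]_m.
Local Notation M := 'M[R]_m.

Lemma is_derive_dotp (x0 x u : E) (f : E -> E) : derivable f x u ->
  is_derive x u (fun y => dotp (f y) (y - x0)) (dotp ('D_u f x) (x - x0) + dotp (f x) u).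
Proof.
move=> df.
have [did eid] := is_derive_translation x0 x u.
have [dft et] := is_derive_trmx df.
have [dm em] := is_derive_mulmx dft did.
have := is_derive_entry 0 0 dm; rewrite em et eid mxE.
have -> : (fun y : E => ((f y)^T *m (y - x0)) 0 0) = (fun y => dotp (f y) (y - x0)).
  by apply/funext => y; rewrite /dotp /bilin mulmx1.
by rewrite /dotp /bilin !mulmx1.
Qed.

(** The trace of the connection is the differential of c |x - x0|^2 / 2, so the
    induced connection on volume forms is flat. *)
Lemma curv_tr0 (W : set E) (Gam : 'I_m -> E -> M) (x0 : E) (c : R) : open W ->
  (forall k, smooth_on W (Gam k)) ->
  (forall x v, W x -> \tr (conn_mx Gam x v) = c * dotp v (x - x0)) ->
  forall x u v, W x -> \tr (curv Gam u v x) = 0.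
Proof.
move=> oW sG trG x u v Wx.
have d a b : \tr ('D_a (fun y => conn_mx Gam y b) x) = c * dotp b a.
  have dC : derivable (fun y => conn_mx Gam y b) x a.
    exact: smooth_derivable (conn_mx_smooth b oW sG) Wx.
  have [_ <-] := is_derive_tr dC.
  have := derive_on a oW Wx (fun y Wy => trG y b Wy) => ->.
  have [db eb] := @is_derive_dotp x0 x a (fun=> b) (derivable_cst b x a).
  apply: is_derive_val; apply: is_derive_eq; first exact: is_deriveZ (DeriveDef db eb).
  by rewrite derive_cst [dotp 0 _]/dotp /bilin trmx0 !mul0mx mxE add0r.
rewrite /curv !mxtraceD !raddfN /= !d mxtrace_mulC dotpC.
by move: (\tr _) (dotp v u) => a b; ring.
Qed.

(** The shift by this covector cancels the trace of the connection, which changes by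
    (m + 4) xi under a shift by xi. *)
Definition trace_form (Gam : 'I_m -> E -> M) (x : E) : 'rV[R]_m :=
  \row_k (- (m%:R + 4)^-1 * \tr (Gam k x)).

Lemma trace_form_smooth (W : set E) Gam : open W -> (forall k, smooth_on W (Gam k)) ->
  smooth_on W (trace_form Gam).
Proof.
move=> oW sG; apply/smooth_mxP => // i k.
have h : smooth_on W (fun x => - (m%:R + 4)^-1 * \tr (Gam k x)).
  by apply: smoothM => //; [exact: smooth_cst|exact: smooth_tr].
by apply: smooth_eq h => // x _; rewrite mxE.
Qed.

Lemma trace_formE Gam x v : (m%:R + 4) * cov (trace_form Gam x) v = - \tr (conn_mx Gam x v).
Proof.
have m4 : m%:R + 4 != 0 :> R by rewrite -natrD pnatr_eq0 addn_eq0 andbF.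
have -> : \tr (conn_mx Gam x v) = \sum_k v k 0 * \tr (Gam k x).
  by rewrite /conn_mx raddf_sum; apply: eq_bigr => k _; rewrite /= mxtraceZ.
rewrite /cov mxE mulr_sumr -sumrN; apply: eq_bigr => k _.
by rewrite mxE; field.
Qed.

(** An exact covector field vanishing at x0 with a prescribed multiple of the
    identity as derivative there. *)
Definition radial_form (x0 : E) (t : R) (x : E) : 'rV[R]_m := (- t) *: (x - x0)^T.

Lemma radial_formE x0 t x v : cov (radial_form x0 t x) v = - t * dotp v (x - x0).
Proof. by rewrite /cov /radial_form -scalemxAl mxE dotpC /dotp /bilin mulmx1. Qed.

Lemma radial_form_smooth x0 t (W : set E) : open W -> smooth_on W (radial_form x0 t).
Proof.
move=> oW; apply: smooth_scale => //; first exact: smooth_cst.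
apply: smooth_trmx => //; apply: smoothB => //; last exact: smooth_cst.
by apply/smooth_mxP => // i j k; exact: Ck_on_coord.
Qed.

Section Radial.
Hypothesis m_gt0 : (0 < m)%N.
Variables (W : set E) (Gam : 'I_m -> E -> M) (I J K : E -> M) (x0 : E) (t : R).
Hypotheses (ad : adapted W Gam I J K) (Wx0 : W x0).
Let xi := radial_form x0 t.
Let Gam' := shifted Gam I J K xi.
Let oW := adapted_open ad.
Let ad' : adapted W Gam' I J K := adapted_shifted ad (radial_form_smooth x0 t oW).

(** The shift vanishes at x0, so only its derivative contributes to the curvature at
    x0, and the curvature form of I sees the trace of that derivative against I. *)
Lemma sp1_curv_radial u v :
  sp1_curv Gam' I J K u v x0 = sp1_curv Gam I J K u v x0
   + t * (dotp u (I x0 *m v) - dotp v (I x0 *m u)).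
Proof.
have [_ [sI sJ sK] rel sG _ _] := ad.
have m0 : m%:R != 0 :> R by rewrite pnatr_eq0 -lt0n.
have xi0 : xi x0 = 0 by rewrite /xi /radial_form subrr trmx0 scaler0.
pose S b y := conn_shift (I y) (J y) (K y) (xi y) b.
have sS b : smooth_on W (S b) by apply: conn_shift_smooth => //; exact: radial_form_smooth.
have S0 b : S b x0 = 0 by rewrite /S xi0 conn_shift0.
have C0 b : conn_mx Gam' x0 b = conn_mx Gam x0 b by rewrite conn_mx_shifted xi0 conn_shift0 addr0.
have dC a b : 'D_a (fun y => conn_mx Gam' y b) x0 =
    'D_a (fun y => conn_mx Gam y b) x0 + 'D_a (S b) x0.
  have -> : (fun y => conn_mx Gam' y b) = (fun y => conn_mx Gam y b + S b y).
    by apply/funext => y; rewrite conn_mx_shifted.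
  apply: is_derive_val; apply: is_deriveD.
    by apply: derivableP; exact: smooth_derivable (conn_mx_smooth b oW sG) Wx0.
  by apply: derivableP; exact: smooth_derivable (sS b) Wx0.
have trS a b : \tr ('D_a (S b) x0 *m I x0) = - (m%:R * t) * dotp (I x0 *m b) a.
  have dS : derivable (S b) x0 a by exact: smooth_derivable (sS b) Wx0.
  have dI : derivable I x0 a by exact: smooth_derivable sI Wx0.
  have [dSI eSI] := is_derive_mulmx dS dI.
  have -> : \tr ('D_a (S b) x0 *m I x0) = 'D_a (fun y => \tr (S b y *m I y)) x0.
    by have [_ ->] := is_derive_tr dSI; rewrite eSI S0 mul0mx addr0.
  have dIb : derivable (fun y => I y *m b) x0 a.
    by have [] := is_derive_mulmx dI (derivable_cst b x0 a).
  have [db eb] := is_derive_dotp x0 dIb.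
  have trE y : W y -> \tr (S b y *m I y) = (- (m%:R * t)) * dotp (I y *m b) (y - x0).
    move=> Wy; rewrite (conn_shift_trI (rel y Wy)) radial_formE.
    by move: (dotp _ _) => c; ring.
  rewrite (derive_on a oW Wx0 trE).
  apply: is_derive_val; apply: is_derive_eq; first exact: is_deriveZ (DeriveDef db eb).
  by rewrite subrr [dotp _ 0]/dotp /bilin mulmx0 mxE add0r.
rewrite (sp1_curvE m_gt0 u v ad' Wx0) (sp1_curvE m_gt0 u v ad Wx0) /curv !C0 !dC.
have e (a b c d f g : M) : (a + c - (b + d) + f - g) = (a - b + f - g) + (c - d).
  mx_ring.
rewrite e (dotpC u) (dotpC v); move: (trS u v) (trS v u).
move: ('D_u (S v) x0) ('D_v (S u) x0) (dotp _ _) (dotp _ _) => s1 s2 p q.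
move: (_ - _ *m _) (I x0) => r i h1 h2.
have -> : \tr ((r + (s1 - s2)) *m i) = \tr (r *m i) + (\tr (s1 *m i) - \tr (s2 *m i)).
  by rewrite mulmxDl mulmxBl mxtraceD raddfB.
by rewrite h1 h2; field.
Qed.

End Radial.

(** The potential of (u, v) |-> u.Iv - v.Iu and its analogues is the standard
    form. *)
Lemma potential_radial (W : set E) Gam I J K x0 t : (0 < m)%N ->
  adapted W Gam I J K -> W x0 ->
  potential (shifted Gam I J K (radial_form x0 t)) I J K x0 =
  potential Gam I J K x0 + t *: 1%:M.
Proof.
move=> m_gt0 ad Wx0; have adJ := adapted_rot ad; have adK := adapted_rot adJ.
have shr (Gam' : 'I_m -> E -> M) (I' J' K' : E -> M) xi : shifted Gam' J' K' I' xi = shifted Gam' I' J' K' xi.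
  by apply/funext => k; apply/funext => y; rewrite /shifted conn_shift_rot.
have rp I' J' K' : adapted W Gam I' J' K' ->
    ric_part_mx (shifted Gam I' J' K' (radial_form x0 t)) I' J' K' x0 =
    ric_part_mx Gam I' J' K' x0 + t *: (2^-1 *: (1%:M + (I' x0)^T *m I' x0)).
  move=> ad'; have [II _ _ _ _] := adapted_rel ad' Wx0.
  rewrite /ric_part_mx.
  have -> : sp1_curv_mx (shifted Gam I' J' K' (radial_form x0 t)) I' J' K' x0 =
      sp1_curv_mx Gam I' J' K' x0 + t *: (I' x0 - (I' x0)^T).
    apply/matrixP => i j; rewrite !mxE (sp1_curv_radial m_gt0 t ad' Wx0).
    by rewrite /dotp -!bilinMr !mul1mx !bilin_basis.
  rewrite mulmxDl -scalemxAl mulmxBl II.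
  move: (_ *m I' x0) (_ *m I' x0) => a b.
  mx_ring.
have [II JJ KK IJ JI] := adapted_rel ad Wx0.
have [JK KJ KI IK] := quaternion_table (adapted_rel ad Wx0).
rewrite /potential (rp _ _ _ ad) -(shr Gam I J K) (rp _ _ _ adJ) -(shr Gam J K I) (rp _ _ _ adK).
have h1 : havg_mx (I x0) (J x0) (K x0) 1%:M = 4^-1 *: (1%:M + (I x0)^T *m I x0
    + (J x0)^T *m J x0 + (K x0)^T *m K x0) by rewrite /havg_mx !mulmx1.
have h2 : havg_mx (I x0) (J x0) (K x0) (2^-1 *: (1%:M + (I x0)^T *m I x0)) =
          havg_mx (I x0) (J x0) (K x0) 1%:M.
  have bT (A : M) u v : bilin (A^T *m A) u v = bilin 1%:M (A *m u) (A *m v).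
    by rewrite -{2}[A]mul1mx mulmxA bilinMr bilinMl.
  apply: bilin_ext => u v; rewrite !bilin_havg /herm_avg !bilinZ !bilinD !bT.
  rewrite !mulmxA II IJ IK !mulNmx !mul1mx !(bilinNl, bilinNr) !opprK.
  by move: (bilin _ _ _) (bilin _ _ _) (bilin _ _ _) (bilin _ _ _) => a b c d; field.
rewrite havg_lin h2 h1.
move: (ric_part_mx _ _ _ _ _) (ric_part_mx _ _ _ _ _) (ric_part_mx _ _ _ _ _) (havg_mx _ _ _ _).
move: (_ *m I x0) (_ *m J x0) (_ *m K x0) (1%:M) => a b c d e f g h.
mx_field.
Qed.

End Normalisation.

(** * Existence of QKT data in a chart *)

Section Existence.
Context {R : realType} {m : nat}.
Local Notation E := 'cV[R]_m.
Local Notation M := 'M[R]_m.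

Lemma qkt_normalised (W : set E) Gam I J K x0 t : (0 < m)%N -> 4 < m%:R :> R ->
  adapted W Gam I J K ->
  let Gam0 := shifted Gam I J K (trace_form Gam) in
  let Gam' := shifted Gam0 I J K (radial_form x0 t) in
  [/\ adapted W Gam0 I J K, adapted W Gam' I J K &
      forall x u v, W x -> \tr (curv Gam' u v x) = 0].
Proof.
move=> m_gt0 m_gt4 ad Gam0 Gam'; have oW := adapted_open ad.
have ad0 : adapted W Gam0 I J K.
  by apply: adapted_shifted => //; apply: trace_form_smooth => //; exact: adapted_conn ad.
have ad' : adapted W Gam' I J K.
  by apply: adapted_shifted => //; exact: radial_form_smooth.
split=> //; apply: (curv_tr0 (x0 := x0) (c := - (m%:R + 4) * t) oW (adapted_conn ad')).
move=> x v Wx; rewrite (shifted_tr _ _ ad0 Wx) (shifted_tr _ _ ad Wx) trace_formE radial_formE.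
by rewrite addrN add0r; ring.
Qed.

(** At x0 the metric is the average of the old potential plus t times the average of
    the standard form, and the latter is at least 1/4.  With t = 4 (mass + 1) the sum
    dominates the standard form at x0; where every entry of g has moved by at most
    1 / (2 (m^2 + 1)) it still dominates half of it. *)
Lemma chart_qkt_large (W : set E) Gam I J K x0 : (0 < m)%N -> 4 < m%:R :> R ->
  adapted W Gam I J K -> W x0 ->
  exists W' g C, [/\ W' `<=` W, W' x0 & chart_qkt W' Gam I J K g C].
Proof.
move=> m_gt0 m_gt4 ad Wx0; have oW := adapted_open ad.
pose Gam0 := shifted Gam I J K (trace_form Gam).
pose h0 := havg_mx (I x0) (J x0) (K x0) (potential Gam0 I J K x0).
pose t := 4 * (mass h0 + 1).
pose Gam' := shifted Gam0 I J K (radial_form x0 t).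
have [ad0 ad' trR] := qkt_normalised x0 t m_gt0 m_gt4 ad.
pose P := potential Gam' I J K.
pose g x := havg_mx (I x) (J x) (K x) (P x).
have [_ [sI sJ sK] _ _ _ _] := ad.
have sP : smooth_on W P by exact: potential_smooth.
have sg : smooth_on W g by exact: havg_smooth.
have g0 v : dotp v v <= bilin (g x0) v v.
  rewrite /g /P (potential_radial t m_gt0 ad0 Wx0) havg_lin bilinD bilinZ -/h0.
  have := bilin_le_mass h0 v; rewrite ler_norml => /andP[+ _].
  have := havg1_pos (I x0) (J x0) (K x0) v; have := dotp_ge0 v.
  have : 0 <= mass h0 by apply: sumr_ge0 => i _; apply: sumr_ge0.
  rewrite /t; move: (mass h0) (dotp v v) (bilin _ v v) (bilin h0 v v) => c d p q.
  move=> c0 d0 dp cq; have : (c + 1) * d <= 4 * (c + 1) * p by nra.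
  lra.
pose e : R := (2 * (m * m).+1%:R)^-1.
have e0 : 0 < e by rewrite invr_gt0 mulr_gt0 // ltr0n.
have nearg : \forall x \near x0, W x /\ forall ij : 'I_m * 'I_m, `|g x ij.1 ij.2 - g x0 ij.1 ij.2| <= e.
  apply: filterI; first exact: open_nbhs_nbhs (conj oW Wx0).
  apply: (@filter_forall _ ('I_m * 'I_m)%type (fun ij x => `|g x ij.1 ij.2 - g x0 ij.1 ij.2| <= e) (nbhs x0) _) => ij.
  have /cvgrPdist_le/(_ _ e0) := smooth_continuous (smooth_entry ij.1 ij.2 oW sg) Wx0.
  by apply: filterS => x; rewrite distrC.
pose W' := [set x | W x /\ forall ij : 'I_m * 'I_m, `|g x ij.1 ij.2 - g x0 ij.1 ij.2| <= e]°.
have sW : W' `<=` W by move=> x /interior_subset[].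
have oW' : open W' by exact: open_interior.
have gpos x : W' x -> forall v, v != 0 -> 0 < bilin (g x) v v.
  move=> /interior_subset[_ gx] v /dotp_gt0 v0.
  have : mass (g x - g x0) <= 2^-1.
    rewrite /mass; apply: (@le_trans _ _ (\sum_(i < m) \sum_(j < m) e)).
      apply: ler_sum => i _; apply: ler_sum => j _.
      by have -> : (g x - g x0) i j = g x i j - g x0 i j by [rewrite mxE [X in _ + X]mxE]; exact: (gx (i, j)).
    rewrite !sumr_const !card_ord -mulrnA -[leLHS]mulr_natl.
    have e1 : (m * m).+1%:R * e = 2^-1.
      have b0 : (m * m).+1%:R != 0 :> R by rewrite pnatr_eq0.
      by rewrite /e invfM mulrCA mulfV // mulr1.
    apply: (@le_trans _ _ ((m * m).+1%:R * e)); last by rewrite e1.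
    by apply: ler_wpM2r; [exact: ltW|rewrite ler_nat].
  have := bilin_le_mass (g x - g x0) v; rewrite ler_norml => /andP[+ _].
  rewrite bilinD bilinN; have := g0 v.
  move: (mass _) (dotp v v) v0 (bilin _ v v) (bilin _ v v) => c d d0 p q h1 h2 h3.
  have cd : c * d <= 2^-1 * d by rewrite ler_pM2r.
  by lra.
have adW := adapted_sub oW' sW ad; have adW' := adapted_sub oW' sW ad'.
exists W', g, (qkt_change Gam Gam' I g); split=> //.
apply: (chart_qkt_of m_gt0 adW adW') => //.
- exact: smooth_sub sg.
- by move=> x /sW Wx; apply: havg_tr; exact: (potential_sym m_gt0 m_gt4 ad' trR Wx).
- by move=> x /sW Wx; exact: havg_herm (adapted_rel ad Wx).
- move=> x /sW Wx u v w.
  have hE a : nabla_bilin Gam' a g x =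
      havg_mx (I x) (J x) (K x) (nabla_bilin Gam' a P x) by exact: nabla_havg ad' Wx sP.
  have := potential_qkt m_gt0 m_gt4 ad' trR Wx u v w.
  by rewrite /torsion3 /= -!bilin_havg -!hE.
Qed.

Lemma chart_qkt_four (W : set E) Gam I J K : m = 4%N -> adapted W Gam I J K ->
  exists g C, chart_qkt W Gam I J K g C.
Proof.
move=> m4 ad; have m_gt0 : (0 < m)%N by rewrite m4.
have [oW [sI sJ sK] rel _ _ _] := ad.
pose g x := havg_mx (I x) (J x) (K x) 1%:M.
have sg : smooth_on W g by apply: havg_smooth => //; exact: smooth_cst.
have gs x : (g x)^T = g x by apply: havg_tr; rewrite trmx1.
have gh x : W x -> [/\ (I x)^T *m g x *m I x = g x, (J x)^T *m g x *m J x = g x &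
    (K x)^T *m g x *m K x = g x].
  by move=> Wx; exact: havg_herm (rel x Wx).
have gp x v : v != 0 -> 0 < bilin (g x) v v.
  move=> /dotp_gt0 v0; apply: lt_le_trans (havg1_pos _ _ _ v).
  by rewrite mulr_gt0.
exists g; eexists; apply: (chart_qkt_of m_gt0 ad ad) => //; first by move=> x _; exact: gp.
move=> x Wx; have q := rel x Wx.
have hE a : nabla_bilin Gam a g x = havg_mx (I x) (J x) (K x) (nabla_bilin Gam a (fun=> 1%:M) x).
  exact: nabla_havg m_gt0 ad Wx (smooth_cst W 1%:M).
apply: (torsion3_dim4 m4 q).
- exact: (nabla_bilin_lin Gam oW sg Wx).
- move=> v; have dg : derivable g x v by exact: smooth_derivable sg Wx.
  by rewrite -(nabla_bilin_tr _ dg); apply: nabla_bilin_on oW Wx _ => y _.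
- by move=> v; rewrite hE; have [] := havg_herm (nabla_bilin Gam v (fun=> 1%:M) x) q.
- by move=> v; rewrite hE; have [] := havg_herm (nabla_bilin Gam v (fun=> 1%:M) x) q.
- by move=> v; rewrite hE; have [] := havg_herm (nabla_bilin Gam v (fun=> 1%:M) x) q.
Qed.

End Existence.

(** * Types of three-forms *)

Section Trilinear.
Context {m : nat} {C : comPzRingType}.
Local Notation V := 'cV[C]_m.
Implicit Types (f : V -> V -> V -> C).

Definition trilinear3 f :=
  [/\ forall a u u' v w, f (a *: u + u') v w = a * f u v w + f u' v w,
      forall a u v v' w, f u (a *: v + v') w = a * f u v w + f u v' w &
      forall a u v w w', f u v (a *: w + w') = a * f u v w + f u v w'].

Lemma eval3_trilinear f : trilinear3 f ->
  forall u v w,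
  eval3 (fun i j k => f (delta_mx i 0) (delta_mx j 0) (delta_mx k 0)) u v w = f u v w.
Proof.
move=> [f1 f2 f3] u v w; rewrite /eval3.
rewrite (linear_form_sum (f := fun u => f u v w)) //; apply: eq_bigr => i _.
rewrite (linear_form_sum (f := fun v => f _ v w)) // mulr_sumr; apply: eq_bigr => j _.
rewrite (linear_form_sum (f := fun w => f _ _ w)) // !mulr_sumr; apply: eq_bigr => k _.
by ring.
Qed.

Lemma trilinear_eval3 c : trilinear3 (eval3 c : V -> V -> V -> C).
Proof.
rewrite /eval3; split=> a u v w z; rewrite !mulr_sumr -big_split /=; apply: eq_bigr => i _;
  rewrite !mulr_sumr -big_split /=; apply: eq_bigr => j _;
  rewrite !mulr_sumr -big_split /=; apply: eq_bigr => k _; rewrite !mxE; ring.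
Qed.

Lemma eval3_delta c i j k :
  eval3 c (delta_mx i 0 : V) (delta_mx j 0) (delta_mx k 0) = c i j k.
Proof.
rewrite /eval3 (bigD1 i) //= (bigD1 j) //= (bigD1 k) //= !mxE !eqxx !mulr1.
rewrite big1 => [|l lk]; last by rewrite !mxE (negPf lk) mulr0.
rewrite big1 => [|l lj]; last first.
  by rewrite big1 // => l' _; rewrite !mxE (negPf lj) mulr0 mul0r.
rewrite big1 => [|l li]; first by rewrite !addr0.
by rewrite big1 // => l' _; rewrite big1 // => l'' _; rewrite !mxE (negPf li) mulr0 !mul0r.
Qed.

Lemma trilinear_ext f g : trilinear3 f -> trilinear3 g ->
  (forall i j k, f (delta_mx i 0) (delta_mx j 0) (delta_mx k 0) =
                 g (delta_mx i 0) (delta_mx j 0) (delta_mx k 0)) ->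
  forall u v w, f u v w = g u v w.
Proof.
move=> tf tg fg u v w; rewrite -(eval3_trilinear tf) -(eval3_trilinear tg) /eval3.
apply: eq_bigr => i _; apply: eq_bigr => j _; apply: eq_bigr => k _.
by rewrite fg.
Qed.

Lemma trilinear_comp f (A B D : 'M[C]_m) : trilinear3 f ->
  trilinear3 (fun u v w => f (A *m u) (B *m v) (D *m w)).
Proof.
move=> [f1 f2 f3]; split=> a u v w z; rewrite mulmxDr -scalemxAr.
- exact: f1.
- exact: f2.
- exact: f3.
Qed.

Lemma trilinear_add f g : trilinear3 f -> trilinear3 g ->
  trilinear3 (fun u v w => f u v w + g u v w).
Proof.
by move=> [f1 f2 f3] [g1 g2 g3]; split=> a u v w z; rewrite ?f1 ?f2 ?f3 ?g1 ?g2 ?g3; ring.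
Qed.

End Trilinear.

(** With F skew, the sum over the places of the distinguished argument is skew in
    (u, u'), (v, v'), (w, w') jointly. *)
Lemma mixed_skew (C : comPzRingType) (V : Type) (F : V -> V -> V -> C) :
  (forall u v w, F v u w = - F u v w /\ F u w v = - F u v w) ->
  forall u u' v v' w w',
  F v u w' + F v u' w + F v' u w = - (F u v w' + F u v' w + F u' v w) /\
  F u w v' + F u w' v + F u' w v = - (F u v w' + F u v' w + F u' v w).
Proof.
move=> sk u u' v v' w w'; split.
  by rewrite (sk u v w').1 (sk u' v w).1 (sk u v' w).1; ring.
by rewrite (sk u v' w).2 (sk u v w').2 (sk u' v w).2; ring.
Qed.

Lemma mixed_vanish (C : comPzRingType) (V : zmodType) (F : V -> V -> V -> C)
    (p : bool -> V -> V) (b b1 b2 b3 : bool) (u v w : V) :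
  [/\ forall v w, F 0 v w = 0, forall u w, F u 0 w = 0 & forall u v, F u v 0 = 0] ->
  (forall b', p b' u = if b1 == b' then u else 0) ->
  (forall b', p b' v = if b2 == b' then v else 0) ->
  (forall b', p b' w = if b3 == b' then w else 0) ->
  ((b1 == b) + (b2 == b) + (b3 == b) != 2)%N ->
  F (p b u) (p b v) (p (~~ b) w) + F (p b u) (p (~~ b) v) (p b w)
  + F (p (~~ b) u) (p b v) (p b w) = 0.
Proof.
move=> [z1 z2 z3] pu pv pw; rewrite !pu !pv !pw.
by case: b b1 b2 b3 {pu pv pw} => [] [] [] [] //= _; rewrite ?z1 ?z2 ?z3 ?addr0.
Qed.

(** Expansion of F on sums of (1,0) and (0,1) parts when the pure terms vanish. *)
Lemma trilinear_split (C : comPzRingType) (m : nat) (F : 'cV[C]_m -> 'cV[C]_m -> 'cV[C]_m -> C)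
    p p' q q' r r' : trilinear3 F -> F p q r = 0 -> F p' q' r' = 0 ->
  F (p + p') (q + q') (r + r') =
  (F p q r' + F p q' r + F p' q r) + (F p' q' r + F p' q r' + F p q' r').
Proof.
move=> [f1 f2 f3] h h'.
have D1 x x' y z : F (x + x') y z = F x y z + F x' y z.
  by rewrite -[x]scale1r f1 scale1r mul1r.
have D2 x y y' z : F x (y + y') z = F x y z + F x y' z.
  by rewrite -[y]scale1r f2 scale1r mul1r.
have D3 x y z z' : F x y (z + z') = F x y z + F x y z'.
  by rewrite -[z]scale1r f3 scale1r mul1r.
by rewrite !D1 !D2 !D3 h h'; ring.
Qed.

Section TypeDecomposition.
Context {R : realType} {m : nat}.
Local Notation C := R[i].
Local Notation rc := (real_complex R).
Variables (I : 'M[R]_m) (c : 'I_m -> 'I_m -> 'I_m -> R).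
Hypothesis II : I *m I = - 1%:M.
Hypothesis skew_c : totally_skew c.
Hypothesis type_c : forall u v w, eval3 c u v w = eval3 c u (I *m v) (I *m w)
  + eval3 c (I *m u) v (I *m w) + eval3 c (I *m u) (I *m v) w.

Let cC i j k : C := rc (c i j k).
Let IC := map_mx rc I.

Lemma eval3_real (u v w : 'cV[R]_m) :
  eval3 cC (map_mx rc u) (map_mx rc v) (map_mx rc w) = rc (eval3 c u v w).
Proof.
rewrite /eval3 rmorph_sum; apply: eq_bigr => i _; rewrite rmorph_sum; apply: eq_bigr => j _.
by rewrite rmorph_sum; apply: eq_bigr => k _; rewrite !mxE /cC !rmorphM.
Qed.

Let F := eval3 cC.
Let tF : trilinear3 (F : 'cV[C]_m -> _) := trilinear_eval3 cC.

Let rc_delta (i : 'I_m) : (delta_mx i 0 : 'cV[C]_m) = map_mx rc (delta_mx i 0).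
Proof. by apply/matrixP => a b; rewrite !mxE; case: (_ && _); rewrite ?rmorph1 ?rmorph0. Qed.

Let IC_rc (u : 'cV[R]_m) : IC *m map_mx rc u = map_mx rc (I *m u).
Proof. by rewrite /IC map_mxM. Qed.

Let F_type (u v w : 'cV[C]_m) : F u v w = F u (IC *m v) (IC *m w)
  + F (IC *m u) v (IC *m w) + F (IC *m u) (IC *m v) w.
Proof.
have t1 := trilinear_comp 1%:M IC IC tF; have t2 := trilinear_comp IC 1%:M IC tF.
have t3 := trilinear_comp IC IC 1%:M tF.
have := trilinear_ext tF (trilinear_add (trilinear_add t1 t2) t3) _ u v w.
rewrite !mul1mx; apply => i j k.
by rewrite !mul1mx !rc_delta !IC_rc /F !eval3_real -!rmorphD type_c.
Qed.

Let F_skew u v w : F v u w = - F u v w /\ F u w v = - F u v w.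
Proof.
have c1 i j k : c j i k = - c i j k.
  have [h _] := skew_c (delta_mx i 0) (delta_mx j 0) (delta_mx k 0).
  by move: h; rewrite !eval3_delta.
have c2 i j k : c i k j = - c i j k.
  have [_ h] := skew_c (delta_mx i 0) (delta_mx j 0) (delta_mx k 0).
  by move: h; rewrite !eval3_delta.
split; rewrite /F /eval3 -sumrN.
  rewrite exchange_big /=; apply: eq_bigr => i _; rewrite -sumrN; apply: eq_bigr => j _.
  rewrite -sumrN; apply: eq_bigr => k _; rewrite /cC c1 rmorphN; ring.
apply: eq_bigr => i _; rewrite exchange_big /= -sumrN; apply: eq_bigr => j _.
rewrite -sumrN; apply: eq_bigr => k _; rewrite /cC c2 rmorphN; ring.
Qed.

Let F0 : [/\ forall v w, F 0 v w = 0, forall u w, F u 0 w = 0 & forall u v, F u v 0 = 0].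
Proof.
by split=> x y; rewrite /F /eval3; do 3 (rewrite big1 // => ? _); rewrite mxE; ring.
Qed.

Let s (b : bool) : C := if b then 'i%C else - 'i%C.

(** Projection onto the eigenspace of I for i or -i. *)
Definition type_proj (b : bool) : 'M[C]_m := 2^-1 *: (1%:M - s b *: IC).

Let ss b : s b * s b = -1.
Proof. by rewrite /s; case: b; rewrite ?mulrNN -expr2 sqr_i. Qed.

Let IC2 : IC *m IC = - 1%:M.
Proof. by rewrite /IC -map_mxM II map_mxN map_mx1. Qed.

Let I_proj b (u : 'cV[C]_m) : IC *m (type_proj b *m u) = s b *: (type_proj b *m u).
Proof.
rewrite mulmxA scalemxAl; congr (_ *m u).
rewrite /type_proj -scalemxAr mulmxBr mulmx1 -scalemxAr IC2 !scalerA.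
rewrite (mulrC (s b)) -scalerA; congr (_ *: _).
by rewrite scalerBr scalerA ss scalerN opprK scaleN1r opprK addrC scalemx1.
Qed.

Let proj_pure b b' (u : 'cV[C]_m) : pure_vec I b u -> type_proj b' *m u = if b == b' then u else 0.
Proof.
rewrite /pure_vec -/IC -/(s b) => e.
rewrite /type_proj -scalemxAl mulmxBl mul1mx -scalemxAl e scalerA.
case: eqVneq => [<-|nb].
  by rewrite ss scaleN1r opprK -[X in _ *: (X + _)]scale1r -{2}[u]scale1r -scalerDl scalerA
    mulVf ?scale1r // (_ : 1 + 1 = 2%:R) // pnatr_eq0.
have -> : s b' = - s b by move: nb; rewrite /s; case: b b' {e} => [] [] //; rewrite opprK.
by rewrite mulNr ss opprK scale1r subrr scaler0.
Qed.

Let proj_sum (u : 'cV[C]_m) : type_proj true *m u + type_proj false *m u = u.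
Proof.
rewrite -mulmxDl /type_proj -scalerDr /s scaleNr opprK.
have -> : 1%:M - 'i%C *: IC + (1%:M + 'i%C *: IC) = 2%:R *: 1%:M :> 'M[C]_m.
  by rewrite addrACA addNr addr0 scaler_nat mulr2n.
rewrite scalerA mulVf ?pnatr_eq0 //.
by rewrite scale1r mul1mx.
Qed.

Let pure_zero b (u v w : 'cV[C]_m) : F (type_proj b *m u) (type_proj b *m v) (type_proj b *m w) = 0.
Proof.
have [f1 f2 f3] := tF; have [z1 z2 z3] := F0.
have Z1 a x y z : F (a *: x) y z = a * F x y z by rewrite -[a *: x]addr0 f1 z1 addr0.
have Z2 a x y z : F x (a *: y) z = a * F x y z by rewrite -[a *: y]addr0 f2 z2 addr0.
have Z3 a x y z : F x y (a *: z) = a * F x y z by rewrite -[a *: z]addr0 f3 z3 addr0.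
have := F_type (type_proj b *m u) (type_proj b *m v) (type_proj b *m w).
rewrite !I_proj !(Z1, Z2, Z3) !mulrA ss; move: (F _ _ _) => x h.
have : 4%:R * x = 0.
  have -> : 4%:R * x = x - (-1 * x + -1 * x + -1 * x) by ring.
  by rewrite -h subrr.
by move/eqP; rewrite mulf_eq0 pnatr_eq0 /= => /eqP.
Qed.

Let mixed (b : bool) (u v w : 'cV[C]_m) : C :=
  F (type_proj b *m u) (type_proj b *m v) (type_proj (~~ b) *m w)
  + F (type_proj b *m u) (type_proj (~~ b) *m v) (type_proj b *m w)
  + F (type_proj (~~ b) *m u) (type_proj b *m v) (type_proj b *m w).

Let mixed_tri b : trilinear3 (mixed b).
Proof. by do 2 (apply: trilinear_add; last exact: trilinear_comp); exact: trilinear_comp. Qed.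

Let form b i j k := mixed b (delta_mx i 0) (delta_mx j 0) (delta_mx k 0).

Let formE b u v w : eval3 (form b) u v w = mixed b u v w.
Proof. exact: eval3_trilinear (mixed_tri b) _ _ _. Qed.

(** Extend c to complex vectors and split each argument into its (1,0) and (0,1)
    parts.  On three vectors of the same type the hypothesis reads c = -3 c, so the
    (3,0) and (0,3) parts vanish; the terms with two arguments of one type are the
    two summands sought. *)
Lemma type_21_12_of : type_21_12 I c.
Proof.
have sk b : totally_skew (form b).
  move=> u v w; rewrite !formE /mixed.
  exact: (mixed_skew F_skew).
exists (form true), (form false); split.
- split=> // b1 b2 b3 u v w pu pv pw ne; rewrite formE /mixed.
  apply: (@mixed_vanish C 'cV[C]_m F (fun b u => type_proj b *m u) true b1 b2 b3 u v w F0
    (fun b' => @proj_pure _ b' _ pu) (fun b' => @proj_pure _ b' _ pv) (fun b' => @proj_pure _ b' _ pw)).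
  by case: b1 b2 b3 ne {pu pv pw} => [] [] [] // ne; case: ne.
- split=> // b1 b2 b3 u v w pu pv pw ne; rewrite formE /mixed.
  apply: (@mixed_vanish C 'cV[C]_m F (fun b u => type_proj b *m u) false b1 b2 b3 u v w F0
    (fun b' => @proj_pure _ b' _ pu) (fun b' => @proj_pure _ b' _ pv) (fun b' => @proj_pure _ b' _ pw)).
  by case: b1 b2 b3 ne {pu pv pw} => [] [] [] // ne; case: ne.
- move=> i j k.
  have -> : rc (c i j k) = F (delta_mx i 0) (delta_mx j 0) (delta_mx k 0) by rewrite /F eval3_delta.
  have := trilinear_split tF
    (pure_zero true (delta_mx i 0) (delta_mx j 0) (delta_mx k 0))
    (pure_zero false (delta_mx i 0) (delta_mx j 0) (delta_mx k 0)).
  by rewrite !proj_sum.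
Qed.

End TypeDecomposition.

(** * Transition maps *)

Section ChainRule.
Context {R : realType} {m p q : nat}.
Local Notation E := 'cV[R]_m.
Implicit Types (U V : set E) (s : E -> E) (f : E -> 'M[R]_(p, q)).

Lemma jacE U (s : E -> E) x v : open U -> smooth_on U s -> U x ->
  'D_v s x = jac s x *m v.
Proof.
move=> oU hs Ux; rewrite (derive_sum_basis v oU hs Ux).
apply/matrixP => a b; rewrite (ord1 b) summxE mxE; apply: eq_bigr => k _.
by rewrite !mxE mulrC.
Qed.

Lemma jac_smooth U (s : E -> E) : open U -> smooth_on U s -> smooth_on U (jac s).
Proof.
move=> oU hs; apply/smooth_mxP => // a b.
have h := smooth_entry a 0 oU (smooth_derive (basis_vec R b) hs).
by apply: smooth_eq h => // x _; rewrite mxE.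
Qed.

Lemma smooth_comp U V s f : open U -> open V -> (forall x, U x -> V (s x)) ->
  smooth_on U s -> smooth_on V f -> smooth_on U (f \o s).
Proof.
move=> oU oV sUV hs hf; apply/smooth_mxP => // i j k.
exact: (Ck_on_comp oU oV sUV (hs k) (smooth_entry i j oV hf k)).
Qed.

Lemma is_derive_comp_mx V s f x v : open V -> smooth_on V f -> V (s x) ->
  derivable s x v -> is_derive x v (f \o s) ('D_('D_v s x) f (s x)).
Proof.
move=> oV hf Vs ds; apply: is_derive_mxP => i j.
have hij := smooth_entry i j oV hf 1%N.
have df : derivable f (s x) ('D_v s x) by exact: smooth_derivable hf Vs.
have -> : ('D_('D_v s x) f (s x)) i j = gradform (fun y => f y i j) (s x) ('D_v s x).
  rewrite -(derive_gradform _ oV hij Vs).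
  by have [_ ->] := is_derive_entry i j df.
exact: (derive_comp_grad oV hij Vs ds).
Qed.

End ChainRule.

Section Transitions.
Context {R : realType} {m : nat} (N : smoothManifold R m).
Local Notation E := 'cV[R]_m.

Lemma coord_img_open (V : set N) i : open V -> open (coord_img V i).
Proof.
move=> oV; rewrite openE => x [p [Vp dp] <-].
have img : (chart i @` chart_dom i) (chart i p) by exists p.
have h1 := open_nbhs_nbhs (conj (@chart_img_open R m N i) img).
have h2 : \forall y \near chart i p, V (chart_inv i y).
  have c := chart_inv_continuous img; apply: c; rewrite (chartK dp).
  exact: open_nbhs_nbhs (conj oV Vp).
rewrite /interior /=; apply: filterS2 h1 h2 => y [r dr <-].
by rewrite (chartK dr) => Vr; exists r.
Qed.

Lemma overlap_open i j : open (chart (s := N) i @` (chart_dom i `&` chart_dom j)).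
Proof.
have -> : chart (s := N) i @` (chart_dom i `&` chart_dom j) = coord_img (chart_dom j) i.
  by rewrite /coord_img setIC.
exact: coord_img_open (@chart_dom_open R m N j).
Qed.

(** The chain rule at a point of three charts, used to transport tensors. *)
Lemma jac_transition_comp i j k (p : N) : chart_dom i p -> chart_dom j p ->
  chart_dom k p ->
  jac (transition i k) (chart i p) =
  jac (transition j k) (chart j p) *m jac (transition i j) (chart i p).
Proof.
move=> di dj dk.
have Tp a b : chart_dom a p -> transition a b (chart a p) = chart b p.
  by move=> da; rewrite /transition /= (chartK da).
have sT a b := @transition_smooth R m N a b.
have In a b : chart_dom a p -> chart_dom b p ->
    (chart a @` (chart_dom a `&` chart_dom b)) (chart a p) by move=> *; exists p.
have e v : 'D_v (transition i k) (chart i p) =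
    'D_v (transition j k \o transition i j) (chart i p).
  apply: near_eq_derive.
  have oI : open (coord_img (chart_dom j `&` chart_dom k) i : set E).
    by apply: coord_img_open; apply: openI; exact: chart_dom_open.
  have Ip : coord_img (chart_dom j `&` chart_dom k) i (chart i p) by exists p.
  apply: filterS (open_nbhs_nbhs (conj oI Ip)) => y [r [[jr kr] ir] <-].
  by rewrite /transition /= (chartK ir) (chartK jr).
have ds v : derivable (transition i j) (chart i p) v.
  exact: smooth_derivable (sT i j) (In i j di dj).
have dc v : 'D_v (transition j k \o transition i j) (chart i p) =
   jac (transition j k) (chart j p) *m (jac (transition i j) (chart i p) *m v).
  have Tj := Tp i j di.
  have [|_ ->] := @is_derive_comp_mx R m m 1 _ (transition i j) (transition j k)
     (chart i p) v (@overlap_open j k) (sT j k) _ (ds v).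
    by rewrite Tj; exact: In.
  rewrite Tj (jacE _ (@overlap_open j k) (sT j k) (In j k dj dk)).
  by rewrite (jacE _ (@overlap_open i j) (sT i j) (In i j di dj)).
apply/matrixP => a b.
have := e (basis_vec R b); rewrite dc (jacE _ (@overlap_open i k) (sT i k) (In i k di dk)).
by rewrite mulmxA /basis_vec -!colE => /matrixP/(_ a 0); rewrite ![col _ _ _ _]mxE.
Qed.

Lemma jac_transition_id i (p : N) : chart_dom i p ->
  jac (transition i i) (chart i p) = 1%:M.
Proof.
move=> di; have oI : open (coord_img (chart_dom i) i : set E).
  exact: coord_img_open (@chart_dom_open R m N i).
have Ip : coord_img (chart_dom i) i (chart i p) by exists p.
apply/matrixP => a b; rewrite mxE.
have -> : 'D_(basis_vec R b) (transition i i) (chart i p) = basis_vec R b.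
  rewrite -[RHS](derive_id (chart i p) (basis_vec R b)); apply: derive_on oI Ip _.
  by move=> y [r [_ ir] <-]; rewrite /transition /= (chartK ir).
by rewrite !mxE eqxx andbT.
Qed.

Lemma jac_transition_unit i j (p : N) : chart_dom i p -> chart_dom j p ->
  jac (transition i j) (chart i p) \in unitmx.
Proof.
move=> di dj; have := jac_transition_comp di dj di.
by rewrite jac_transition_id // => /esym/mulmx1_unit[].
Qed.

End Transitions.

(** * From one chart to all charts *)

Section Globalisation.
Context {R : realType} {m : nat} (N : smoothManifold R m).
Local Notation E := 'cV[R]_m.
Local Notation M := 'M[R]_m.
Variables (G : endo_subset N) (Gam0 : christoffel N).
Hypotheses (Glaw : endo_subset_law setT G)
  (Gbasis : forall i p, setT p -> chart_dom i p -> exists W I J K,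
     W (chart i p) /\ local_quaternion_basis G setT i W I J K)
  (conn0 : is_connection setT Gam0) (tf0 : torsion_free setT Gam0)
  (pres0 : preserves setT Gam0 G).
Variables (i0 : chart_idx N) (V : set N) (W : set E) (I J K g0 : E -> M)
  (C0 : 'I_m -> E -> M).
Hypotheses (oV : open V) (sV : V `<=` chart_dom i0)
  (VW : forall q, V q -> W (chart i0 q)).
Hypothesis qkt : chart_qkt W (Gam0 i0) I J K g0 C0.
Hypothesis relW : forall x, W x -> quaternion_relations (I x) (J x) (K x).
Hypothesis GW : forall x, W x -> G i0 x =
  [set A | exists a b c, A = a *: I x + b *: J x + c *: K x].

(** All tensors are given in the chart i0, and [frame] is the differential of the
    change to that chart. *)
Definition to_base j : E -> E := transition j i0.
Definition frame j y : M := jac (to_base j) y.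
Definition metricN : bilinear_field N := fun j y =>
  (frame j y)^T *m g0 (to_base j y) *m frame j y.
Definition changeN j (k : 'I_m) (y : E) : M :=
  invmx (frame j y) *m conn_mx C0 (to_base j y) (frame j y *m basis_vec R k) *m frame j y.
Definition connN : christoffel N := fun j k y => Gam0 j k y + changeN j k y.

Let oU j : open (coord_img V j : set E). Proof. exact: coord_img_open. Qed.

Let sub_setT j : coord_img V j `<=` coord_img [set: N] j.
Proof. by move=> y [q [Vq dq] <-]; exists q. Qed.

Let sub_overlap j : coord_img V j `<=` chart j @` (chart_dom j `&` chart_dom i0).
Proof. by move=> y [q [Vq dq] <-]; exists q => //; split=> //; exact: sV. Qed.

Let base_smooth j : smooth_on (coord_img V j) (to_base j).
Proof. exact: smooth_sub (sub_overlap (j := j)) (@transition_smooth R m N j i0). Qed.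

Let base_W j y : coord_img V j y -> W (to_base j y).
Proof.
move=> [q [Vq dq] <-]; rewrite /to_base /transition /= (chartK dq); exact: VW.
Qed.

Let frame_unit j y : coord_img V j y -> frame j y \in unitmx.
Proof. by move=> [q [Vq dq] <-]; apply: jac_transition_unit => //; exact: sV. Qed.

Let frame_smooth j : smooth_on (coord_img V j) (frame j).
Proof. exact: jac_smooth (@oU j) (@base_smooth j). Qed.

Lemma conn_mx_changeN j y v : conn_mx (changeN j) y v =
  invmx (frame j y) *m conn_mx C0 (to_base j y) (frame j y *m v) *m frame j y.
Proof.
apply: (@linear_conn_mx R m (fun y v => invmx (frame j y) *m
  conn_mx C0 (to_base j y) (frame j y *m v) *m frame j y)) => a u w /=.
by rewrite mulmxDr -scalemxAr conn_mx_lin mulmxDr -scalemxAr mulmxDl -scalemxAl.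
Qed.

Lemma conn_mx_connN j y v : conn_mx (connN j) y v =
  conn_mx (Gam0 j) y v + conn_mx (changeN j) y v.
Proof. exact: conn_mx_add. Qed.

Lemma frame_changeN j y v : coord_img V j y ->
  frame j y *m conn_mx (changeN j) y v =
  conn_mx C0 (to_base j y) (frame j y *m v) *m frame j y.
Proof. by move=> Uy; rewrite conn_mx_changeN !mulmxA mulmxV ?mul1mx // frame_unit. Qed.

Lemma bilin_metricN j y u v : bilin (metricN j y) u v =
  bilin (g0 (to_base j y)) (frame j y *m u) (frame j y *m v).
Proof. by rewrite /metricN bilinMr bilinMl. Qed.

Lemma metricN_smooth j : smooth_on (coord_img V j) (metricN j).
Proof.
have sg : smooth_on (coord_img V j) (fun y => g0 (to_base j y)).
  exact: (smooth_comp (@oU j) (chart_qkt_open qkt) (@base_W j) (@base_smooth j) (chart_qkt_metric qkt)).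
by apply: smooth_mulmx => //; apply: smooth_mulmx => //; exact: smooth_trmx.
Qed.

Lemma changeN_smooth j k : smooth_on (coord_img V j) (changeN j k).
Proof.
have sC l : smooth_on (coord_img V j) (fun y => C0 l (to_base j y)).
  exact: (smooth_comp (@oU j) (chart_qkt_open qkt) (@base_W j) (@base_smooth j) (chart_qkt_conn qkt l)).
have sF := @frame_smooth j.
apply: smooth_mulmx => //; apply: smooth_mulmx => //.
  by apply: smooth_invmx => // y Uy; exact: frame_unit.
apply: smooth_sum => // l; apply: smooth_scale => //.
apply: (smooth_entry l 0 (@oU j)); apply: smooth_mulmx => //; exact: smooth_cst.
Qed.

Lemma metricN_pos j y v : coord_img V j y -> v != 0 -> 0 < bilin (metricN j y) v v.
Proof.
move=> Uy v0; rewrite bilin_metricN; apply: (chart_qkt_pos qkt (base_W Uy)).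
apply: contraNneq v0 => Kv; rewrite -[v](mulKmx (frame_unit Uy)) Kv mulmx0 //.
Qed.

(** Compatibility of the frames with transitions, the source of all transformation
    laws below. *)
Lemma frame_law i j p : V p -> chart_dom i p -> chart_dom j p ->
  frame i (chart i p) = frame j (chart j p) *m jac (transition i j) (chart i p) /\
  to_base i (chart i p) = to_base j (chart j p).
Proof.
move=> Vp di dj; split; first by apply: jac_transition_comp => //; exact: sV.
by rewrite /to_base /transition /= (chartK di) (chartK dj).
Qed.

Lemma metricN_is_metric : is_metric V metricN.
Proof.
split=> [j|j y Uy|i j p Vp di dj /=].
- exact: metricN_smooth.
- split; last by apply: posdef_unit => v v0; exact: metricN_pos.
  by rewrite /metricN !trmx_mul trmxK (chart_qkt_sym qkt (base_W Uy)) mulmxA.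
- by rewrite /metricN; have [-> ->] := frame_law Vp di dj; rewrite trmx_mul !mulmxA.
Qed.

(** The affine transformation law of connections is stable under adding a tensor. *)
Lemma conn_law_add (A A' B B' T D : M) : A *m T = T *m A' - D -> B *m T = T *m B' ->
  (A + B) *m T = T *m (A' + B') - D.
Proof. by move=> eA eB; rewrite mulmxDl mulmxDr eA eB addrAC. Qed.

Lemma conn_law_conj (F F' T B B' C : M) : F \in unitmx -> F' = F *m T ->
  F *m B = C *m F -> F' *m B' = C *m F' -> B *m T = T *m B'.
Proof.
move=> Fu -> FB FB'; apply: (can_inj (mulKmx Fu)).
by rewrite mulmxA FB -mulmxA -FB' mulmxA.
Qed.

Lemma connN_is_connection : is_connection V connN.
Proof.
have [s0 l0] := conn0; split=> [j k|i j p Vp di dj /= v].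
  apply: (smoothD (@oU j)); last exact: changeN_smooth.
  exact: smooth_sub (sub_setT (j := j)) (s0 j k).
have h := l0 i j p (Logic.I) di dj v; cbv zeta in h.
set T := jac (transition i j) (chart i p) in h *.
have Ui : coord_img V i (chart i p) by exists p.
have Uj : coord_img V j (chart j p) by exists p.
have e : conn_mx (changeN j) (chart j p) (T *m v) *m T =
         T *m conn_mx (changeN i) (chart i p) v.
  have [fi bi] := frame_law Vp di dj; rewrite -/T in fi.
  have eT : frame j (chart j p) *m (T *m v) = frame i (chart i p) *m v by rewrite fi mulmxA.
  have ej := frame_changeN (T *m v) Uj; rewrite eT -bi in ej.
  exact: (conn_law_conj (frame_unit Uj) fi ej (frame_changeN v Ui)).
apply: etrans (congr1 (mulmx^~ T) (conn_mx_connN j (chart j p) (T *m v))) _.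
apply: etrans (conn_law_add h e) _; congr (_ - _); congr (_ *m _).
by rewrite -conn_mx_connN.
Qed.

(** The equation D g = C^T g + g C in the base chart, pulled back by F: with Dg the
    derivative of g along the image vector, F' that of F, and A, B the endomorphisms
    of the connection and of its change in the other chart, the sum of both makes
    F^T g F parallel. *)
Lemma pullback_metric_eq (F F' g Dg Ga C A B : M) :
  F *m A = Ga *m F - - F' -> F *m B = C *m F ->
  Dg - Ga^T *m g - g *m Ga = C^T *m g + g *m C ->
  ((F'^T *m g + F^T *m Dg) *m F + F^T *m g *m F')
  - (A + B)^T *m (F^T *m g *m F) - F^T *m g *m F *m (A + B) = 0.
Proof.
move=> FA FB hDg.
have e : F *m (A + B) = Ga *m F + F' + C *m F by rewrite mulmxDr FA FB opprK.
have -> : F^T *m g *m F *m (A + B) = F^T *m g *m (F *m (A + B)) by rewrite mulmxA.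
have -> : (A + B)^T *m (F^T *m g *m F) = (F *m (A + B))^T *m (g *m F).
  by rewrite trmx_mul !mulmxA.
have -> : Dg = Ga^T *m g + g *m Ga + (C^T *m g + g *m C).
  rewrite -hDg; move: (Ga^T *m g) (g *m Ga) => a b.
  mx_ring.
rewrite e.
have -> : (Ga *m F + F' + C *m F)^T = F^T *m Ga^T + F'^T + F^T *m C^T.
  by rewrite -!trmx_mul; apply/matrixP => i j; rewrite !mxE.
rewrite !(mulmxDl, mulmxDr) !mulmxA.
move: (F'^T *m g *m F) (F^T *m g *m F') (F^T *m Ga^T *m g *m F) (F^T *m C^T *m g *m F).
move: (F^T *m g *m Ga *m F) (F^T *m g *m C *m F) => x1 x2 x3 x4 x5 x6.
mx_ring.
Qed.

Lemma connN_metric : metric_connection V connN metricN.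
Proof.
move=> j y v Uy; have [q [Vq dq] qy] := Uy.
have dF : derivable (frame j) y v by exact: smooth_derivable (@frame_smooth j) Uy.
have ds : derivable (to_base j) y v by exact: smooth_derivable (@base_smooth j) Uy.
have [dg eg] := is_derive_comp_mx (chart_qkt_open qkt) (chart_qkt_metric qkt) (base_W Uy) ds.
rewrite (jacE v (@oU j) (@base_smooth j) Uy) -/(frame j y) in eg.
have [dFt eFt] := is_derive_trmx dF; have [dFg eFg] := is_derive_mulmx dFt dg.
have [_ eM] := is_derive_mulmx dFg dF.
have := chart_qkt_nabla qkt (frame j y *m v) (base_W Uy).
rewrite /nabla_bilin => hn.
have l := (proj2 conn0) j i0 q (Logic.I) dq (sV Vq) v; cbv zeta in l; rewrite qy in l.
have bq : chart i0 q = to_base j y.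
  by rewrite -qy /to_base /transition /= (chartK dq).
rewrite bq -/(to_base j) -/(frame j y) in l.
have lA : frame j y *m conn_mx (Gam0 j) y v =
    conn_mx (Gam0 i0) (to_base j y) (frame j y *m v) *m frame j y - - 'D_v (frame j) y.
  by rewrite l opprK subrK.
apply: etrans (pullback_metric_eq lA (frame_changeN v Uy) hn).
by rewrite -conn_mx_connN -eg -eFt -eFg -eM.
Qed.

Lemma span_of_G j y A : coord_img V j y -> G j y A <->
  qspan (I (to_base j y)) (J (to_base j y)) (K (to_base j y))
    (frame j y *m A *m invmx (frame j y)).
Proof.
move=> Uy; have [q [Vq dq] qy] := Uy.
have bq : chart i0 q = to_base j y.
  by rewrite -qy /to_base /transition /= (chartK dq).
have := Glaw Logic.I dq (sV Vq); cbv zeta; rewrite qy bq => h.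
by rewrite (h A) (GW (base_W Uy)).
Qed.

Lemma base_structure j y Q : coord_img V j y -> G j y Q -> Q *m Q = - 1%:M ->
  let Q' := frame j y *m Q *m invmx (frame j y) in
  [/\ qspan (I (to_base j y)) (J (to_base j y)) (K (to_base j y)) Q',
      Q' *m Q' = - 1%:M & forall v : E, Q' *m (frame j y *m v) = frame j y *m (Q *m v)].
Proof.
move=> Uy GQ QQ Q'; have Fu := frame_unit Uy.
have QF : Q' *m frame j y = frame j y *m Q by rewrite /Q' -mulmxA mulVmx // mulmx1.
split.
- exact: (proj1 (span_of_G Q Uy)).
- rewrite {2}/Q' !mulmxA QF -(mulmxA (frame j y)) QQ mulmxN mulmx1 mulNmx mulmxV //.
- by move=> v; rewrite mulmxA QF mulmxA.
Qed.

Lemma basis_in_G j W' I' J' K' y : local_quaternion_basis G V j W' I' J' K' -> W' y ->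
  [/\ coord_img V j y, G j y (I' y), G j y (J' y) & G j y (K' y)].
Proof.
move=> [[oW' sW'] _ _ GW'] Wy; rewrite (GW' y Wy); split; first exact: sW'.
- by exists 1, 0, 0; rewrite scale1r !scale0r !addr0.
- by exists 0, 1, 0; rewrite scale1r !scale0r add0r addr0.
- by exists 0, 0, 1; rewrite scale1r !scale0r !add0r.
Qed.

Lemma metricN_hermitian : Defs.hermitian V metricN G.
Proof.
move=> j W' I' J' K' lb y Wy u v; have [Uy GI GJ GK] := basis_in_G lb Wy.
have [_ _ rel _] := lb; have [II JJ KK _ _] := rel y Wy.
have key Q : G j y Q -> Q *m Q = - 1%:M ->
    bilin (metricN j y) (Q *m u) (Q *m v) = bilin (metricN j y) u v.
  move=> GQ QQ; have [sQ QQ' cQ] := base_structure Uy GQ QQ.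
  by rewrite !bilin_metricN -!cQ -bilinMr -bilinMl mulmxA
    (qspan_herm (relW (base_W Uy)) (chart_qkt_herm qkt (base_W Uy)) sQ QQ').
by split; apply: key.
Qed.

Lemma connN_preserves : preserves V connN G.
Proof.
move=> j W' A [oW' sW'] sA GA y v Wy; have Uy := sW' y Wy; have Fu := frame_unit Uy.
have e : nabla_endo (connN j) v A y = nabla_endo (Gam0 j) v A y +
    (conn_mx (changeN j) y v *m A y - A y *m conn_mx (changeN j) y v).
  rewrite /nabla_endo conn_mx_connN; move: (conn_mx (Gam0 j) y v) (conn_mx (changeN j) y v) => a b.
  rewrite (mulmxDl a) (mulmxDr (A y) a).
  move: ('D_v A y) (a *m _) (b *m _) (_ *m a) (_ *m b) => x1 x2 x3 x4 x5.
  mx_ring.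
have GN : G j y (nabla_endo (Gam0 j) v A y).
  by apply: pres0 Wy => //; split=> // z /sW' /sub_setT.
rewrite e; apply/(span_of_G _ Uy); rewrite mulmxDr mulmxDl.
apply: qspanD; first exact: (proj1 (span_of_G _ Uy)).
have /(span_of_G _ Uy) := GA y Wy.
have FB := frame_changeN v Uy.
have -> : frame j y *m (conn_mx (changeN j) y v *m A y - A y *m conn_mx (changeN j) y v)
     *m invmx (frame j y) =
   conn_mx C0 (to_base j y) (frame j y *m v) *m (frame j y *m A y *m invmx (frame j y))
   - (frame j y *m A y *m invmx (frame j y)) *m conn_mx C0 (to_base j y) (frame j y *m v).
  rewrite mulmxBr mulmxBl !mulmxA FB; congr (_ - _).
  have BF : conn_mx (changeN j) y v *m invmx (frame j y) =
      invmx (frame j y) *m conn_mx C0 (to_base j y) (frame j y *m v).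
    apply: (can_inj (mulKmx Fu)); rewrite mulmxA FB mulmxA mulmxV // mul1mx.
    by rewrite -mulmxA mulmxV // mulmx1.
  by rewrite -!(mulmxA (frame j y *m A y)) BF.
move: (frame j y *m A y *m _) => Q [a [b [c ->]]].
have [[a1 [b1 [c1 e1]]] [a2 [b2 [c2 e2]]] [a3 [b3 [c3 e3]]]] :=
  chart_qkt_span qkt (frame j y *m v) (base_W Uy).
move: (conn_mx C0 _ _) e1 e2 e3 => B e1 e2 e3.
exists (a * a1 + b * a2 + c * a3), (a * b1 + b * b2 + c * b3), (a * c1 + b * c2 + c * c3).
rewrite !mulmxDr !mulmxDl -!scalemxAl -!scalemxAr.
transitivity (a *: (B *m I (to_base j y) - I (to_base j y) *m B) +
  b *: (B *m J (to_base j y) - J (to_base j y) *m B) +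
  c *: (B *m K (to_base j y) - K (to_base j y) *m B)).
  move: (_ *m I _) (I _ *m _) (_ *m J _) (J _ *m _) (_ *m K _) (K _ *m _) => x1 x2 x3 x4 x5 x6.
  mx_ring.
rewrite e1 e2 e3; move: (I _) (J _) (K _) => x1 x2 x3.
mx_ring.
Qed.

Lemma torsion_constant (Ga : 'I_m -> E -> M) u v x :
  torsion Ga (fun=> u) (fun=> v) x = conn_mx Ga x u *m v - conn_mx Ga x v *m u.
Proof. 
have d (w z : E) : 'D_w (fun=> z : E) x = 0 by exact: derive_cst.
by rewrite /torsion /nabla /bracket /= !d !add0r !oppr0 addr0.
Qed.

Lemma torsion_free_sym j y u v : coord_img [set: N] j y ->
  conn_mx (Gam0 j) y u *m v = conn_mx (Gam0 j) y v *m u.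
Proof.
move=> Uy; apply/eqP; rewrite -subr_eq0 -torsion_constant; apply/eqP.
have oT : open (coord_img [set: N] j : set E) by apply: coord_img_open; exact: openT.
have sc (w : E) : smooth_on (coord_img [set: N] j) (fun=> w) by exact: smooth_cst.
exact: (tf0 (conj oT (@subset_refl _ (coord_img [set: N] j))) (sc u) (sc v) Uy).
Qed.

(** The torsion form transported from the base chart. *)
Definition torsionN j y (u v w : E) : R :=
  skew_part (g0 (to_base j y)) (conn_mx C0 (to_base j y))
    (frame j y *m u) (frame j y *m v) (frame j y *m w).

Lemma torsion_formN j y a b c : coord_img V j y ->
  torsion_form (connN j) (metricN j) y a b c =
  torsionN j y (basis_vec R a) (basis_vec R b) (basis_vec R c).
Proof.
move=> Uy; rewrite /torsion_form torsion_constant /torsionN /skew_part bilin_metricN.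
congr (bilin _ _ _); move: (basis_vec R b) (basis_vec R c) => u v.
have h := torsion_free_sym u v (sub_setT Uy).
rewrite (conn_mx_connN j y u) (conn_mx_connN j y v).
rewrite (mulmxDl (conn_mx (Gam0 j) y u)) (mulmxDl (conn_mx (Gam0 j) y v)) h.
rewrite [X in _ *m X](_ : _ = conn_mx (changeN j) y u *m v - conn_mx (changeN j) y v *m u).
  by rewrite mulmxBr !mulmxA !frame_changeN.
move: (_ *m u) (_ *m v) (conn_mx (changeN j) y v *m u) => x1 x2 x3.
mx_ring.
Qed.

Lemma torsionN_trilinear j y : trilinear3 (torsionN j y).
Proof.
rewrite /torsionN /skew_part; split=> a u v w z.
- by rewrite mulmxDr -scalemxAr bilinDl bilinZl.
- rewrite mulmxDr -scalemxAr conn_mx_lin mulmxDl -scalemxAl mulmxDr -scalemxAr.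
  by rewrite opprD addrACA bilinDr -scalerBr bilinZr.
- rewrite mulmxDr -scalemxAr conn_mx_lin mulmxDl -scalemxAl mulmxDr -scalemxAr.
  by rewrite opprD addrACA bilinDr -scalerBr bilinZr.
Qed.

Lemma eval3_torsion j y u v w : coord_img V j y ->
  eval3 (torsion_form (connN j) (metricN j) y) u v w = torsionN j y u v w.
Proof.
move=> Uy; rewrite -(eval3_trilinear (torsionN_trilinear j y)).
by apply: eq_bigr => a _; apply: eq_bigr => b _; apply: eq_bigr => c _; rewrite torsion_formN.
Qed.

Lemma torsion_totally_skew j y : coord_img V j y ->
  totally_skew (torsion_form (connN j) (metricN j) y).
Proof.
move=> Uy u v w; rewrite !eval3_torsion //.
exact: (chart_qkt_skew qkt _ _ _ (base_W Uy)).
Qed.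

Lemma torsion_type_mixed j W' I' J' K' y :
  local_quaternion_basis G V j W' I' J' K' -> W' y ->
  type_21_12 (I' y) (torsion_form (connN j) (metricN j) y).
Proof.
move=> lb Wy; have [Uy GI _ _] := basis_in_G lb Wy.
have [_ _ rel _] := lb; have [II _ _ _ _] := rel y Wy.
have [sQ QQ cQ] := base_structure Uy GI II.
apply: type_21_12_of => // [|u v w]; first exact: torsion_totally_skew.
rewrite !eval3_torsion // /torsionN -!cQ.
exact: (chart_qkt_type qkt _ _ _ (base_W Uy) sQ QQ).
Qed.

Lemma almost_quaternionic_sub : almost_quaternionic V G.
Proof.
split=> [i j p Vp|i p Vp di]; first exact: Glaw.
have [W1 [I1 [J1 [K1 [Wp [[oW1 sW1] [sI sJ sK] rel GW1]]]]]] := Gbasis (p := p) Logic.I di.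
exists (W1 `&` coord_img V i), I1, J1, K1; split; first by split=> //; exists p.
have sub : W1 `&` coord_img V i `<=` W1 by move=> z [].
split.
- by split; [apply: openI => //; exact: oU | move=> z []].
- by split; apply: smooth_sub sub _.
- by move=> z [/rel].
- by move=> z [/GW1].
Qed.

End Globalisation.

(** Dimension 4 and higher dimensions need different metrics. *)
Lemma chart_qkt_ex (R : realType) (n : nat) (W : set 'cV[R]_(4 * n)) Gam I J K x :
  (0 < n)%N -> adapted W Gam I J K -> W x ->
  exists W' g C, [/\ W' `<=` W, W' x & chart_qkt W' Gam I J K g C].
Proof.
case: n W Gam I J K x => [|[|n]] // W Gam I J K x _ ad Wx.
  by have [g [C qkt]] := chart_qkt_four (erefl 4%N) ad; exists W, g, C; split.
apply: chart_qkt_large ad Wx => //; rewrite (ltr_nat R 4).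
by apply: (@leq_trans (4 * 2)); rewrite // leq_pmul2l.
Qed.

Lemma adapted_of (R : realType) (m : nat) (N : smoothManifold R m) (G : endo_subset N)
    (Gam : christoffel N) i W I J K :
  is_connection setT Gam -> torsion_free setT Gam -> preserves setT Gam G ->
  local_quaternion_basis G setT i W I J K -> adapted W (Gam i) I J K.
Proof.
move=> [sG _] tf pres lb; have [[oW sW] [sI sJ sK] rel GW] := lb.
split=> // [k|x /sW Ux u v|x Wx v].
- exact: smooth_sub sW (sG i k).
- exact: torsion_free_sym.
have key A : smooth_on W A -> (forall z, W z -> G i z (A z)) ->
    qspan (I x) (J x) (K x) (nabla_endo (Gam i) v A x).
  by move=> sA GA; have := pres i W A (conj oW sW) sA GA x v Wx; rewrite GW.
by split; apply: key => // z Wz; have [_ ? ? ?] := basis_in_G lb Wz.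
Qed.

Theorem proposition6p5 (R : realType) (n : nat) (hn : (0 < n)%N)
    (N : smoothManifold R (4 * n)%N) (G : endo_subset N)
    (hG : quaternionic_manifold G) :
  forall p : N, exists V : set N, [/\ open V, V p &
    exists (g : bilinear_field N) (Gam : christoffel N),
      QKT_structure V g G Gam /\ positive_definite V g].
Proof.
move=> p; have [[Glaw Gbasis] [Gam0 [conn0 tf0 pres0]] _] := hG.
have [i0 d0] := chart_cover p.
have [W0 [I [J [K [W0p lb]]]]] := Gbasis i0 p Logic.I d0.
have ad := adapted_of conn0 tf0 pres0 lb.
have [W [g0 [C0 [sW Wp qkt]]]] := chart_qkt_ex hn ad W0p.
have [[oW0 sW0] _ rel GW0] := lb.
pose V : set N := [set q | chart_dom i0 q /\ W (chart i0 q)].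
have oV : open V.
  rewrite openE => q [dq Wq]; apply: filterI.
    exact: open_nbhs_nbhs (conj (@chart_dom_open R (4 * n)%N N i0) dq).
  exact: (chart_continuous dq (open_nbhs_nbhs (conj (chart_qkt_open qkt) Wq))).
have sV : V `<=` chart_dom i0 by move=> q [].
have VW q : V q -> W (chart i0 q) by case.
have relW x : W x -> quaternion_relations (I x) (J x) (K x) by move=> /sW/rel.
have GW x : W x -> G i0 x = [set A | exists a b c, A = a *: I x + b *: J x + c *: K x].
  by move=> /sW/GW0.
exists V; split=> //.
exists (metricN i0 g0), (connN Gam0 i0 C0); split.
  split.
  - exact: almost_quaternionic_sub.
  - by split; [exact: metricN_is_metric qkt | exact: metricN_hermitian qkt relW GW].
  - exact: connN_is_connection qkt.
  - by split; [exact: connN_metric qkt | exact: connN_preserves qkt GW].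
  - split=> [i x Ux|i W' I' J' K' lb' x Wx]; first exact: (torsion_totally_skew tf0 sV VW qkt Ux).
    exact: (torsion_type_mixed Glaw tf0 sV VW qkt GW lb' Wx).
by move=> i x Ux v v0; exact: (metricN_pos sV VW qkt Ux v0).
Qed.
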